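(* Let $C$ be the Klein quartic, let $R_1\in C\setminus\{e_1,e_2,e_3\}$ be a point with $\psi(R_1)\in C$, set $R_i=\varphi^{i-1}(R_1)$ and let $P=(L_1,\dots,L_7)$ with $L_1=\overline{R_6R_1}, L_2=\overline{R_7R_2}, L_3=\overline{R_1R_3}, L_4=\overline{R_2R_4}, L_5=\overline{R_3R_5}, L_6=\overline{R_4R_6}, L_7=\overline{R_5R_7}$ (this is a heptagon with adjoint $C$ and associated theta characteristic $\eta_{\mathrm{sym}}$). Then: (1) $\operatorname{Aut}(C)$, acting by $\sigma\cdot(L_1,\dots,L_7)=(\sigma(L_1),\dots,\sigma(L_7))$, acts freely on the orbit of $P$; each $\sigma(P)$ is a heptagon with adjoint $C$ and associated theta characteristic $\eta_{\mathrm{sym}}$; and $\varphi$ acts on $P$ by a cyclic permutation of the labels, so this orbit consists of $168$ heptagons, i.e. $24$ modulo cyclic relabeling. (2) The set of heptagons with adjoint $C$ and associated theta characteristic $\eta_{\mathrm{sym}}$ contains the union of the $\operatorname{Aut}(C)$-orbits of $(L_1,\dots,L_7)$ and of $(L_7,\dots,L_1)$, which consists of $336=14\times24$ distinct heptagons.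
   Context: Work over $\mathbb{C}$. The Klein quartic is $C=\{x^3y+y^3z+z^3x=0\}\subset\mathbb{P}^2$, with $|\operatorname{Aut}(C)|=168$, acting linearly on $\mathbb{P}^2$. Let $e_1=[1:0:0],e_2=[0:1:0],e_3=[0:0:1]$, $\zeta$ a primitive seventh root of unity, $\varphi\colon[x:y:z]\mapsto[\zeta^4x:\zeta^2y:\zeta z]$, and $\psi\colon\mathbb{P}^2\to\mathbb{P}^2$, $[x:y:z]\mapsto[(\zeta^4+2\zeta^2-2\zeta-\zeta^6)x:(\zeta^2+2\zeta-2\zeta^4-\zeta^3)y:(\zeta+2\zeta^4-2\zeta^2-\zeta^5)z]$ (for $p\in C$, $\psi(p)$ is the intersection point of the lines $\overline{p\,\varphi^2(p)}$ and $\overline{\varphi^4(p)\,\varphi^6(p)}$). $\overline{pq}$ is the line through $p,q$. $\eta_{\mathrm{sym}}$ is the unique $\operatorname{Aut}(C)$-invariant even theta characteristic of $C$, with $\eta_{\mathrm{sym}}+H\sim 2(e_1+e_2+e_3)$. A heptagon is an ordered $7$-tuple of distinct lines with no three concurrent; its residual points are the $14$ points $L_i\cap L_j$ with $i,j$ non-consecutive mod $7$; its adjoint is the unique quartic through them; the associated theta characteristic is $\sum_{\text{residual }p}p-3H$ on the (smooth) adjoint. *)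

(* Defs.v *)
From HB Require Import structures.
From mathcomp Require Import all_boot all_order all_algebra all_field.
From mathcomp Require Import mpoly.
Set Implicit Arguments. Unset Strict Implicit. Unset Printing Implicit Defensive.
Import Order.TTheory GRing.Theory Num.Theory.
Local Open Scope ring_scope.

Section Plane.
Variable K : numClosedFieldType.

(* Points of P^2 and lines of P^2 are represented by nonzero column vectors
   of K^3 (homogeneous coordinates), considered up to nonzero scalars.     *)
Definition vec := 'cV[K]_3.

Definition form := {mpoly K[3]}.

Definition ev (G : form) (x : vec) : K := G.@[fun i => x i 0].

Definition proj_eq (u v : vec) : bool :=
  [&& u != 0, v != 0 & \rank (row_mx u v) == 1%N].

Definition on_line (a x : vec) : Prop := a^T *m x = 0.

(* coefficient vector of the line through two points (cross product);
   also the intersection point of two lines *)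
Definition cross (u v : vec) : vec :=
  \col_(i < 3) (u (i + 1) 0 * v (i + 2) 0 - u (i + 2) 0 * v (i + 1) 0).

Definition e_pt (i : 'I_3) : vec := \col_(j < 3) (if j == i then 1 else 0).

Definition kleinF : form :=
  'X_0 ^+ 3 * 'X_1 + 'X_1 ^+ 3 * 'X_2 + 'X_2 ^+ 3 * 'X_0.

Definition phiM (z : K) : 'M[K]_3 :=
  diag_mx (\row_(i < 3) [:: z ^+ 4; z ^+ 2; z]`_i).
Definition psiM (z : K) : 'M[K]_3 :=
  diag_mx (\row_(i < 3)
    [:: z ^+ 4 + 2 * z ^+ 2 - 2 * z - z ^+ 6;
        z ^+ 2 + 2 * z - 2 * z ^+ 4 - z ^+ 3;
        z + 2 * z ^+ 4 - 2 * z ^+ 2 - z ^+ 5]`_i).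

(* Aut(C) : projective linear maps (invertible 3x3 matrices up to scalar)
   mapping the curve {F = 0} onto itself *)
Definition isAut (F : form) (M : 'M[K]_3) : Prop :=
  M \in unitmx /\ forall x : vec, ev F x = 0 <-> ev F (M *m x) = 0.

Definition is_scalar_proj (M : 'M[K]_3) : Prop := exists c : K, M = c%:M.

(* action of a projective linear map on lines: x |-> M x sends the line a
   to the line (M^-1)^T a *)
Definition act_line (M : 'M[K]_3) (a : vec) : vec := (invmx M)^T *m a.

Definition tuple7 := 'I_7 -> vec.

Definition act7 (M : 'M[K]_3) (L : tuple7) : tuple7 := fun i => act_line M (L i).

Definition eq7 (L L' : tuple7) : Prop := forall i, proj_eq (L i) (L' i).

Definition eq7_cyc (L L' : tuple7) : Prop :=
  exists r : 'I_7, forall i, proj_eq (L i) (L' (i + r)).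

Definition rev7 (L : tuple7) : tuple7 := fun i => L (rev_ord i).

Definition heptagon (L : tuple7) : Prop :=
  (forall i, L i != 0) /\
  (forall i j, i != j -> ~~ proj_eq (L i) (L j)) /\
  (forall i j k, i != j -> j != k -> i != k ->
     ~ (exists x : vec, x != 0 /\ on_line (L i) x /\ on_line (L j) x
                              /\ on_line (L k) x)).

Definition nonconsec (i j : 'I_7) : bool :=
  [&& i != j, j != i + 1 & i != j + 1].

Definition residual_pairs : seq ('I_7 * 'I_7) :=
  [seq ij <- [seq (i, j) | i : 'I_7 <- enum 'I_7, j : 'I_7 <- enum 'I_7]
     | (val ij.1 < val ij.2)%N && nonconsec ij.1 ij.2].

Definition residual_pts (L : tuple7) : seq vec :=
  [seq cross (L ij.1) (L ij.2) | ij <- residual_pairs].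

Definition adjoint_is (L : tuple7) (G : form) : Prop :=
  forall Q : form, Q \is 4.-homog ->
    ((forall p, p \in residual_pts L -> ev Q p = 0) <-> exists c : K, Q = c *: G).

(* membership in I_x^k, the k-th power of the homogeneous ideal I_x of the
   point x, which is generated by the linear forms vanishing at x *)
Definition in_pt_ideal_pow (x : vec) (k : nat) (H : form) : Prop :=
  exists (n : nat) (A : 'I_n -> form) (l : 'I_n -> 'I_k -> form),
    (forall i j, l i j \is 1.-homog /\ ev (l i j) x = 0) /\
    H = \sum_(i < n) A i * \prod_(j < k) l i j.

(* ord_x(G|_C) >= k : the image of G in the local ring O_{C,x} lies in
   the k-th power of its maximal ideal *)
Definition ord_ge (F : form) (x : vec) (G : form) (k : nat) : Prop :=
  exists (B A H : form) (d : nat),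
    B \is d.-homog /\ ev B x != 0 /\ in_pt_ideal_pow x k H /\ B * G = A * F + H.

Definition ord_eq (F : form) (x : vec) (G : form) (k : nat) : Prop :=
  ord_ge F x G k /\ ~ ord_ge F x G k.+1.

(* divisors on C: functions from (representatives of) points to int.
   A "divisor class expression" (D, n) stands for D + n H, H the class of a
   line section.  (D1, n1) ~ (D2, n2) iff D1 - D2 = div(G1) - div(G2) for
   forms G1, G2 not vanishing identically on C with
   deg G1 - deg G2 = n2 - n1 (i.e. D1 - D2 ~ (n2 - n1) H). *)
Definition divisor := vec -> int.

Definition lin_equiv (F : form) (D1 : divisor) (n1 : int) (D2 : divisor) (n2 : int)
  : Prop :=
  (forall x, x != 0 -> ev F x != 0 -> D1 x = D2 x) /\
  exists (G1 G2 : form) (d1 d2 : nat),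
    G1 \is d1.-homog /\ G2 \is d2.-homog /\
    (d1%:Z + n1 = d2%:Z + n2) /\
    ~ (exists A, G1 = A * F) /\ ~ (exists A, G2 = A * F) /\
    forall x, x != 0 -> ev F x = 0 ->
      exists k1 k2 : nat, ord_eq F x G1 k1 /\ ord_eq F x G2 k2 /\
        k1%:Z - k2%:Z = D1 x - D2 x.

Definition div_of_pts (s : seq vec) : divisor :=
  fun x => (count (proj_eq x) s)%:Z.

Definition eta_sym_div : divisor := fun x => 2%:Z * (div_of_pts [:: e_pt 0; e_pt 1; e_pt 2] x).
Definition eta_sym_H : int := -1.

Definition theta_is_eta_sym (F : form) (L : tuple7) : Prop :=
  lin_equiv F (div_of_pts (residual_pts L)) (-3) eta_sym_div eta_sym_H.

Definition good_heptagon (L : tuple7) : Prop :=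
  heptagon L /\ adjoint_is L kleinF /\ theta_is_eta_sym kleinF L.

(* the heptagon P built from R_1 : R_i = phi^(i-1)(R_1),
   L_i = line(R_{i-2}, R_i) (indices mod 7); here 0-based: index i <-> L_{i+1} *)
Definition kleinP (z : K) (R1 : vec) : tuple7 :=
  fun i => cross (phiM z ^+ ((i + 5) %% 7) *m R1) (phiM z ^+ i *m R1).

Definition orbit7 (P : tuple7) (Q : tuple7) : Prop :=
  exists M, isAut kleinF M /\ eq7 Q (act7 M P).

Definition n_classes (T : Type) (A : T -> Prop) (eqv : T -> T -> Prop) (n : nat) : Prop :=
  exists s : 'I_n -> T,
    (forall i, A (s i)) /\
    (forall i j, eqv (s i) (s j) -> i = j) /\
    (forall x, A x -> exists i, eqv x (s i)).

End Plane.

(* Main.v *)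
Require Import Defs.
From HB Require Import structures.
From mathcomp Require Import all_boot all_order all_algebra all_field.
From mathcomp Require Import mpoly.
From mathcomp Require Import ring zify.
Import Order.TTheory GRing.Theory Num.Theory.
Local Open Scope ring_scope.
Set Implicit Arguments. Unset Strict Implicit. Unset Printing Implicit Defensive.

(** Write a = x^3 y, b = y^3 z, c = z^3 x. On C one has a + b + c = 0, and (a : b : c) is the
    quotient of C by phi. As phi, psi are diagonal, the hypotheses on R_1 determine (a : b : c)
    at R_1 and psi(R_1); the residual points of P are the 14 points of these two fibres.

    Heptagon: three concurrent lines would give three distinct seventh roots of unity that are
    roots of a polynomial X t^3 + Y t + W, hence have sum 0, which is impossible.
    Adjoint: a quartic vanishing on the residual points splits into phi-eigenforms; each eigenspace
    other than that of F has dimension 2, and the two fibres impose independent conditions on it.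
    Theta characteristic: let q be the product of the linear forms in a, b cutting out the two
    fibres. Then q / (xyz)^2 has divisor (residual points) - 2 (e_1 + e_2 + e_3). If S is the
    involution of C, the cubic x^2 y + y^2 z + z^2 x + x y z has divisor 2 sum e_i + 2 sum S e_i,
    so the class of 2 sum e_i - H is S-invariant as well.
    Automorphisms: M maps the flex e_1 to a flex, so to an e_i or to some phi^k S e_j; an
    automorphism that fixes e_1 is a power of phi. This gives 24 * 7 automorphisms, and P is only
    fixed by scalars because it contains four lines in general position. No projective map reverses
    the labels of P, since it would conjugate phi to its inverse. *)

(** * Projective points and lines *)

(** Three definitions shape the proof. [ord_eq] denies that any identity witnesses a higher order,
    so upper bounds on orders need an argument of their own: pulling back along a polynomial arc on
    which F vanishes to high order. Order 10 suffices at the e_i, since the forms that occur have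
    order at most 8 there, and order 2 at a general point; orders at S e_i are transported from e_i.
    [isAut] compares zero sets only; the uniqueness of the adjoint of P turns this into F o M = c F.
    [lin_equiv] asserts the existence of two forms, and its transitivity would need additivity of
    orders at every point. It is avoided: with D the residual divisor, D - 3 H is shown equivalent
    both to 2 sum e_i - H and to 2 sum S e_i - H, each time with explicit forms. The root z enters
    only through its minimal equation: equalities in Z[zeta] are ring identities modulo that
    equation, and an element is shown nonzero by exhibiting a multiple of it that is a positive
    integer. *)

Section Projective.
Variable K : numClosedFieldType.
Implicit Types (u v w a b : vec K) (M N : 'M[K]_3).

Lemma ord3P (P : 'I_3 -> Prop) : P 0 -> P 1 -> P 2%:R -> forall i, P i.
Proof.
move=> P0 P1 P2 [[|[|[|i]]] hi] //.
- by rewrite (_ : Ordinal hi = 0) //; apply/val_inj.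
- by rewrite (_ : Ordinal hi = 1) //; apply/val_inj.
- by rewrite (_ : Ordinal hi = 2%:R) //; apply/val_inj.
Qed.

Definition col3 (x y w : K) : vec K := \col_(i < 3) [:: x; y; w]`_i.

Lemma col3E (x y w : K) : (col3 x y w 0 0 = x) * (col3 x y w 1 0 = y) * (col3 x y w 2%:R 0 = w).
Proof. by rewrite !mxE. Qed.

Lemma vecP u v : u 0 0 = v 0 0 -> u 1 0 = v 1 0 -> u 2%:R 0 = v 2%:R 0 -> u = v.
Proof. by move=> h0 h1 h2; apply/colP; apply: ord3P. Qed.

Lemma col3P u : u = col3 (u 0 0) (u 1 0) (u 2%:R 0).
Proof. by apply: vecP; rewrite !col3E. Qed.

Lemma col3_inj (x y w x' y' w' : K) : col3 x y w = col3 x' y' w' -> [/\ x = x', y = y' & w = w'].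
Proof.
move=> h; have := (congr1 (fun t : vec K => t 0 0) h, congr1 (fun t : vec K => t 1 0) h,
  congr1 (fun t : vec K => t 2%:R 0) h).
by rewrite !col3E => -[[-> ->] ->].
Qed.

Lemma col3Z (c x y w : K) : c *: col3 x y w = col3 (c * x) (c * y) (c * w).
Proof. by apply: vecP; rewrite !mxE. Qed.

Lemma col3D (x y w x' y' w' : K) :
  col3 x y w + col3 x' y' w' = col3 (x + x') (y + y') (w + w').
Proof. by apply: vecP; rewrite !mxE. Qed.

Lemma sum3 (V : nmodType) (f : 'I_3 -> V) : \sum_(i < 3) f i = f 0 + f 1 + f 2%:R.
Proof.
rewrite !big_ord_recl big_ord0 addr0 addrA; congr (_ + f _ + f _).
  exact/val_inj.
exact/val_inj.
Qed.

Lemma prod3 (V : comNzRingType) (f : 'I_3 -> V) : \prod_(i < 3) f i = f 0 * f 1 * f 2%:R.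
Proof.
rewrite !big_ord_recl big_ord0 mulr1 mulrA; congr (_ * f _ * f _); exact/val_inj.
Qed.

Lemma mulmx3 M u :
  M *m u = col3 (M 0 0 * u 0 0 + M 0 1 * u 1 0 + M 0 2%:R * u 2%:R 0)
                (M 1 0 * u 0 0 + M 1 1 * u 1 0 + M 1 2%:R * u 2%:R 0)
                (M 2%:R 0 * u 0 0 + M 2%:R 1 * u 1 0 + M 2%:R 2%:R * u 2%:R 0).
Proof. by apply: vecP; rewrite mxE sum3 col3E. Qed.

Lemma on_lineE a x :
  on_line a x <-> a 0 0 * x 0 0 + a 1 0 * x 1 0 + a 2%:R 0 * x 2%:R 0 = 0.
Proof.
rewrite /on_line; split=> [/matrixP/(_ 0 0)|h].
  by rewrite mxE sum3 !mxE.
by apply/matrixP=> i j; rewrite !ord1 mxE sum3 !mxE.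
Qed.

Lemma crossE u v :
  cross u v = col3 (u 1 0 * v 2%:R 0 - u 2%:R 0 * v 1 0)
                   (u 2%:R 0 * v 0 0 - u 0 0 * v 2%:R 0)
                   (u 0 0 * v 1 0 - u 1 0 * v 0 0).
Proof.
apply: vecP; rewrite mxE col3E /=.
- by congr (u _ _ * v _ _ - u _ _ * v _ _); apply/val_inj.
- by congr (u _ _ * v _ _ - u _ _ * v _ _); apply/val_inj.
- by congr (u _ _ * v _ _ - u _ _ * v _ _); apply/val_inj.
Qed.

Lemma det3 M : \det M =
  M 0 0 * (M 1 1 * M 2%:R 2%:R - M 1 2%:R * M 2%:R 1)
  - M 0 1 * (M 1 0 * M 2%:R 2%:R - M 1 2%:R * M 2%:R 0)
  + M 0 2%:R * (M 1 0 * M 2%:R 1 - M 1 1 * M 2%:R 0).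
Proof.
rewrite (expand_det_row _ 0) sum3 /cofactor.
have d2 (B : 'M[K]_2) : \det B = B 0 0 * B 1 1 - B 0 1 * B 1 0.
  rewrite (expand_det_row _ 0) !big_ord_recl big_ord0 /cofactor !det_mx11 !mxE /=.
  have -> : lift 0 0 = 1 :> 'I_2 by apply/val_inj.
  have -> : lift 1 0 = 0 :> 'I_2 by apply/val_inj.
  by rewrite /= expr0 expr1; ring.
rewrite !d2 !mxE.
have l00 : lift 0 0 = 1 :> 'I_3 by apply/val_inj.
have l01 : lift 0 1 = 2%:R :> 'I_3 by apply/val_inj.
have l10 : lift 1 0 = 0 :> 'I_3 by apply/val_inj.
have l11 : lift 1 1 = 2%:R :> 'I_3 by apply/val_inj.
have l20 : lift 2%:R 0 = 0 :> 'I_3 by apply/val_inj.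
have l21 : lift 2%:R 1 = 1 :> 'I_3 by apply/val_inj.
rewrite l00 l01 l10 l11 l20 l21 /=.
ring.
Qed.

Lemma proj_eqP u v :
  reflect (v != 0 /\ exists2 c, c != 0 & u = c *: v) (proj_eq u v).
Proof.
have tr1 (w : vec K) : w != 0 -> \rank w^T = 1%N.
  by move=> w0; rewrite rank_rV trmx_eq0 w0.
have rk : \rank (row_mx u v) = \rank (col_mx v^T u^T).
  by rewrite -mxrank_tr tr_row_mx -!addsmxE addsmxC.
rewrite /proj_eq rk -addsmxE; apply: (iffP and3P) => [[u0 v0 /eqP h]|[v0 [c c0 ->]]].
  split=> //; have : (u^T <= v^T)%MS.
    have := mxrank_leqif_sup (addsmxSl v^T u^T); rewrite tr1 // h => /leqif_refl.
    by move=> /(submx_trans (addsmxSr _ _)).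
  case/sub_rVP => c hc; exists c; last by apply: trmx_inj; rewrite hc linearZ.
  by apply: contraNneq u0 => c0; rewrite -[u]trmxK hc c0 scale0r trmx0.
split=> //; first by rewrite scaler_eq0 negb_or c0.
apply/eqP; rewrite linearZ /=; apply: etrans (tr1 _ v0); apply/eqmx_rank/andP; split; last exact: addsmxSl.
by rewrite addsmx_sub submx_refl scalemx_sub ?submx_refl.
Qed.

Lemma proj_eq_refl u : u != 0 -> proj_eq u u.
Proof. by move=> u0; apply/proj_eqP; split=> //; exists 1; rewrite ?oner_eq0 ?scale1r. Qed.

Lemma proj_eq_sym u v : proj_eq u v = proj_eq v u.
Proof.
suff h a b : proj_eq a b -> proj_eq b a by apply/idP/idP; apply: h.
case/proj_eqP=> b0 [c c0 ->]; apply/proj_eqP; split.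
  by rewrite scaler_eq0 negb_or c0.
by exists c^-1; rewrite ?invr_eq0 // scalerA mulVf // scale1r.
Qed.

Lemma proj_eq_trans v u w : proj_eq u v -> proj_eq v w -> proj_eq u w.
Proof.
case/proj_eqP=> v0 [c c0 ->] /proj_eqP[w0 [d d0 ->]]; apply/proj_eqP; split=> //.
by exists (c * d); rewrite ?mulf_neq0 // scalerA.
Qed.

Lemma proj_eq_congl u v w : proj_eq u v -> proj_eq u w = proj_eq v w.
Proof.
move=> uv; apply/idP/idP; last exact: proj_eq_trans.
by apply: proj_eq_trans; rewrite proj_eq_sym.
Qed.

Lemma proj_eq_congr u v w : proj_eq u v -> proj_eq w u = proj_eq w v.
Proof. by move=> uv; rewrite ![proj_eq w _]proj_eq_sym (proj_eq_congl _ uv). Qed.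

Lemma proj_eqZ c u : c != 0 -> u != 0 -> proj_eq (c *: u) u.
Proof. by move=> c0 u0; apply/proj_eqP; split=> //; exists c. Qed.

Lemma proj_eqZr c u v : c != 0 -> proj_eq u (c *: v) = proj_eq u v.
Proof.
move=> c0; have [->|v0] := eqVneq v 0; first by rewrite scaler0.
exact/proj_eq_congr/proj_eqZ.
Qed.

Lemma proj_eqZl c u v : c != 0 -> proj_eq (c *: u) v = proj_eq u v.
Proof. by move=> c0; rewrite proj_eq_sym proj_eqZr // proj_eq_sym. Qed.

Lemma unit_mulmx_eq0 M u : M \in unitmx -> (M *m u == 0) = (u == 0).
Proof.
move=> hM; apply/eqP/eqP => [h|->]; last by rewrite mulmx0.
by rewrite -[u](mulKmx hM) h mulmx0.
Qed.

Lemma proj_eqM M u v : M \in unitmx -> proj_eq (M *m u) (M *m v) = proj_eq u v.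
Proof.
move=> hM; apply/proj_eqP/proj_eqP; rewrite unit_mulmx_eq0 // => -[v0 [c c0 h]].
  split=> //; exists c => //.
  by rewrite -[u](mulKmx hM) h -scalemxAr mulKmx.
by split=> //; exists c => //; rewrite h scalemxAr.
Qed.

Lemma proj_eq_neq0 u v : proj_eq u v -> (u != 0) /\ (v != 0).
Proof. by case/and3P. Qed.

Lemma crossC u v : cross v u = - cross u v.
Proof. by apply: vecP; rewrite !crossE !mxE /=; ring. Qed.

Lemma proj_eqN u v : proj_eq u (- v) = proj_eq u v.
Proof. by rewrite -scaleN1r proj_eqZr // oppr_eq0 oner_eq0. Qed.

Lemma crossZ c d u v : cross (c *: u) (d *: v) = (c * d) *: cross u v.
Proof. by apply: vecP; rewrite !crossE !mxE /=; ring. Qed.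

Lemma cross_mul M u v : M^T *m cross (M *m u) (M *m v) = \det M *: cross u v.
Proof.
apply: vecP; rewrite [in LHS]mulmx3 !crossE !mulmx3 col3Z !col3E det3 ![M^T _ _]mxE;
move: (M 0 0) (M 0 1) (M 0 2%:R) (M 1 0) (M 1 1) (M 1 2%:R) (M 2%:R 0) (M 2%:R 1) (M 2%:R 2%:R)
  (u 0 0) (u 1 0) (u 2%:R 0) (v 0 0) (v 1 0) (v 2%:R 0) => *; ring.
Qed.

(** The cofactor identity [cross_mul] for the inverse transpose. It makes residual points
    equivariant: those of [act7 M L] are the images under M of those of L, up to a scalar. *)
Lemma act_line_cross M a b : M \in unitmx ->
  cross (act_line M a) (act_line M b) = (\det M)^-1 *: (M *m cross a b).
Proof.
move=> hM; have := cross_mul (invmx M)^T a b.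
rewrite trmxK det_tr det_inv => h.
by rewrite -[LHS](mulKVmx hM) h -scalemxAr.
Qed.

Lemma on_line_act M a x : M \in unitmx -> on_line (act_line M a) x <-> on_line a (invmx M *m x).
Proof. by move=> hM; rewrite /on_line /act_line trmx_mul trmxK mulmxA. Qed.

Lemma proj_eq_act M a b : M \in unitmx -> proj_eq (act_line M a) (act_line M b) = proj_eq a b.
Proof. by move=> hM; rewrite proj_eqM // unitmx_tr unitmx_inv. Qed.

Lemma act_line_neq0 M a : M \in unitmx -> (act_line M a != 0) = (a != 0).
Proof. by move=> hM; rewrite /act_line unit_mulmx_eq0 // unitmx_tr unitmx_inv. Qed.

Lemma act_lineM M N a : M \in unitmx -> N \in unitmx ->
  act_line M (act_line N a) = act_line (M *m N) a.
Proof.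
move=> hM hN; rewrite /act_line mulmxA -trmx_mul.
by have -> : invmx (M *m N) = invmx N *m invmx M := invrM hM hN.
Qed.

Lemma act_lineZ c M a : c != 0 -> M \in unitmx -> act_line (c *: M) a = c^-1 *: act_line M a.
Proof.
move=> c0 hM; rewrite /act_line invmxZ ?unitfE // ?linearZ /= -?scalemxAl //.
by rewrite -[c *: M]/(c *: (M : 'M_3)) unitmxZ // unitfE.
Qed.

End Projective.

(** * Forms *)

Section Forms.
Variable K : numClosedFieldType.
Implicit Types (u v w : vec K) (M N : 'M[K]_3) (F G H Q : {mpoly K[3]}).

Lemma evD F G v : ev (F + G) v = ev F v + ev G v. Proof. exact: mevalD. Qed.
Lemma evM F G v : ev (F * G) v = ev F v * ev G v. Proof. exact: mevalM. Qed.
Lemma evB F G v : ev (F - G) v = ev F v - ev G v. Proof. exact: mevalB. Qed.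
Lemma evZ c F v : ev (c *: F) v = c * ev F v. Proof. exact: mevalZ. Qed.
Lemma evXn F k v : ev (F ^+ k) v = ev F v ^+ k. Proof. exact: rmorphXn. Qed.
Lemma evX i v : ev 'X_i v = v i 0. Proof. exact: mevalXU. Qed.
Lemma ev_sum (I : Type) (r : seq I) (P : pred I) (f : I -> {mpoly K[3]}) v :
  ev (\sum_(i <- r | P i) f i) v = \sum_(i <- r | P i) ev (f i) v.
Proof. exact: raddf_sum. Qed.
Lemma ev_kleinF v : ev (kleinF K) v =
  v 0 0 ^+ 3 * v 1 0 + v 1 0 ^+ 3 * v 2%:R 0 + v 2%:R 0 ^+ 3 * v 0 0.
Proof. by rewrite /kleinF !(evD, evXn, evM, evX). Qed.

(** Pullback of the form G along M, hence contravariant in M. *)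
Definition lsub M G : {mpoly K[3]} := G \mPo [tuple \sum_(j < 3) M i j *: 'X_j | i < 3].

Lemma lsubM M F G : lsub M (F * G) = lsub M F * lsub M G. Proof. exact: rmorphM. Qed.
Lemma lsubD M F G : lsub M (F + G) = lsub M F + lsub M G. Proof. exact: raddfD. Qed.
Lemma lsubZ M c F : lsub M (c *: F) = c *: lsub M F. Proof. exact: comp_mpolyZ. Qed.
Lemma lsubXn M F k : lsub M (F ^+ k) = lsub M F ^+ k. Proof. exact: rmorphXn. Qed.
Lemma lsubX M i : lsub M 'X_i = \sum_(j < 3) M i j *: 'X_j.
Proof. by rewrite /lsub comp_mpolyXU -tnth_nth tnth_mktuple. Qed.

Lemma lsub_sum M (I : Type) (r : seq I) (P : pred I) (f : I -> {mpoly K[3]}) :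
  lsub M (\sum_(i <- r | P i) f i) = \sum_(i <- r | P i) lsub M (f i).
Proof. exact: raddf_sum. Qed.
Lemma lsub_prod M (I : Type) (r : seq I) (P : pred I) (f : I -> {mpoly K[3]}) :
  lsub M (\prod_(i <- r | P i) f i) = \prod_(i <- r | P i) lsub M (f i).
Proof. exact: rmorph_prod. Qed.

Lemma ev_lsub M G v : ev (lsub M G) v = ev G (M *m v).
Proof.
rewrite /ev comp_mpoly_meval; apply: meval_eq => i.
rewrite tnth_mktuple mxE (raddf_sum (meval _)); apply: eq_bigr => j _.
by rewrite /= mevalZ mevalXU.
Qed.

Lemma homogX i : 'X_i \is [in K[3], 1.-homog].
Proof. by rewrite dhomogX /= mdeg1. Qed.

Lemma homog_prodexp (n : nat) (f : 'I_n -> {mpoly K[3]}) (d : 'I_n -> nat) :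
  (forall i, f i \is 1.-homog) -> \prod_i f i ^+ d i \is (\sum_i d i)%N.-homog.
Proof.
elim: n f d => [|n IH] f d h; first by rewrite !big_ord0 dhomog1.
rewrite !big_ord_recl; apply: dhomogM; last exact: IH.
by rewrite -[X in X.-homog]mul1n; apply: dhomogMn.
Qed.

Lemma lsub_homog M G d : G \is d.-homog -> lsub M G \is d.-homog.
Proof.
move=> /dhomogP hG; rewrite /lsub comp_mpolyEX big_seq; apply: rpred_sum => m hm.
apply: dhomogZ; rewrite comp_mpolyX -(hG m hm) /= mdegE; apply: homog_prodexp => i.
by rewrite tnth_mktuple; apply: rpred_sum => j _; apply/dhomogZ/homogX.
Qed.

Lemma lsub_comp M N G : lsub M (lsub N G) = lsub (N *m M) G.
Proof.
rewrite /lsub [G \mPo _ in LHS]comp_mpolyEX [RHS]comp_mpolyEX raddf_sum /=; apply: eq_bigr => m _.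
rewrite comp_mpolyZ; congr (_ *: _); rewrite !comp_mpolyX rmorph_prod /=.
apply: eq_bigr => i _; rewrite rmorphXn /= !tnth_mktuple; congr (_ ^+ _).
rewrite raddf_sum /=; under eq_bigr do rewrite comp_mpolyZ comp_mpolyXU -tnth_nth tnth_mktuple.
under [RHS]eq_bigr do rewrite mxE scaler_suml.
rewrite exchange_big /=; apply: eq_bigr => j _; rewrite scaler_sumr.
by apply: eq_bigr => k _; rewrite scalerA.
Qed.

Lemma lsub1 G : lsub 1%:M G = G.
Proof.
rewrite /lsub -[RHS]comp_mpoly_id; congr comp_mpoly; apply: eq_mktuple => i.
rewrite (bigD1 i) //= big1 ?addr0 => [|j hj]; rewrite mxE ?eqxx ?scale1r //.
by rewrite eq_sym (negbTE hj) scale0r.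
Qed.

Lemma ev_homogZ G d c v : G \is d.-homog -> ev G (c *: v) = c ^+ d * ev G v.
Proof.
move=> /dhomogP hG; rewrite /ev !mevalE mulr_sumr !big_seq; apply: eq_bigr => m hm.
rewrite mulrCA; congr (_ * _); rewrite -(hG m hm) /= mdegE.
rewrite (eq_bigr (fun i => c ^+ m i * v i 0 ^+ m i)) => [|i _]; last first.
  by rewrite mxE exprMn.
by rewrite big_split /= -expr_sum.
Qed.

Definition mono (i j k : nat) : {mpoly K[3]} := 'X_0 ^+ i * 'X_1 ^+ j * 'X_2%:R ^+ k.

Lemma ev_mono i j k v : ev (mono i j k) v = v 0 0 ^+ i * v 1 0 ^+ j * v 2%:R 0 ^+ k.
Proof. by rewrite /mono !(evXn, evM, evX). Qed.

Lemma mono_homog i j k : mono i j k \is (i + j + k)%N.-homog.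
Proof.
have h i0 n : 'X_i0 ^+ n \is [in K[3], n.-homog].
  by rewrite -[X in X.-homog]mul1n; apply/dhomogMn/homogX.
by rewrite /mono !dhomogM.
Qed.

Definition mn (i j k : nat) : 'X_{1..3} := [multinom nth 0%N [:: i; j; k] l | l < 3].

Lemma monoE i j k : mono i j k = 'X_[mn i j k].
Proof. by rewrite mpolyXE_id prod3 !mnmE. Qed.

Lemma mn_eqE i j k (m : 'X_{1..3}) : (mn i j k == m) = [&& i == m 0, j == m 1 & k == m 2%:R].
Proof.
apply/eqP/and3P => [<-|[/eqP h0 /eqP h1 /eqP h2]]; first by rewrite !mnmE.
by apply/mnmP; apply: ord3P; rewrite mnmE.
Qed.

Definition quartic_exps : seq (nat * nat * nat) :=
  [:: (4,0,0); (0,4,0); (0,0,4); (3,1,0); (0,3,1); (1,0,3); (1,3,0); (0,1,3); (3,0,1);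
      (2,2,0); (0,2,2); (2,0,2); (2,1,1); (1,2,1); (1,1,2)]%N.

Lemma quarticE Q : Q \is 4.-homog ->
  Q = \sum_(e <- quartic_exps) Q@_(mn e.1.1 e.1.2 e.2) *: mono e.1.1 e.1.2 e.2.
Proof.
move=> hQ; apply/mpolyP => m; rewrite raddf_sum /=.
have hm : mdeg m = (m 0%R + m 1%R + m (2%:R)%R)%N by rewrite mdegE sum3.
set e0 := (m 0%R, m 1%R, m 2%:R).
have mE (e : nat * nat * nat) : (mn e.1.1 e.1.2 e.2 == m) = (e == e0).
  by rewrite mn_eqE; case: e => [[i j] k] /=; rewrite -pair_eqE /= -pair_eqE /= andbA.
have -> : \sum_(e <- quartic_exps) (Q@_(mn e.1.1 e.1.2 e.2) *: mono e.1.1 e.1.2 e.2)@_m =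
   \sum_(e <- quartic_exps) (if e == e0 then Q@_m else 0).
  apply: eq_bigr => e _; rewrite mcoeffZ monoE mcoeffX mE -mE.
  by case: eqP => [->|_]; rewrite ?mulr1 ?mulr0.
rewrite -big_mkcond big_const_seq iter_addr_0 /=.
have [d4|d4] := eqVneq (mdeg m) 4; last by rewrite (dhomog_nemf_coeff hQ d4) mul0rn.
rewrite -[LHS]mulr1n; congr (_ *+ _); move: d4; rewrite hm /e0.
(* An exponent above 4 contradicts the degree, so finitely many cases remain, and each exponent
   triple occurs once in the list. *)
by move: (m 0) (m 1) (m 2%:R) => [|[|[|[|[|a]]]]] [|[|[|[|[|b]]]]] [|[|[|[|[|c]]]]].
Qed.

Lemma kleinF_mono : kleinF K = mono 3 1 0 + mono 0 3 1 + mono 1 0 3.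
Proof. by rewrite /kleinF /mono; ring. Qed.

Lemma kleinF_homog : kleinF K \is 4.-homog.
Proof. by rewrite kleinF_mono !rpredD ?mono_homog. Qed.

End Forms.

(** * Vanishing orders along a plane curve *)

Section Order.
Variable K : numClosedFieldType.
Implicit Types (x : vec K) (M N : 'M[K]_3) (F G H : {mpoly K[3]}).

(** Allows any finite index type, so that sums and products of representations can be indexed by sum
    and product types. *)
Lemma ipow_fin (I : finType) x k (A : I -> {mpoly K[3]}) (l : I -> 'I_k -> {mpoly K[3]}) :
  (forall i j, l i j \is 1.-homog /\ ev (l i j) x = 0) ->
  in_pt_ideal_pow x k (\sum_i A i * \prod_j l i j).
Proof.
move=> h; exists #|I|, (A \o enum_val), (l \o enum_val); split=> [i j|]; first exact: h.
rewrite (reindex (@enum_val I predT)) //=; exact: onW_bij (enum_val_bij I).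
Qed.

Lemma ipowD x k G H : in_pt_ideal_pow x k G -> in_pt_ideal_pow x k H ->
  in_pt_ideal_pow x k (G + H).
Proof.
move=> [n [A [l [hl ->]]]] [m [B [l' [hl' ->]]]].
pose C (i : 'I_n + 'I_m) := match i with inl i => A i | inr i => B i end.
pose f (i : 'I_n + 'I_m) := match i with inl i => l i | inr i => l' i end.
have := @ipow_fin ('I_n + 'I_m)%type x k C f; rewrite big_sumType /=; apply.
by case=> i j /=.
Qed.

Lemma ipowM x k k' G H : in_pt_ideal_pow x k G -> in_pt_ideal_pow x k' H ->
  in_pt_ideal_pow x (k + k') (G * H).
Proof.
move=> [n [A [l [hl ->]]]] [m [B [l' [hl' ->]]]].
pose C (i : 'I_n * 'I_m) := A i.1 * B i.2.
pose f (i : 'I_n * 'I_m) (j : 'I_(k + k')) :=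
  match split j with inl j => l i.1 j | inr j => l' i.2 j end.
have := @ipow_fin ('I_n * 'I_m)%type x (k + k') C f.
rewrite -(pair_bigA _ (fun i i' => C (i, i') * \prod_j f (i, i') j)) /=.
rewrite mulr_suml; under [X in _ -> in_pt_ideal_pow _ _ X]eq_bigr do rewrite mulr_sumr.
move=> h; have := h _; have -> : \sum_(i < n) \sum_(j < m) C (i, j) * \prod_(j0 < k + k') f (i, j) j0 =
  \sum_(i < n) \sum_(j < m) (A i * \prod_(j0 < k) l i j0) * (B j * \prod_(j0 < k') l' j j0).
  apply: eq_bigr => i _; apply: eq_bigr => j _; rewrite big_split_ord /= /C /f /=.
  rewrite mulrACA; congr ((_ * _) * (_ * _)); apply: eq_bigr => a _.
    by rewrite -[lshift _ _]/(unsplit (inl _ a)) unsplitK.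
  by rewrite -[rshift _ _]/(unsplit (inr _ a)) unsplitK.
by apply=> i j; rewrite /f; case: split.
Qed.

Lemma ipow0 x G : in_pt_ideal_pow x 0 G.
Proof.
exists 1%N, (fun=> G), (fun _ _ => 0); split=> [i []//|].
by rewrite big_ord1 big_ord0 mulr1.
Qed.

Lemma ipow_mull x k G H : in_pt_ideal_pow x k H -> in_pt_ideal_pow x k (G * H).
Proof. by move=> h; apply: (@ipowM x 0 k) h; apply: ipow0. Qed.

Lemma ipow_lin x G : G \is 1.-homog -> ev G x = 0 -> in_pt_ideal_pow x 1 G.
Proof.
move=> hG h0; exists 1%N, (fun=> 1), (fun _ _ => G); split=> // .
by rewrite !big_ord1 mul1r.
Qed.

Lemma ipow_leq x k k' H : (k <= k')%N -> in_pt_ideal_pow x k' H -> in_pt_ideal_pow x k H.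
Proof.
move=> le [n [A [l [hl ->]]]]; move: l hl; rewrite -(subnK le) addnC => l hl.
under eq_bigr do rewrite big_split_ord /= mulrC -mulrA mulrC.
exact: (@ipow_fin _ x k (fun i => _) (fun i j => l i (lshift _ j))).
Qed.

Lemma ipow_scale c x k H : in_pt_ideal_pow x k H -> in_pt_ideal_pow (c *: x) k H.
Proof.
move=> [n [A [l [hl ->]]]]; exists n, A, l; split=> // i j.
by case: (hl i j) => h h0; rewrite (ev_homogZ _ _ h) h0 mulr0.
Qed.

Lemma ipow_lsub M x k H : in_pt_ideal_pow (M *m x) k H -> in_pt_ideal_pow x k (lsub M H).
Proof.
move=> [n [A [l [hl ->]]]]; exists n, (lsub M \o A), (fun i j => lsub M (l i j)).
split=> [i j|]; first by rewrite lsub_homog ?ev_lsub; case: (hl i j).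
by rewrite lsub_sum; apply: eq_bigr => i _; rewrite lsubM lsub_prod.
Qed.

Lemma ordge0 F x G : ord_ge F x G 0.
Proof.
exists 1, 0, G, 0%N; rewrite dhomog1 /ev meval1 oner_eq0 mul1r mul0r add0r.
by split=> //; split=> //; split=> //; apply: ipow0.
Qed.

Lemma ordgeM F x G H k k' : ord_ge F x G k -> ord_ge F x H k' -> ord_ge F x (G * H) (k + k').
Proof.
move=> [B [A [I [d [hB [B0 [hI e]]]]]]] [B' [A' [I' [d' [hB' [B0' [hI' e']]]]]]].
exists (B * B'), (A * A' * F + A * I' + A' * I), (I * I'), (d + d')%N.
rewrite dhomogM // evM mulf_neq0 //; split=> //; split=> //; split; first exact: ipowM.
by rewrite mulrACA e e'; ring.
Qed.

Lemma ordgeD F x G H k : ord_ge F x G k -> ord_ge F x H k -> ord_ge F x (G + H) k.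
Proof.
move=> [B [A [I [d [hB [B0 [hI e]]]]]]] [B' [A' [I' [d' [hB' [B0' [hI' e']]]]]]].
exists (B * B'), (B' * A + B * A'), (B' * I + B * I'), (d + d')%N.
rewrite dhomogM // evM mulf_neq0 //; split=> //; split=> //; split.
  by apply: ipowD; apply: ipow_mull.
have -> : B * B' * (G + H) = B' * (B * G) + B * (B' * H) by ring.
by rewrite e e'; ring.
Qed.

Lemma ordge_leq F x G k k' : (k <= k')%N -> ord_ge F x G k' -> ord_ge F x G k.
Proof.
move=> le [B [A [I [d [hB [B0 [hI e]]]]]]]; exists B, A, I, d.
by do 3!split=> //; apply: ipow_leq hI.
Qed.

Lemma ordge_mull F x G H k : ord_ge F x H k -> ord_ge F x (G * H) k.
Proof. exact: (@ordgeM _ _ _ _ 0 k (ordge0 _ _ _)). Qed.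

Lemma ordgeZ F x c H k : ord_ge F x H k -> ord_ge F x (c *: H) k.
Proof. by rewrite -mul_mpolyC; apply: ordge_mull. Qed.

Lemma ordgeXn F x G k n : ord_ge F x G k -> ord_ge F x (G ^+ n) (n * k).
Proof.
move=> h; elim: n => [|n IH]; first exact: ordge0.
by rewrite exprS mulSn; apply: ordgeM.
Qed.

Lemma ordge_ideal F x G k : in_pt_ideal_pow x k G -> ord_ge F x G k.
Proof.
by move=> h; exists 1, 0, G, 0%N; rewrite dhomog1 /ev meval1 oner_eq0 mul1r mul0r add0r.
Qed.

Lemma ordge_scale F c x G k : c != 0 -> ord_ge F x G k -> ord_ge F (c *: x) G k.
Proof.
move=> c0 [B [A [I [d [hB [B0 [hI e]]]]]]]; exists B, A, I, d.
rewrite (ev_homogZ _ _ hB) mulf_neq0 ?expf_neq0 //.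
by do 3!split=> //; apply: ipow_scale.
Qed.

Lemma ordeq_scale F c x G k : c != 0 -> ord_eq F x G k -> ord_eq F (c *: x) G k.
Proof.
move=> c0 [h1 h2]; split; first exact: ordge_scale.
by move=> /(@ordge_scale _ c^-1); rewrite invr_eq0 scalerA mulVf // scale1r => /(_ c0).
Qed.

Lemma ordge_lsub F M c x G k : lsub M F = c *: F ->
  ord_ge F (M *m x) G k -> ord_ge F x (lsub M G) k.
Proof.
move=> hF [B [A [I [d [hB [B0 [hI e]]]]]]].
exists (lsub M B), (c *: lsub M A), (lsub M I), d.
rewrite lsub_homog // ev_lsub -lsubM e lsubD lsubM hF -scalerAr -scalerAl.
by do 3!split=> //; apply: ipow_lsub.
Qed.

Lemma lsub_inv_eigen F M c : c != 0 -> M \in unitmx -> lsub M F = c *: F ->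
  lsub (invmx M) F = c^-1 *: F.
Proof.
move=> c0 hM h; have : lsub (invmx M) (lsub M F) = F by rewrite lsub_comp mulmxV // lsub1.
by rewrite h lsubZ => {2}<-; rewrite scalerA mulVf // scale1r.
Qed.

Lemma ordge_lsubP F M c x G k : c != 0 -> M \in unitmx -> lsub M F = c *: F ->
  ord_ge F x (lsub M G) k <-> ord_ge F (M *m x) G k.
Proof.
move=> c0 hM hF; split; last exact: ordge_lsub hF.
rewrite -{1}[x](mulKmx hM) => /(ordge_lsub (lsub_inv_eigen c0 hM hF)).
by rewrite lsub_comp mulmxV // lsub1.
Qed.

Lemma ordeq_lsubP F M c x G k : c != 0 -> M \in unitmx -> lsub M F = c *: F ->
  ord_eq F x (lsub M G) k <-> ord_eq F (M *m x) G k.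
Proof. by move=> c0 hM hF; rewrite /ord_eq !(ordge_lsubP _ _ _ c0 hM hF). Qed.

(** Choose j with x_j nonzero and substitute (x_i / x_j) X_j for each X_i. Modulo the ideal of x
    this changes nothing, as X_i - (x_i / x_j) X_j is a linear form vanishing at x. By homogeneity
    the substitution turns G into G(x / x_j) X_j^d, which is 0. *)
Lemma homog_in_pt_ideal x G d : x != 0 -> G \is d.-homog -> ev G x = 0 ->
  in_pt_ideal_pow x 1 G.
Proof.
move=> x0 hG G0.
have [j xj] : exists j, x j 0 != 0.
  apply/existsP; apply: contraNT x0; rewrite negb_exists => /forallP h.
  by apply/eqP/colP => i; rewrite mxE; apply/eqP; have := h i; rewrite negbK.
pose s (H : {mpoly K[3]}) := H \mPo [tuple (x i 0 / x j 0) *: ('X_j : {mpoly K[3]}) | i < 3].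
have sX m : s 'X_[m] = \prod_i ((x i 0 / x j 0) *: 'X_j) ^+ m i.
  by rewrite /s comp_mpolyX; apply: eq_bigr => i _; rewrite tnth_mktuple.
have id0 : in_pt_ideal_pow x 1 (0 : {mpoly K[3]}).
  by exists 0%N, (fun=> 0), (fun _ _ => 0); split=> [[]//|]; rewrite big_ord0.
have congM A A' B B' : in_pt_ideal_pow x 1 (A - A') -> in_pt_ideal_pow x 1 (B - B') ->
    in_pt_ideal_pow x 1 (A * B - A' * B').
  move=> h h'; have -> : A * B - A' * B' = B * (A - A') + A' * (B - B') by ring.
  by apply: ipowD; apply: ipow_mull.
have sm m : in_pt_ideal_pow x 1 ('X_[m] - s 'X_[m]).
  rewrite sX mpolyXE_id; elim/big_rec2: _ => [|i A B _ IH]; first by rewrite subrr.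
  apply: (congM) IH; elim: (m i) => [|n IH]; first by rewrite subrr.
  rewrite !exprS; apply: (congM) IH; apply: ipow_lin.
    by rewrite rpredB ?rpredZ ?homogX.
  by rewrite evB evZ !evX mulfVK ?subrr.
have sG : in_pt_ideal_pow x 1 (G - s G).
  rewrite [X in X - _]mpolyE /s comp_mpolyEX -sumrB; elim/big_ind: _ => // [|m _].
    exact: ipowD.
  by rewrite -scalerBr -mul_mpolyC; apply: ipow_mull.
suff s0 : s G = 0 by rewrite s0 subr0 in sG.
have : ev G ((x j 0)^-1 *: x) = 0 by rewrite (ev_homogZ _ _ hG) G0 mulr0.
rewrite /ev mevalE => e.
rewrite /s comp_mpolyEX; transitivity ((\sum_(m <- msupp G) G@_m *
   \prod_(i < 3) ((x j 0)^-1 *: x) i 0 ^+ m i) *: ('X_j : {mpoly K[3]}) ^+ d); last first.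
  by rewrite e scale0r.
rewrite scaler_suml !big_seq; apply: eq_bigr => m hm; rewrite -[_ \mPo _]/(s _) sX -scalerA.
congr (_ *: _); rewrite -(dhomog_mf hG hm) /= mdegE expr_sum -scaler_prod.
by apply: eq_bigr => i _; rewrite mxE exprZn mulrC.
Qed.

Definition aev (g : 'I_3 -> {poly K}) G : {poly K} := mmap polyC g G.

Lemma aevM g G H : aev g (G * H) = aev g G * aev g H. Proof. exact: rmorphM. Qed.
Lemma aevD g G H : aev g (G + H) = aev g G + aev g H. Proof. exact: raddfD. Qed.
Lemma aevZ g c G : aev g (c *: G) = c%:P * aev g G. Proof. exact: mmapZ. Qed.
Lemma aevXn g G k : aev g (G ^+ k) = aev g G ^+ k. Proof. exact: rmorphXn. Qed.
Lemma aevX g i : aev g 'X_i = g i. Proof. by rewrite /aev mmapX mmap1U. Qed.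

(* [g] is a parametrized arc through [x] on which [F] vanishes modulo ['X^n];
   it bounds vanishing orders on the curve [F = 0] from above. *)
Definition is_arc F (n : nat) x (g : 'I_3 -> {poly K}) :=
  (forall i, (g i).[0] = x i 0) /\ 'X^n %| aev g F.

Lemma aev_at0 F n x g G : is_arc F n x g -> (aev g G).[0] = ev G x.
Proof.
case=> hg _; rewrite /aev /mmap /ev mevalE horner_sum; apply: eq_bigr => m _.
rewrite hornerM hornerC /mmap1 horner_prod; congr (_ * _).
by apply: eq_bigr => i _; rewrite horner_exp hg.
Qed.

Lemma dvdp_X (p : {poly K}) : ('X %| p) = (p.[0] == 0).
Proof. by have := dvdp_XsubCl p 0; rewrite subr0 => ->; rewrite rootE. Qed.

Lemma ordge_arc F n x g G k : is_arc F n x g -> (k <= n)%N -> ord_ge F x G k ->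
  'X^k %| aev g G.
Proof.
move=> hg kn [B [A [I [d [hB [B0 [hI e]]]]]]].
have dI : 'X^k %| aev g I.
  case: hI => [m [C [l [hl ->]]]]; rewrite /aev raddf_sum /=.
  rewrite -[mmap _ _]/(aev g).
  elim/big_ind: _ => [|p q|i _]; [exact: dvdp0 | exact: dvdp_add |].
  rewrite aevM dvdp_mull // /aev rmorph_prod /= -[k in 'X^k]card_ord -prodr_const.
  elim/big_ind2: _ => // [p p' q q'|j _]; first exact: dvdp_mul.
  by rewrite dvdp_X -[mmap _ _ _]/(aev g _) (aev_at0 _ hg); case: (hl i j) => _ ->.
have : 'X^k %| aev g B * aev g G.
  rewrite -aevM e aevD aevM dvdp_addl ?dI // dvdp_mull //.
  by case: hg => _; apply: dvdp_trans; rewrite dvdp_exp2l.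
rewrite Gauss_dvdpr // coprimep_expl // coprimep_sym.
by rewrite -['X]subr0 coprimep_XsubC rootE (aev_at0 _ hg).
Qed.

(** A lower bound on the curve together with the exact order along the arc. Unlike [ord_eq], this is
    visibly additive on products. *)
Definition arc_ord F x g G k := ord_ge F x G k /\
  exists2 w : {poly K}, w.[0] != 0 & aev g G = 'X^k * w.

Lemma arc_ord_eq F n x g G k : is_arc F n x g -> (k < n)%N -> arc_ord F x g G k ->
  ord_eq F x G k.
Proof.
move=> hg kn [h [w w0 e]]; split=> // /(ordge_arc hg kn); rewrite e exprSr.
by rewrite dvdp_mul2l ?expf_neq0 ?polyX_eq0 // dvdp_X (negbTE w0).
Qed.

Lemma arc_ordM F x g G H k k' : arc_ord F x g G k -> arc_ord F x g H k' ->
  arc_ord F x g (G * H) (k + k').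
Proof.
move=> [h [w w0 e]] [h' [w' w0' e']]; split; first exact: ordgeM.
by exists (w * w'); rewrite ?hornerM ?mulf_neq0 // aevM e e' exprD mulrACA.
Qed.

Lemma arc_ordZ F x g c G k : c != 0 -> arc_ord F x g G k -> arc_ord F x g (c *: G) k.
Proof.
move=> c0 [h [w w0 e]]; split; first exact: ordgeZ.
exists (c%:P * w); first by rewrite hornerM hornerC mulf_neq0.
by rewrite aevZ e mulrCA.
Qed.

Lemma arc_ord0 F n x g G : is_arc F n x g -> ev G x != 0 -> arc_ord F x g G 0.
Proof.
move=> hg G0; split; first exact: ordge0.
by exists (aev g G); rewrite ?(aev_at0 _ hg) // mul1r.
Qed.

End Order.

(** * The Klein quartic *)

Ltac nz := by repeat (first [assumption | rewrite invr_eq0 | apply: expf_neq0 | apply: mulf_neq0]).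

Section Klein.
Variable K : numClosedFieldType.
Implicit Types (u v : vec K) (M N : 'M[K]_3) (F G : {mpoly K[3]}).

Definition mulX v : K := v 0 0 * v 1 0 * v 2%:R 0.
Definition cA v : K := v 0 0 ^+ 3 * v 1 0.
Definition cB v : K := v 1 0 ^+ 3 * v 2%:R 0.
Definition cC v : K := v 2%:R 0 ^+ 3 * v 0 0.

Lemma kleinE v : ev (kleinF K) v = cA v + cB v + cC v. Proof. exact: ev_kleinF. Qed.

Lemma mulX_neq0 v : mulX v != 0 -> [/\ v 0 0 != 0, v 1 0 != 0 & v 2%:R 0 != 0].
Proof. by rewrite /mulX !mulf_eq0 !negb_or => /andP[/andP[-> ->] ->]. Qed.

Lemma mulXZ c v : mulX (c *: v) = c ^+ 3 * mulX v.
Proof. by rewrite /mulX !mxE; ring. Qed.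

Lemma e_ptE : (e_pt K 0 = col3 1 0 0) * (e_pt K 1 = col3 0 1 0) * (e_pt K 2%:R = col3 0 0 1).
Proof. by split; [split|]; apply: vecP; rewrite !mxE. Qed.

Lemma e_pt_neq0 i : e_pt K i != 0.
Proof.
by apply/eqP=> /colP/(_ i); rewrite !mxE eqxx => /eqP; rewrite oner_eq0.
Qed.

Lemma mulX_e i : mulX (e_pt K i) = 0.
Proof. by elim/ord3P: i; rewrite e_ptE /mulX !col3E ?(mulr0, mul0r). Qed.

Lemma klein_e i : ev (kleinF K) (e_pt K i) = 0.
Proof. by elim/ord3P: i; rewrite e_ptE ev_kleinF !col3E ; ring. Qed.

Lemma klein_mulX0 v : ev (kleinF K) v = 0 -> v != 0 -> mulX v = 0 ->
  exists i, proj_eq v (e_pt K i).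
Proof.
rewrite ev_kleinF /mulX.
move e0 : (v 0 0) => x; move e1 : (v 1 0) => y; move e2 : (v 2%:R 0) => w hF v0 h.
suff [i [c hc]] : exists i c, v = c *: e_pt K i.
  exists i; rewrite hc proj_eqZ ?e_pt_neq0 //; apply: contraNneq v0 => c0.
  by rewrite hc c0 scale0r.
have fin0 : y = 0 -> w = 0 -> exists i c, v = c *: e_pt K i.
  by move=> y0 w0; exists 0, x; rewrite [v]col3P e0 e1 e2 y0 w0 e_ptE col3Z mulr1 !mulr0.
have fin1 : x = 0 -> w = 0 -> exists i c, v = c *: e_pt K i.
  by move=> x0 w0; exists 1, y; rewrite [v]col3P e0 e1 e2 x0 w0 e_ptE col3Z mulr1 !mulr0.
have fin2 : x = 0 -> y = 0 -> exists i c, v = c *: e_pt K i.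
  by move=> x0 y0; exists 2%:R, w; rewrite [v]col3P e0 e1 e2 x0 y0 e_ptE col3Z mulr1 !mulr0.
move/eqP: h; rewrite !mulf_eq0 => /orP[/orP[]|] /eqP z0; move: hF; rewrite z0.
- rewrite expr0n !(mul0r, mulr0, add0r, addr0) => /eqP; rewrite mulf_eq0 expf_eq0 /=.
  by case/orP => /eqP ?; [apply: fin2 | apply: fin1].
- rewrite expr0n !(mul0r, mulr0, add0r, addr0) => /eqP; rewrite mulf_eq0 expf_eq0 /=.
  by case/orP => /eqP ?; [apply: fin0 | apply: fin2].
rewrite expr0n !(mul0r, mulr0, add0r, addr0) => /eqP; rewrite mulf_eq0 expf_eq0 /=.
by case/orP => /eqP ?; [apply: fin1 | apply: fin0].
Qed.

Definition tauM : 'M[K]_3 := \matrix_(i, j) (j == i + 1)%:R.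

Lemma tauM_col v : tauM *m v = col3 (v 1 0) (v 2%:R 0) (v 0 0).
Proof. by rewrite mulmx3 !mxE /=; congr col3; ring. Qed.

(** * Arithmetic in Z[zeta], the automorphisms phi, tau and S, and the flexes *)

Section Zeta.
Variable z : K.
Hypothesis hz : 7.-primitive_root z.

Lemma z7 : z ^+ 7 = 1. Proof. exact: prim_expr_order. Qed.

Lemma z_neq0 : z != 0.
Proof. by apply: contraNneq (oner_neq0 K) => e; rewrite -z7 e expr0n. Qed.

(** The cyclotomic relation, oriented so that [ring] can use it to reduce polynomials in z to degree
    at most 5. *)
Lemma z6 : z ^+ 6 = - (1 + z + z ^+ 2 + z ^+ 3 + z ^+ 4 + z ^+ 5).
Proof.
have z1 : z - 1 != 0.
  rewrite subr_eq0; apply/eqP => e; have := prim_order_dvd hz 1.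
  by rewrite expr1 e eqxx.
apply: (mulfI z1); transitivity (z ^+ 7 - z ^+ 6); first by ring.
by rewrite z7; ring.
Qed.

(* Applied with [b] a multiple of the inverse of [a] in Z[zeta]. *)
Lemma neq0_cert (n : nat) (a b : K) : a * b = n.+1%:R -> a != 0.
Proof.
by move=> h; apply: contraNneq (oner_neq0 K) => a0; move/eqP: h; rewrite a0 mul0r eq_sym pnatr_eq0.
Qed.

Definition psi0 : K := z ^+ 4 + 2 * z ^+ 2 - 2 * z - z ^+ 6.
Definition psi1 : K := z ^+ 2 + 2 * z - 2 * z ^+ 4 - z ^+ 3.
Definition psi2 : K := z + 2 * z ^+ 4 - 2 * z ^+ 2 - z ^+ 5.

Lemma psi0_neq0 : psi0 != 0.
Proof.
apply: (@neq0_cert 6 _ (1 + 3 * z + 2 * z ^+ 2 + z ^+ 3 + 3 * z ^+ 4 + 4 * z ^+ 5)).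
by rewrite /psi0; ring: z6.
Qed.
Lemma psi1_neq0 : psi1 != 0.
Proof.
apply: (@neq0_cert 6 _ (- 3 - 2 * z - z ^+ 2 - 4 * z ^+ 3 - z ^+ 4 - 3 * z ^+ 5)).
by rewrite /psi1; ring: z6.
Qed.
Lemma psi2_neq0 : psi2 != 0.
Proof.
apply: (@neq0_cert 6 _ (2 * z + 2 * z ^+ 2 + 3 * z ^+ 3 + z ^+ 4 - z ^+ 5)).
by rewrite /psi2; ring: z6.
Qed.
(** Each phi-eigenspace of quartics other than that of F is spanned by two monomials, and psi must
    change the ratio of their values for R and psi(R) to impose independent conditions. Each of the
    three ratio inequalities serves two eigenspaces; [psi_ratioF] plays this role in the eigenspace
    of F. *)
Lemma psi_ratio0 : psi0 ^+ 3 != psi1 ^+ 2 * psi2.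
Proof.
rewrite -subr_eq0; apply: (@neq0_cert 97 _ (- 1 + z ^+ 5)).
by rewrite /psi0 /psi1 /psi2; ring: z6.
Qed.
Lemma psi_ratio1 : psi1 ^+ 3 != psi2 ^+ 2 * psi0.
Proof.
rewrite -subr_eq0; apply: (@neq0_cert 97 _ (- 2 - z - z ^+ 2 - z ^+ 3 - z ^+ 4 - z ^+ 5)).
by rewrite /psi0 /psi1 /psi2; ring: z6.
Qed.
Lemma psi_ratio2 : psi2 ^+ 3 != psi0 ^+ 2 * psi1.
Proof.
rewrite -subr_eq0; apply: (@neq0_cert 97 _ (- 1 + z ^+ 3)).
by rewrite /psi0 /psi1 /psi2; ring: z6.
Qed.
Lemma psi_ratioF : psi0 ^+ 3 * psi1 != psi1 ^+ 3 * psi2.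
Proof.
rewrite -subr_eq0; apply: (@neq0_cert 685 _ (4 + 2 * z ^+ 2 + 3 * z ^+ 3 + 3 * z ^+ 4 + 2 * z ^+ 5)).
by rewrite /psi0 /psi1 /psi2; ring: z6.
Qed.

Lemma psiM_col v : psiM z *m v = col3 (psi0 * v 0 0) (psi1 * v 1 0) (psi2 * v 2%:R 0).
Proof. by rewrite mulmx3 !mxE /=; congr col3; rewrite ?(mulr0n, mul0r, addr0, add0r, mulr1n). Qed.

Lemma phiM_col v : phiM z *m v = col3 (z ^+ 4 * v 0 0) (z ^+ 2 * v 1 0) (z * v 2%:R 0).
Proof. by rewrite mulmx3 !mxE /=; congr col3; rewrite ?(mulr0n, mul0r, addr0, add0r, mulr1n). Qed.

Lemma phik_col k v : phiM z ^+ k *m v =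
  col3 ((z ^+ k) ^+ 4 * v 0 0) ((z ^+ k) ^+ 2 * v 1 0) (z ^+ k * v 2%:R 0).
Proof.
elim: k => [|k IH]; first by rewrite mul1mx !expr1n !mul1r -col3P.
rewrite exprS -mulmxA IH phiM_col !col3E; by rewrite !(exprS z k); congr col3; ring.
Qed.

(** With [s1] and [s2], the entries of the classical involution in Klein's three-dimensional
    representation, without the normalising factor 1 / sqrt(-7). *)
Definition s0 : K := z - z ^+ 6.
Definition s1 : K := z ^+ 2 - z ^+ 5.
Definition s2 : K := z ^+ 4 - z ^+ 3.
(* Its square is -7, so this is an involution of the plane. *)
Definition SM : 'M[K]_3 := \matrix_(i, j) [:: s0; s1; s2; s0; s1]`_(i + j).

Lemma SM_col v : SM *m v = col3 (s0 * v 0 0 + s1 * v 1 0 + s2 * v 2%:R 0)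
  (s1 * v 0 0 + s2 * v 1 0 + s0 * v 2%:R 0) (s2 * v 0 0 + s0 * v 1 0 + s1 * v 2%:R 0).
Proof. by rewrite mulmx3 !mxE. Qed.

Lemma mx_ext (M N : 'M[K]_3) : (forall v, M *m v = N *m v) -> M = N.
Proof.
move=> h; apply/row_matrixP => i; apply/rowP => j; rewrite !mxE.
have := congr1 (fun v : vec K => v i 0) (h (delta_mx j 0)).
by rewrite -!colE !mxE.
Qed.

Lemma phi_unit : phiM z \in unitmx.
Proof.
have h : phiM z *m (phiM z ^+ 6) = 1%:M.
  apply: mx_ext => v; rewrite -mulmxA phik_col phiM_col !col3E mul1mx [RHS]col3P.
  by congr col3; ring: z7.
by case/mulmx1_unit: h.
Qed.

Lemma phik_unit k : phiM z ^+ k \in unitmx.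
Proof. by rewrite -[_ \in _]/(_ \is a GRing.unit) unitrX //; apply: phi_unit. Qed.

Lemma SM2 : SM *m SM = (- 7%:R)%:M.
Proof.
apply: mx_ext => v; rewrite -mulmxA !SM_col !col3E mul_scalar_mx [v in RHS]col3P col3Z.
by congr col3; rewrite /s0 /s1 /s2; ring: z6.
Qed.

Lemma neg7_neq0 : - 7%:R != 0 :> K. Proof. by rewrite oppr_eq0 pnatr_eq0. Qed.

Lemma SM_unit : SM \in unitmx.
Proof.
have h : SM *m ((- 7%:R)^-1 *: SM) = 1%:M.
  rewrite -scalemxAr SM2 -mul_scalar_mx -scalar_mxM mulVf //; exact: neg7_neq0.
by case/mulmx1_unit: h.
Qed.

Lemma tauM3 : tauM *m (tauM *m tauM) = 1%:M.
Proof.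
by apply: mx_ext => v; rewrite -!mulmxA !tauM_col !col3E mul1mx -col3P.
Qed.

Lemma tau_unit : tauM \in unitmx. Proof. by case/mulmx1_unit: tauM3. Qed.

Lemma klein_phi k v : ev (kleinF K) (phiM z ^+ k *m v) = ev (kleinF K) v.
Proof.
have h : (z ^+ k) ^+ 7 = 1 by rewrite -exprM mulnC exprM z7 expr1n.
by rewrite phik_col !ev_kleinF !col3E; ring: h.
Qed.

Lemma klein_tau v : ev (kleinF K) (tauM *m v) = ev (kleinF K) v.
Proof. by rewrite tauM_col !ev_kleinF !col3E; ring. Qed.

Lemma klein_S v : ev (kleinF K) (SM *m v) = 49%:R * ev (kleinF K) v.
Proof. by rewrite SM_col !ev_kleinF !col3E /s0 /s1 /s2; ring: z6. Qed.

Lemma mulX_phi k v : mulX (phiM z ^+ k *m v) = mulX v.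
Proof.
have h : (z ^+ k) ^+ 7 = 1 by rewrite -exprM mulnC exprM z7 expr1n.
by rewrite phik_col /mulX !col3E; ring: h.
Qed.

Lemma cA_phi k v : cA (phiM z ^+ k *m v) = cA v.
Proof.
have h : (z ^+ k) ^+ 7 = 1 by rewrite -exprM mulnC exprM z7 expr1n.
by rewrite phik_col /cA !col3E; ring: h.
Qed.

Lemma cB_phi k v : cB (phiM z ^+ k *m v) = cB v.
Proof.
have h : (z ^+ k) ^+ 7 = 1 by rewrite -exprM mulnC exprM z7 expr1n.
by rewrite phik_col /cB !col3E; ring: h.
Qed.

Lemma root7 (t : K) : t ^+ 7 = 1 -> exists k : nat, t = z ^+ k.
Proof. by move=> /(prim_rootP hz)[k ->]; exists k. Qed.

(* On the curve, the ratio of [cA] to [cB] is the quotient map by [phi]. *)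
Lemma phi_fiber v v' : ev (kleinF K) v = 0 -> ev (kleinF K) v' = 0 ->
  mulX v != 0 -> mulX v' != 0 -> cA v * cB v' = cA v' * cB v ->
  exists k, proj_eq v' (phiM z ^+ k *m v).
Proof.
move=> F0 F0' m m' h; have := mulX_neq0 m; have := mulX_neq0 m'; move: F0 F0' h.
rewrite !ev_kleinF /cA /cB.
move e0 : (v 0 0) => x; move e1 : (v 1 0) => y; move e2 : (v 2%:R 0) => w.
move e0' : (v' 0 0) => x'; move e1' : (v' 1 0) => y'; move e2' : (v' 2%:R 0) => w'.
move=> F0 F0' h [x0' y0' w0'] [x0 y0 w0].
(* The coordinatewise ratio of v' to v, scaled to (s : t : 1). Equality of the ratios cA / cB gives
   t^3 = s^3 t, the curve equation gives s = t^3, and together t^7 = 1: this is the action of a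
   power of phi. *)
pose s := (x' / x) / (w' / w); pose t := (y' / y) / (w' / w).
pose l := w' / w.
have l0 : l != 0 by rewrite mulf_neq0 ?invr_eq0.
have ex : x' = l * s * x by rewrite /l /s; field; rewrite ?x0 ?w0 ?w0'.
have ey : y' = l * t * y by rewrite /l /t; field; rewrite ?y0 ?w0 ?w0'.
have ew : w' = l * w by rewrite /l divfK.
have s0' : s != 0 by nz.
have t0' : t != 0 by nz.
have e1s : t ^+ 3 = s ^+ 3 * t.
  have : l ^+ 4 * (x ^+ 3 * y * (y ^+ 3 * w)) * (t ^+ 3 - s ^+ 3 * t) = 0.
    by transitivity (x ^+ 3 * y * (y' ^+ 3 * w') - x' ^+ 3 * y' * (y ^+ 3 * w));
      [rewrite ex ey ew; ring | rewrite h subrr].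
  have n0 : l ^+ 4 * (x ^+ 3 * y * (y ^+ 3 * w)) != 0 by nz.
  by move/eqP; rewrite mulf_eq0 (negbTE n0) subr_eq0 => /eqP.
have e2s : s = t ^+ 3.
  have : l ^+ 4 * (w ^+ 3 * x) * (s - t ^+ 3) = 0.
    have c1 : w ^+ 3 * x = - (x ^+ 3 * y + y ^+ 3 * w) by apply/eqP; rewrite -subr_eq0 -F0; apply/eqP; ring.
    transitivity ((x' ^+ 3 * y' + y' ^+ 3 * w' + w' ^+ 3 * x') - l ^+ 4 * x ^+ 3 * y * (s ^+ 3 * t - t ^+ 3)
      - l ^+ 4 * t ^+ 3 * (x ^+ 3 * y + y ^+ 3 * w + w ^+ 3 * x)).
      by rewrite ex ey ew; ring.
    by rewrite F0 F0' e1s subrr; ring.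
  have n0 : l ^+ 4 * (w ^+ 3 * x) != 0 by nz.
  by move/eqP; rewrite mulf_eq0 (negbTE n0) subr_eq0 => /eqP.
have t7 : t ^+ 7 = 1.
  apply: (mulfI (expf_neq0 3 t0')); rewrite mulr1 {2}e1s e2s; ring.
have [k tk] := root7 t7; exists k; apply/proj_eqP; split.
  by rewrite unit_mulmx_eq0 ?phik_unit //; apply: contraNneq m => ->; rewrite /mulX !mxE !mul0r.
have u7 : (z ^+ k) ^+ 7 = 1 by rewrite -tk.
exists (l / z ^+ k); first by rewrite mulf_neq0 // invr_eq0 expf_neq0 // z_neq0.
rewrite phik_col col3Z [v']col3P e0 e1 e2 e0' e1' e2' ex ey ew e2s tk.
have k0 : z ^+ k != 0 by rewrite expf_neq0 // z_neq0.
by congr col3; field.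
Qed.

(* Value of cA / cB at the flex S e_j. *)
Definition flex_t (j : 'I_3) : K :=
  [:: 2 - z ^+ 2 + 2 * z ^+ 3 + 2 * z ^+ 4 - z ^+ 5;
      - 2 * z ^+ 2 - 3 * z ^+ 3 - 3 * z ^+ 4 - 2 * z ^+ 5;
      3 + 3 * z ^+ 2 + z ^+ 3 + z ^+ 4 + 3 * z ^+ 5]`_j.

Lemma Se_col j : SM *m e_pt K j = col3 (SM 0 j) (SM 1 j) (SM 2%:R j).
Proof. by elim/ord3P: j; rewrite e_ptE SM_col !col3E !mxE /=; congr col3; ring. Qed.

Lemma Se_flex j : cA (SM *m e_pt K j) = flex_t j * cB (SM *m e_pt K j).
Proof.
by elim/ord3P: j; rewrite Se_col /cA /cB !col3E !mxE /flex_t /s0 /s1 /s2 /=; ring: z6.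
Qed.

Lemma s0_neq0 : s0 != 0.
Proof.
apply: (@neq0_cert 6 _ (- 3 - 6 * z - 2 * z ^+ 2 - 5 * z ^+ 3 - z ^+ 4 - 4 * z ^+ 5)).
by rewrite /s0; ring: z6.
Qed.
Lemma s1_neq0 : s1 != 0.
Proof.
apply: (@neq0_cert 6 _ (2 + 4 * z - z ^+ 2 + z ^+ 3 + 3 * z ^+ 4 + 5 * z ^+ 5)).
by rewrite /s1; ring: z6.
Qed.
Lemma s2_neq0 : s2 != 0.
Proof.
apply: (@neq0_cert 6 _ (1 + 2 * z + 3 * z ^+ 2 + 4 * z ^+ 3 - 2 * z ^+ 4 - z ^+ 5)).
by rewrite /s2; ring: z6.
Qed.

Lemma Se_mulX j : mulX (SM *m e_pt K j) != 0.
Proof.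
by elim/ord3P: j; rewrite Se_col /mulX !col3E !mxE /= !mulf_neq0 ?s0_neq0 ?s1_neq0 ?s2_neq0.
Qed.

(** The cubic is the one that [flex_point] reaches by elimination. Its roots lie in the real cubic
    subfield of Q(zeta), so it splits into explicit factors. *)
Lemma flex_roots (a b : K) : a ^+ 3 - 5%:R * a ^+ 2 * b - 8%:R * a * b ^+ 2 - b ^+ 3 = 0 ->
  exists j, a = flex_t j * b.
Proof.
move=> h; have : (a - flex_t 0 * b) * (a - flex_t 1 * b) * (a - flex_t 2%:R * b) = 0.
  by rewrite -[RHS]h /flex_t /=; ring: z6.
move/eqP; rewrite !mulf_eq0 !subr_eq0 => /orP[/orP[]|] /eqP ->; by [exists 0 | exists 1 | exists 2%:R].
Qed.

Lemma klein_Se j : ev (kleinF K) (SM *m e_pt K j) = 0.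
Proof. by rewrite klein_S klein_e mulr0. Qed.

(** The hypothesis says that the line pq is an inflectional tangent at p and meets the curve again
    at q. It holds for the pair e_1, e_3 and passes to images under automorphisms. If p is not an
    e_i, the vanishing of the terms of degree 1 and 2 in t, after elimination of the direction of
    the line, leaves a cubic equation for cA / cB at p, whose solutions are the values at the S
    e_j. *)
Lemma flex_point (p q : vec K) (c : K) : c != 0 ->
  (forall s t : K, ev (kleinF K) (s *: p + t *: q) = c * s * t ^+ 3) ->
  (exists i, proj_eq p (e_pt K i)) \/
  (exists k j, proj_eq p (phiM z ^+ k *m (SM *m e_pt K j))).
Proof.
move=> c0 h.
have p0 : p != 0.
  have h1 := h 1 1; have h0 := h 0 1; apply: contraNneq c0 => p0.
  move: h0 h1; rewrite p0 !scaler0 !add0r mulr0 mul0r => ->.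
  by rewrite expr1n !mulr1 => <-.
have F0 : ev (kleinF K) p = 0.
  by have := h 1 0; rewrite scale0r addr0 scale1r expr0n mulr0.
have [m|m] := eqVneq (mulX p) 0; first by left; apply: klein_mulX0.
right; have [x0 y0 w0] := mulX_neq0 m.
have npq (l : K) : q <> l *: p.
  move=> e; have := h 1 1; rewrite e !scale1r -{1}[p]scale1r -scalerDl.
  rewrite (ev_homogZ _ _ (kleinF_homog K)) F0 mulr0 expr1n !mulr1 => /eqP.
  by rewrite eq_sym (negbTE c0).
have F4 t : ev (kleinF K) (1 *: p + t *: q) = c * t ^+ 3 by rewrite h mulr1.
suff [j hj] : exists j, cA p = flex_t j * cB p.
  have e : cA (SM *m e_pt K j) * cB p = cA p * cB (SM *m e_pt K j).
    by rewrite Se_flex hj; ring.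
  by have [k hk] := phi_fiber (klein_Se j) F0 (Se_mulX j) m e; exists k, j.
apply: flex_roots; rewrite /cA /cB; move: F0 F4 npq; rewrite ev_kleinF => F0 F4 npq.
have {}F4 t : (p 0 0 + t * q 0 0) ^+ 3 * (p 1 0 + t * q 1 0) +
   (p 1 0 + t * q 1 0) ^+ 3 * (p 2%:R 0 + t * q 2%:R 0) +
   (p 2%:R 0 + t * q 2%:R 0) ^+ 3 * (p 0 0 + t * q 0 0) = c * t ^+ 3.
  by rewrite -F4 ev_kleinF !mxE !mul1r.
have : col3 (q 0 0) (q 1 0) (q 2%:R 0) <> col3 (q 2%:R 0 / p 2%:R 0 * p 0 0)
    (q 2%:R 0 / p 2%:R 0 * p 1 0) (q 2%:R 0 / p 2%:R 0 * p 2%:R 0).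
  by move=> e; apply: (npq (q 2%:R 0 / p 2%:R 0)); rewrite [LHS]col3P e [RHS]col3P !mxE.
move: F0 F4 x0 y0 w0.
move: (p 0 0) (p 1 0) (p 2%:R 0) (q 0 0) (q 1 0) (q 2%:R 0) => x y w l n r F0 F4 x0 y0 w0 npq'.
(* Replacing q by q - r' p kills its last coordinate; divided by the coordinates of p, the rest is
   (l', n', 0). *)
pose l' := l / x - r / w; pose n' := n / y - r / w; pose r' := r / w.
have el : l = x * (l' + r') by rewrite /l' /r' subrK mulrC divfK.
have en : n = y * (n' + r') by rewrite /n' /r' subrK mulrC divfK.
have er : r = w * r' by rewrite /r' mulrC divfK.
have l'n' : (l' != 0) || (n' != 0).
  rewrite -negb_and; apply/negP => /andP[/eqP l0 /eqP n0]; apply: npq'.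
  by rewrite -/r'; congr col3; rewrite ?el ?en ?er ?l0 ?n0 ?add0r mulrC.
set a := x ^+ 3 * y; set b := y ^+ 3 * w.
have ec : w ^+ 3 * x = - a - b by apply/eqP; rewrite -subr_eq0 -F0; apply/eqP; rewrite /a /b; ring.
(* Coefficients of t and t^2 of F (p + t q), recovered from its values at -2, -1, 1, 2. *)
pose A1 := a * (3%:R * l' + n') + b * (3%:R * n') + w ^+ 3 * x * l'.
pose A2 := a * (l' ^+ 2 + l' * n') + b * n' ^+ 2.
have A10 : A1 = 0.
  have n12 : 12%:R != 0 :> K by rewrite pnatr_eq0.
  apply: (mulfI n12); rewrite mulr0.
  transitivity (8%:R * (c * 1 ^+ 3 - c * (-1) ^+ 3) - (c * 2%:R ^+ 3 - c * (- 2%:R) ^+ 3)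
     - 48%:R * r' * (x ^+ 3 * y + y ^+ 3 * w + w ^+ 3 * x)); last by rewrite F0; ring.
  by rewrite -!F4 el en er /A1 /a /b; ring.
have A20 : A2 = 0.
  have n72 : 72%:R != 0 :> K by rewrite pnatr_eq0.
  apply: (mulfI n72); rewrite mulr0.
  transitivity (16%:R * (c * 1 ^+ 3 + c * (-1) ^+ 3) - (c * 2%:R ^+ 3 + c * (- 2%:R) ^+ 3)
     - 72%:R * r' * A1 - (30%:R + 144%:R * r' ^+ 2) * (x ^+ 3 * y + y ^+ 3 * w + w ^+ 3 * x)).
    by rewrite -!F4 el en er /A1 /A2 /a /b; ring.
  by rewrite F0 A10; ring.
have b0 : b != 0 by rewrite /b; nz.
have E1 : n' * (a + 3%:R * b) = l' * (b - 2%:R * a).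
  by apply/eqP; rewrite -subr_eq0 -A10 /A1 ec; apply/eqP; ring.
have l0 : l' != 0.
  apply: contraTneq l'n' => l0; rewrite l0 eqxx /= negbK; apply/eqP.
  move: A20; rewrite /A2 l0 expr0n mul0r addr0 mulr0 add0r => /eqP.
  by rewrite mulf_eq0 (negbTE b0) expf_eq0 /= => /eqP.
apply: (mulfI (expf_neq0 2 l0)); rewrite mulr0.
(* Multiplying A2 by (a + 3 b)^2 allows [E1] to replace each n' (a + 3 b), leaving l'^2 times the
   cubic in a and b. *)
transitivity (- (a + 3%:R * b) ^+ 2 * A2); last by rewrite A20 mulr0.
transitivity (- (a * l' ^+ 2 * (a + 3%:R * b) ^+ 2 + a * l' * (a + 3%:R * b) * (l' * (b - 2%:R * a))
   + b * (l' * (b - 2%:R * a)) ^+ 2)); first by ring.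
by rewrite -E1 /A2; ring.
Qed.

End Zeta.
End Klein.

(** * Divisors of the forms in play *)

Section Theta.
Variable K : numClosedFieldType.
Implicit Types (u v x : vec K) (M N : 'M[K]_3) (F G : {mpoly K[3]}).
Local Notation F := (kleinF K).

Definition fA : {mpoly K[3]} := 'X_0 ^+ 3 * 'X_1.
Definition fB : {mpoly K[3]} := 'X_1 ^+ 3 * 'X_2%:R.
Definition fC : {mpoly K[3]} := 'X_2%:R ^+ 3 * 'X_0.
Definition fX : {mpoly K[3]} := 'X_0 * 'X_1 * 'X_2%:R.
Definition ell (a b : K) : {mpoly K[3]} := b *: fA - a *: fB.
(* It touches the curve at the points e_i and S e_i, and meets it nowhere else. *)
Definition fG : {mpoly K[3]} :=
  'X_0 ^+ 2 * 'X_1 + 'X_1 ^+ 2 * 'X_2%:R + 'X_2%:R ^+ 2 * 'X_0 + fX.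

Lemma ev_ell a b v : ev (ell a b) v = b * cA v - a * cB v.
Proof. by rewrite /ell /fA /fB !(evB, evZ, evXn, evM, evX). Qed.

Lemma ev_fX v : ev fX v = mulX v.
Proof. by rewrite /fX !(evM, evX). Qed.

Lemma homogXn i n : 'X_i ^+ n \is [in K[3], n.-homog].
Proof. by rewrite -[X in X.-homog]mul1n; apply/dhomogMn/homogX. Qed.

Lemma ell_homog a b : ell a b \is 4.-homog.
Proof. by rewrite rpredB // rpredZ //; apply: (dhomogM (d:=3) (e:=1)); rewrite ?homogXn ?homogX. Qed.

Lemma fX_homog : fX \is 3.-homog.
Proof. by apply: (dhomogM (d:=2) (e:=1)); rewrite ?homogX //; apply: (dhomogM (d:=1) (e:=1)); rewrite ?homogX. Qed.

Lemma fG_homog : fG \is 3.-homog.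
Proof.
by rewrite !rpredD ?fX_homog //; apply: (dhomogM (d:=2) (e:=1)); rewrite ?homogXn ?homogX.
Qed.

Lemma lsub_tauX i : lsub (tauM K) 'X_i = 'X_(i + 1).
Proof.
rewrite lsubX (bigD1 (i + 1)) //= mxE eqxx scale1r big1 ?addr0 // => j hj.
by rewrite mxE (negbTE hj) scale0r.
Qed.

Lemma lsub_tau :
  (lsub (tauM K) fA = fB) * (lsub (tauM K) fB = fC) * (lsub (tauM K) fC = fA) *
  (lsub (tauM K) fX = fX) * (lsub (tauM K) fG = fG) * (lsub (tauM K) F = F).
Proof.
have e1 : (0 + 1 : 'I_3) = 1 by apply/val_inj.
have e2 : (1 + 1 : 'I_3) = 2%:R by apply/val_inj.
have e3 : (2%:R + 1 : 'I_3) = 0 by apply/val_inj.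
rewrite /fA /fB /fC /fG /fX /kleinF !(lsubD, lsubXn, lsubM, lsub_tauX, e1, e2, e3).
by do ![split] => //; ring.
Qed.

(** The span of fA, fB and fC is stable under tau, so it contains the pullbacks of [ell] whose
    orders at e_1 are the orders of [ell] at the other e_i. *)
Definition lin3 (a b c : K) : {mpoly K[3]} := a *: fA + b *: fB + c *: fC.

Lemma lsub_tau_lin3 a b c : lsub (tauM K) (lin3 a b c) = lin3 c a b.
Proof. by rewrite /lin3 !(lsubD, lsubZ, lsub_tau) addrC addrA. Qed.

Lemma ell_lin3 a b : ell a b = lin3 b (- a) 0.
Proof. by rewrite /ell /lin3 scale0r addr0 scaleNr. Qed.

(* Solving F(1, y, t) = 0 for y gives y = - t^3 + O(t^10). *)
Definition arc0 (i : 'I_3) : {poly K} := [:: 1; - 'X ^+ 3; 'X]`_i.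

Lemma arc0P : is_arc F 10 (e_pt K 0) arc0.
Proof.
split; first by elim/ord3P; rewrite e_ptE !col3E /arc0 /= ?hornerE ?expr0n ?oppr0.
rewrite /kleinF !(aevD, aevXn, aevM, aevX) /arc0 /=.
have -> : 1 ^+ 3 * - 'X ^+ 3 + (- 'X ^+ 3) ^+ 3 * 'X + 'X ^+ 3 * 1 = 'X^10 * (-1) :> {poly K} by ring.
exact: dvdp_mulr.
Qed.

Lemma arc_ordX0 : arc_ord F (e_pt K 0) arc0 'X_0 0.
Proof. by apply: arc_ord0 arc0P _; rewrite evX e_ptE col3E oner_eq0. Qed.

(** On the curve (x^3 + y^2 z) y = - x z^3, and x^3 + y^2 z does not vanish at e_1, so y is a local
    multiple of z^3. *)
Lemma arc_ordX1 : arc_ord F (e_pt K 0) arc0 'X_1 3.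
Proof.
split; last by exists (-1); rewrite ?hornerE ?oppr_eq0 ?oner_eq0 // aevX /arc0 /=; ring.
exists ('X_0 ^+ 3 + 'X_1 ^+ 2 * 'X_2%:R), 1, (- 'X_0 * 'X_2%:R ^+ 3), 3%N.
split.
  rewrite rpredD ?homogXn //; apply: (dhomogM (d:=2) (e:=1)); rewrite ?homogXn ?homogX //.
split; first by rewrite !(evD, evXn, evM, evX) e_ptE !col3E expr1n mulr0 addr0 oner_eq0.
split; last by rewrite /kleinF; ring.
apply: ipow_mull; apply: (@ipowM _ _ 1 2); last apply: (@ipowM _ _ 1 1);
  by apply: ipow_lin; rewrite ?homogX // evX e_ptE col3E.
Qed.

Lemma arc_ordX2 : arc_ord F (e_pt K 0) arc0 'X_2%:R 1.
Proof.
split; last by exists 1; rewrite ?hornerE ?oner_eq0 // aevX /arc0 /=; ring.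
by apply: ordge_ideal; apply: ipow_lin; rewrite ?homogX // evX e_ptE col3E.
Qed.

Lemma arc_ord_fX : arc_ord F (e_pt K 0) arc0 fX 4.
Proof. exact: arc_ordM (arc_ordM arc_ordX0 arc_ordX1) arc_ordX2. Qed.

(** At e_1 both x^3 y and z^3 x have order 3, with leading terms -t^3 and t^3 along the arc, while
    y^3 z has order 10. The hypothesis prevents the leading terms from cancelling. *)
Lemma arc_ord_lin3 a b c : a != c -> arc_ord F (e_pt K 0) arc0 (lin3 a b c) 3.
Proof.
move=> ac; have [[[g0 _] [g1 _]] [g2 _]] := (arc_ordX0, arc_ordX1, arc_ordX2).
split.
  apply: ordgeD; last by apply/ordgeZ; apply: (@ordgeM _ _ _ _ _ 3 0); [apply: (ordgeXn 3 g2)|].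
  apply: ordgeD; apply/ordgeZ; first exact/ordge_mull.
  by apply: (@ordge_leq _ _ _ _ 3 10) => //; apply: (@ordgeM _ _ _ _ _ 9 1) => //; apply: (ordgeXn 3 g1).
exists ((c - a)%:P - b%:P * 'X^7).
  by rewrite hornerD hornerN hornerM !hornerC hornerXn expr0n mulr0 subr0 subr_eq0 eq_sym.
rewrite /lin3 /fA /fB /fC !(aevD, aevZ, aevXn, aevM, aevX) /arc0 /= polyCB; ring.
Qed.

Lemma arc_ord_fG : arc_ord F (e_pt K 0) arc0 fG 2.
Proof.
have [[[g0 _] [g1 _]] [g2 _]] := (arc_ordX0, arc_ordX1, arc_ordX2).
split.
  apply: ordgeD; last first.
    by case: arc_ord_fX => h _; apply: ordge_leq h.
  apply: ordgeD; last by apply: (@ordgeM _ _ _ _ _ 2 0); [apply: (ordgeXn 2 g2)|].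
  apply: ordgeD; first by apply: (@ordge_leq _ _ _ _ 2 3) => //; apply/ordge_mull.
  apply: (@ordge_leq _ _ _ _ 2 7) => //; apply: (@ordgeM _ _ _ _ _ 6 1) => //.
  exact: (ordgeXn 2 g1).
exists (1 - 'X - 'X^2 + 'X^5); first by rewrite !(hornerD, hornerN, hornerXn, hornerX, hornerC) !expr0n !subr0 addr0 oner_eq0.
rewrite /fG /fX !(aevD, aevXn, aevM, aevX) /arc0 /=; ring.
Qed.

(** * Orders at the points of the curve off the coordinate triangle *)

Section Tangent.
Variable x : vec K.
Hypotheses (x0 : x != 0) (hx : ev F x = 0) (mx : mulX x != 0).

(* Tangent vector at [x], in coordinates scaled by those of [x]. *)
Definition tan0 : K := cA x + 3%:R * cB x.
Definition tan1 : K := cB x - 2%:R * cA x.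
(** The tangent line, which agrees with the curve to first order. This is enough where the forms
    have order 0 or 1. *)
Definition arc1 (i : 'I_3) : {poly K} :=
  [:: (x 0 0)%:P * (1 + tan0%:P * 'X); (x 1 0)%:P * (1 + tan1%:P * 'X); (x 2%:R 0)%:P]`_i.

Lemma arc1P : is_arc F 2 x arc1.
Proof.
split; first by elim/ord3P; rewrite /arc1 /= !hornerE ?mulr0 ?addr0 ?mulr1.
rewrite /kleinF !(aevD, aevXn, aevM, aevX) /arc1 /=.
have h0 : (cA x)%:P + (cB x)%:P + (cC x)%:P = 0 by rewrite -!polyCD -kleinE hx.
have h1 : (cA x)%:P * (3%:R * tan0%:P + tan1%:P) + (cB x)%:P * (3%:R * tan1%:P) + (cC x)%:P * tan0%:P = 0.
  have -> : (cC x)%:P = - (cA x)%:P - (cB x)%:P by apply/eqP; rewrite -subr_eq0 -h0; apply/eqP; ring.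
  by rewrite /tan0 /tan1 !(polyCD, polyCN, polyCM, polyC_natr); ring.
pose W : {poly K} := (cA x)%:P * (3%:R * tan0%:P ^+ 2 + 3%:R * tan0%:P * tan1%:P +
   (3%:R * tan0%:P ^+ 2 * tan1%:P + tan0%:P ^+ 3) * 'X + tan0%:P ^+ 3 * tan1%:P * 'X^2)
   + (cB x)%:P * (3%:R * tan1%:P ^+ 2 + tan1%:P ^+ 3 * 'X).
apply/dvdpP; exists W; rewrite -[RHS]addr0 -[in RHS](mul0r 'X) -h1 -[RHS]addr0 -h0 /W.
rewrite /cA /cB /cC !(polyCD, polyCM, rmorphXn) /=; ring.
Qed.

(** The order is the truth value of vanishing read as 0 or 1. At a zero, the derivative along the
    tangent is 7 b cA (cA + cB), which is nonzero: the quotient by phi is unramified off the e_i, so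
    every point of a fibre counts once. *)
Lemma arc_ord_ell a b : b != 0 -> a + b != 0 -> 
  arc_ord F x arc1 (ell a b) (ev (ell a b) x == 0).
Proof.
move=> b0 ab0; have [h|h] := eqVneq (ev (ell a b) x) 0; last exact: arc_ord0 arc1P h.
split; first exact/ordge_ideal/homog_in_pt_ideal/h/ell_homog.
pose p0 : {poly K} := tan0%:P; pose p1 : {poly K} := tan1%:P.
pose w : {poly K} := b%:P * (cA x)%:P * (3%:R * p0 + p1 + (3%:R * p0 ^+ 2 + 3%:R * p0 * p1) * 'X
   + (p0 ^+ 3 + 3%:R * p0 ^+ 2 * p1) * 'X^2 + p0 ^+ 3 * p1 * 'X^3)
  - a%:P * (cB x)%:P * (3%:R * p1 + 3%:R * p1 ^+ 2 * 'X + p1 ^+ 3 * 'X^2).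
have [y0 y1 y2] := mulX_neq0 mx.
have e : a * cB x = b * cA x by apply/eqP; rewrite eq_sym -subr_eq0 -ev_ell h.
have cB0 : cB x != 0 by rewrite /cB; nz.
have cA0 : cA x != 0 by rewrite /cA; nz.
exists w.
  rewrite /w /p0 /p1 !(hornerD, hornerN, hornerXn, hornerX, hornerC, hornerM, horner_exp, hornerMn) !expr0n !(mulr0, addr0) /=.
  have -> : b * cA x * (3%:R * tan0 + tan1) - a * cB x * (3%:R * tan1) =
     7%:R * (b * cA x) * (cA x + cB x) by rewrite e /tan0 /tan1; ring.
  have n7 : 7%:R != 0 :> K by rewrite pnatr_eq0.
  have : cA x + cB x != 0.
    apply: contraNneq ab0 => ab; rewrite -(mulIr_eq0 _ (mulIf cB0)) mulrDl e -mulrDr ab mulr0 //.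
  by move=> ?; nz.
have eP : a%:P * (cB x)%:P = b%:P * (cA x)%:P by rewrite -!polyCM e.
transitivity ('X^(1%N) * w + (b%:P * (cA x)%:P - a%:P * (cB x)%:P)); last by rewrite eP subrr addr0.
rewrite /w /ell /fA /fB -scaleNr !(aevD, aevZ, aevXn, aevM, aevX) /arc1 /= -/p0 -/p1 polyCN.
by rewrite /cA /cB !(polyCM, rmorphXn) /=; ring.
Qed.
End Tangent.

Lemma e_pt_proj i j : proj_eq (e_pt K i) (e_pt K j) = (i == j).
Proof.
apply/idP/eqP => [/proj_eqP[_ [c c0 /colP/(_ i)]]|->]; last exact/proj_eq_refl/e_pt_neq0.
rewrite !mxE eqxx; case: eqP => // _; rewrite mulr0 => /eqP; by rewrite oner_eq0.
Qed.

Lemma mulX_proj_e x i : proj_eq x (e_pt K i) -> mulX x = 0 /\ ev F x = 0.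
Proof.
case/proj_eqP => _ [c c0 ->]; rewrite mulXZ mulX_e mulr0; split=> //.
by rewrite (ev_homogZ _ _ (kleinF_homog K)) klein_e mulr0.
Qed.

Lemma eta_e x i : proj_eq x (e_pt K i) -> eta_sym_div x = 2.
Proof.
move=> h; rewrite /eta_sym_div /div_of_pts /= !(proj_eq_congl _ h) !e_pt_proj.
by elim/ord3P: i {h}.
Qed.

Lemma eta_0 x : ~ (exists i, proj_eq x (e_pt K i)) -> eta_sym_div x = 0.
Proof.
move=> h; rewrite /eta_sym_div /div_of_pts /=.
have n i : proj_eq x (e_pt K i) = false by apply/negP => hi; apply: h; exists i.
by rewrite !n.
Qed.

Lemma eta_mulX x : mulX x != 0 -> eta_sym_div x = 0.
Proof. by move=> h; apply: eta_0 => -[i /mulX_proj_e[/eqP]]; rewrite (negbTE h). Qed.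

Lemma eta_off x : ev F x != 0 -> eta_sym_div x = 0.
Proof. by move=> h; apply: eta_0 => -[i /mulX_proj_e[_ /eqP]]; rewrite (negbTE h). Qed.

Lemma tau_e i : tauM K *m e_pt K (i + 1) = e_pt K i.
Proof.
have e1 : (0 + 1 : 'I_3) = 1 by apply/val_inj.
have e2 : (1 + 1 : 'I_3) = 2%:R by apply/val_inj.
have e3 : (2%:R + 1 : 'I_3) = 0 by apply/val_inj.
by elim/ord3P: i; rewrite ?e1 ?e2 ?e3 tauM_col !e_ptE !col3E.
Qed.

(** Since tau permutes the e_i cyclically, the order at each of them is the order at e_1 of an
    iterated pullback. The bound 10 is the order to which F vanishes along [arc0]. *)
Lemma ordeq_e (G : {mpoly K[3]}) k i : (k < 10)%N ->
  (forall j, arc_ord F (e_pt K 0) arc0 (iter j (lsub (tauM K)) G) k) ->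
  ord_eq F (e_pt K i) G k.
Proof.
move=> k10 h.
have step (H : {mpoly K[3]}) v : ord_eq F v (lsub (tauM K) H) k -> ord_eq F (tauM K *m v) H k.
  by move/(ordeq_lsubP (c := 1)); rewrite oner_eq0 scale1r; apply => //; rewrite ?lsub_tau ?tau_unit.
have h0 := arc_ord_eq arc0P k10 (h 0%N).
have h1 := step _ _ (arc_ord_eq arc0P k10 (h 1%N)).
have h2 := step _ _ (step _ _ (arc_ord_eq arc0P k10 (h 2%N))).
have t2 : tauM K *m e_pt K 0 = e_pt K 2%:R by rewrite -[RHS]tau_e; congr (_ *m e_pt K _); apply/val_inj.
have t1 : tauM K *m e_pt K 2%:R = e_pt K 1 by rewrite -[RHS]tau_e; congr (_ *m e_pt K _); apply/val_inj.
by move: h0 h1 h2; rewrite t2 t1; elim/ord3P: i.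
Qed.

(** A multiple of the equation has order at least every k, so one point of exact finite order
    excludes it. *)
Lemma ordeq_not_mul F' x (G : {mpoly K[3]}) k : ord_eq F' x G k -> ~ exists A, G = A * F'.
Proof.
move=> [_ h] [A e]; apply: h; exists 1, A, 0, 0%N.
rewrite dhomog1 /ev meval1 oner_eq0 mul1r e addr0; do 3![split=> //].
by exists 0%N, (fun=> 0), (fun _ _ => 0); split=> [[]//|]; rewrite big_ord0.
Qed.

(** The pullbacks are given by the cyclic shifts of (b, -a, 0); their first and last entries differ
    precisely when b, a and a + b are nonzero. *)
Lemma arc_ord_ell_iter a b j : a != 0 -> b != 0 -> a + b != 0 ->
  arc_ord F (e_pt K 0) arc0 (iter j (lsub (tauM K)) (ell a b)) 3.
Proof.
move=> a0 b0 ab; rewrite ell_lin3.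
suff [t q h] : exists2 t : K * K * K, iter j (lsub (tauM K)) (lin3 b (- a) 0) = lin3 t.1.1 t.1.2 t.2
   & t \in [:: (b, - a, 0); (0, b, - a); (- a, 0, b)].
  move: h; rewrite !inE => /or3P[] /eqP e; rewrite q e /=; apply: arc_ord_lin3 => //.
  - by rewrite eq_sym oppr_eq0.
  - by rewrite eq_sym -addr_eq0 addrC.
elim: j => [|j [t e ht]]; first by exists (b, - a, 0); rewrite ?inE ?eqxx.
exists (t.2, t.1.1, t.1.2); first by rewrite iterS e lsub_tau_lin3.
by move: ht; rewrite !inE => /or3P[] /eqP -> /=; rewrite eqxx ?orbT.
Qed.

Lemma iter_lsubM M (G H : {mpoly K[3]}) j : iter j (lsub M) (G * H) = iter j (lsub M) G * iter j (lsub M) H.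
Proof. by elim: j => //= j ->; rewrite lsubM. Qed.

Lemma iter_lsubZ M c (G : {mpoly K[3]}) j : iter j (lsub M) (c *: G) = c *: iter j (lsub M) G.
Proof. by elim: j => //= j ->; rewrite lsubZ. Qed.

Lemma iter_tau_fX j : iter j (lsub (tauM K)) fX = fX.
Proof. by elim: j => //= j ->; rewrite lsub_tau. Qed.

Lemma iter_tau_fG j : iter j (lsub (tauM K)) fG = fG.
Proof. by elim: j => //= j ->; rewrite lsub_tau. Qed.

Lemma ordeq_proj x y (G : {mpoly K[3]}) k : proj_eq x y -> ord_eq F y G k -> ord_eq F x G k.
Proof. by case/proj_eqP => _ [c c0 ->]; apply: ordeq_scale. Qed.

(** * The class of a divisor made of two fibres of the quotient by phi *)

Section Residual.
Variables (D : divisor K) (a b a' b' : K).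
Hypotheses (a0 : a != 0) (b0 : b != 0) (ab0 : a + b != 0).
Hypotheses (a0' : a' != 0) (b0' : b' != 0) (ab0' : a' + b' != 0).
Hypothesis nprop : a * b' != a' * b.
Hypothesis Doff : forall x, x != 0 -> ev F x != 0 -> D x = 0.
Hypothesis De : forall x, x != 0 -> ev F x = 0 -> mulX x = 0 -> D x = 0.
Hypothesis Don : forall x, x != 0 -> ev F x = 0 -> mulX x != 0 ->
  D x = ((ev (ell a b) x == 0%R) + (ev (ell a' b') x == 0%R))%N%:Z.

Let q := ell a b * ell a' b'.

Lemma q_homog : q \is 8.-homog.
Proof. by apply: (dhomogM (d:=4) (e:=4)); rewrite ell_homog. Qed.

Lemma arc_ord_q_tan x : x != 0 -> ev F x = 0 -> mulX x != 0 ->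
  exists2 k, arc_ord F x (arc1 x) q k & (k < 2)%N /\ D x = k%:Z.
Proof.
move=> x0 hx mx; exists ((ev (ell a b) x == 0%R) + (ev (ell a' b') x == 0%R))%N.
  by apply: arc_ordM; apply: arc_ord_ell.
split; last exact: Don.
(* The two fibres are disjoint: a common point would make (a : b) and (a' : b') proportional. *)
case: eqVneq => // e1; case: eqVneq => // e2; exfalso; move/eqP: nprop; apply.
have [y0 y1 y2] := mulX_neq0 mx; move: e1 e2; rewrite !ev_ell => /eqP e1 /eqP e2.
have cB0 : cB x != 0 by rewrite /cB; nz.
apply: (mulIf cB0); move: e1 e2; rewrite !subr_eq0 => /eqP e1 /eqP e2.
by rewrite mulrAC -e1 [RHS]mulrAC -e2; ring.
Qed.

Lemma arc_ord_q_e j : arc_ord F (e_pt K 0) arc0 (iter j (lsub (tauM K)) q) 6.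
Proof. by rewrite iter_lsubM; apply: (@arc_ordM _ _ _ _ _ _ 3 3); apply: arc_ord_ell_iter. Qed.

Lemma theta_e : lin_equiv F D (-3) (@eta_sym_div K) (-1).
Proof.
have oqe i : ord_eq F (e_pt K i) q 6 by apply: ordeq_e => // j; apply: arc_ord_q_e.
have oXe i : ord_eq F (e_pt K i) (fX ^+ 2) 8.
  apply: ordeq_e => // j; rewrite expr2 iter_lsubM iter_tau_fX.
  by apply: (@arc_ordM _ _ _ _ _ _ 4 4); apply: arc_ord_fX.
split=> [x x0 hx|]; first by rewrite Doff // eta_off.
(* The degrees match as 8 - 3 = 6 - 1. At e_i the orders 6 and 8 differ by -2, the coefficient of
   e_i in the difference of the divisors. *)
exists q, (fX ^+ 2), 8%N, 6%N; rewrite q_homog (dhomogMn (d:=3) 2 fX_homog).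
do 3!split=> //; split; first exact: ordeq_not_mul (oqe 0).
split; first exact: ordeq_not_mul (oXe 0).
move=> x x0 hx; have [m|m] := eqVneq (mulX x) 0.
  have [i hi] := klein_mulX0 hx x0 m; exists 6%N, 8%N.
  rewrite De // (eta_e hi); split; first exact: ordeq_proj hi (oqe i).
  by split=> //; exact: ordeq_proj hi (oXe i).
have [k hk [k2 Dk]] := arc_ord_q_tan x0 hx m; exists k, 0%N.
rewrite Dk eta_mulX //; split; first exact: arc_ord_eq (arc1P hx) k2 hk.
split=> //; apply: (arc_ord_eq (arc1P hx)) => //; apply: arc_ord0 (arc1P hx) _.
by rewrite evXn ev_fX expf_neq0.
Qed.

(** * The same divisor compared with the image of 2 (e_1 + e_2 + e_3) under S *)

Section SResidual.
Variable z : K.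
Hypothesis hz : 7.-primitive_root z.
Hypothesis nflex : forall j, a != flex_t z j * b.
Hypothesis nflex' : forall j, a' != flex_t z j * b'.
Local Notation S := (SM z).

Lemma zP6 (R := {mpoly K[3]}) :
  (z%:MP : R) ^+ 6 = - (1 + z%:MP + z%:MP ^+ 2 + z%:MP ^+ 3 + z%:MP ^+ 4 + z%:MP ^+ 5).
Proof. by rewrite -!rmorphXn /= (z6 hz) -(mpolyC1 3 K) -!mpolyCD -mpolyCN. Qed.

Lemma lsub_S :
  let s0 : {mpoly K[3]} := z%:MP - z%:MP ^+ 6 in
  let s1 : {mpoly K[3]} := z%:MP ^+ 2 - z%:MP ^+ 5 in
  let s2 : {mpoly K[3]} := z%:MP ^+ 4 - z%:MP ^+ 3 in
  (lsub S 'X_0 = s0 * 'X_0 + s1 * 'X_1 + s2 * 'X_2%:R) *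
  (lsub S 'X_1 = s1 * 'X_0 + s2 * 'X_1 + s0 * 'X_2%:R) *
  (lsub S 'X_2%:R = s2 * 'X_0 + s0 * 'X_1 + s1 * 'X_2%:R).
Proof.
move=> t0 t1 t2; have [[e0 e1] e2] : (t0 = (s0 z)%:MP) * (t1 = (s1 z)%:MP) * (t2 = (s2 z)%:MP).
  by rewrite /t0 /t1 /t2 /s0 /s1 /s2 !mpolyCB !rmorphXn.
by rewrite !lsubX !sum3 !mxE /= -!mul_mpolyC e0 e1 e2.
Qed.

Lemma lsub_S_F : lsub S F = 49%:R *: F.
Proof.
rewrite -mul_mpolyC mpolyC_nat /kleinF !(lsubD, lsubXn, lsubM, lsub_S); ring: zP6.
Qed.

(** This is -7 g with g = 1 + 2 (z + z^2 + z^4) the quadratic Gauss sum. Since g^2 = -7, its square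
    is (-7)^3, as it must be for a cubic when S^2 = -7. *)
Definition kapS : K := - 7 - 14 * z - 14 * z ^+ 2 - 14 * z ^+ 4.

Lemma kapS_neq0 : kapS != 0.
Proof.
apply: (@neq0_cert _ 48 _ (1 + 2 * z + 2 * z ^+ 2 + 2 * z ^+ 4)).
by rewrite /kapS; ring: (z6 hz).
Qed.

Lemma lsub_S_fG : lsub S fG = kapS *: fG.
Proof.
have -> : kapS *: fG = (- 7%:R - 14%:R * z%:MP - 14%:R * z%:MP ^+ 2 - 14%:R * z%:MP ^+ 4) * fG.
  by rewrite -mul_mpolyC /kapS; congr (_ * _); rewrite !(mpolyCB, mpolyCN, mpolyCM, mpolyC_nat, rmorphXn).
rewrite /fG /fX !(lsubD, lsubXn, lsubM, lsub_S); ring: zP6.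
Qed.

Lemma lsub_SS_fX : lsub S (lsub S fX) = (- 343%:R) *: fX.
Proof.
rewrite lsub_comp (SM2 hz) -mul_mpolyC mpolyCN mpolyC_nat /fX !lsubM !lsubX !sum3 !mxE /=.
rewrite !mulr0n !scale0r !mulr1n !addr0 !add0r -!mul_mpolyC mpolyCN mpolyC_nat; ring.
Qed.

Lemma ordeq_Se (G : {mpoly K[3]}) k j : ord_eq F (e_pt K j) (lsub S G) k ->
  ord_eq F (S *m e_pt K j) G k.
Proof.
apply: (iffLR (ordeq_lsubP _ _ _ _ (SM_unit hz) lsub_S_F)).
by rewrite pnatr_eq0.
Qed.

(** In the coordinates v = y / x and t = z / y, the two equations combine to one that is linear in
    t. Eliminating t gives the square of v^3 + v^2 - 2 v - 1, the minimal polynomial of zeta + 1 /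
    zeta; the square reflects the tangency of the cubic and the quartic. Each of the three roots v
    determines t, and the point is one of the S e_j. *)
Lemma fG_zero x : ev F x = 0 -> mulX x != 0 -> ev fG x = 0 ->
  exists j, proj_eq x (S *m e_pt K j).
Proof.
move=> hx m; have [] := mulX_neq0 m; have ep := col3P x.
have hG : ev fG x = x 0 0 ^+ 2 * x 1 0 + x 1 0 ^+ 2 * x 2%:R 0 + x 2%:R 0 ^+ 2 * x 0 0
    + x 0 0 * x 1 0 * x 2%:R 0 by rewrite /fG /fX !(evD, evXn, evM, evX).
move: hx; rewrite hG ev_kleinF; move: {hG m} ep.
move: (x 0 0) (x 1 0) (x 2%:R 0) => p y w -> hF p0 y0 w0 hG.
pose v := y / p; pose t := w / y.
have ey : y = v * p by rewrite /v divfK.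
have ew : w = t * v * p by rewrite -mulrA -ey /t divfK.
have v0 : v != 0 by rewrite /v; nz.
have t0 : t != 0 by rewrite /t; nz.
have E1 : 1 + t * v ^+ 3 + t ^+ 3 * v ^+ 2 = 0.
  have n0 : p ^+ 4 * v != 0 by nz.
  by apply: (mulfI n0); rewrite mulr0 -hF ew ey; ring.
have E2 : 1 + t * v ^+ 2 + t ^+ 2 * v + t * v = 0.
  have n0 : p ^+ 3 * v != 0 by nz.
  by apply: (mulfI n0); rewrite mulr0 -hG ew ey; ring.
have E3 : v ^+ 2 + v * t ^+ 2 - v - t - 1 = 0.
  have n0 : v * t != 0 by nz.
  apply: (mulfI n0); rewrite mulr0.
  by transitivity ((1 + t * v ^+ 3 + t ^+ 3 * v ^+ 2) - (1 + t * v ^+ 2 + t ^+ 2 * v + t * v));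
    [ring | rewrite E1 E2 subrr].
have E4 : (v ^+ 2 + v + 1) * t = v ^+ 2 - v - 2%:R.
  apply/eqP; rewrite -subr_eq0; apply/eqP.
  by transitivity ((1 + t * v ^+ 2 + t ^+ 2 * v + t * v) - (v ^+ 2 + v * t ^+ 2 - v - t - 1));
    [ring | rewrite E3 E2 subrr].
have E5 : (v ^+ 3 + v ^+ 2 - 2%:R * v - 1) ^+ 2 = 0.
  transitivity ((v ^+ 2 + v + 1) ^+ 2 * (v ^+ 2 + v * t ^+ 2 - v - t - 1)); last by rewrite E3 mulr0.
  transitivity ((v ^+ 2 - v - 1) * (v ^+ 2 + v + 1) ^+ 2 + v * ((v ^+ 2 + v + 1) * t) ^+ 2
     - ((v ^+ 2 + v + 1) * t) * (v ^+ 2 + v + 1)); last by ring.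
  by rewrite E4; ring.
have fin (j : 'I_3) (th th' r0 r1 r2 : K) : S *m e_pt K j = col3 r0 r1 r2 -> r0 != 0 ->
    r1 = th * r0 -> r2 = th' * r1 -> th ^+ 2 + th + 1 != 0 ->
    (th ^+ 2 + th + 1) * th' = th ^+ 2 - th - 2%:R -> v = th ->
    exists j, proj_eq (col3 p y w) (S *m e_pt K j).
  move=> ej r00 e1 e2 n0 eth ev; exists j; apply/proj_eqP; split.
    by rewrite (unit_mulmx_eq0 _ (SM_unit hz)) e_pt_neq0.
  have et : t = th' by apply: (mulfI n0); rewrite eth -ev E4.
  exists (p / r0); first by nz.
  by rewrite ej col3Z e2 e1 ew ey et ev; congr col3; field.
have : (v - (z + z ^+ 6)) * (v - (z ^+ 2 + z ^+ 5)) * (v - (z ^+ 3 + z ^+ 4)) = 0.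
  transitivity (v ^+ 3 + v ^+ 2 - 2%:R * v - 1); first by ring: (z6 hz).
  by move/eqP: E5; rewrite expf_eq0 => /andP[_ /eqP].
move/eqP; rewrite !mulf_eq0 !subr_eq0 => /orP[/orP[]|] /eqP e.
- apply: (fin 0 _ (z ^+ 2 + z ^+ 5) _ _ _ (Se_col _ _) _ _ _ _ _ e); rewrite ?mxE /=.
  + exact: s0_neq0.
  + by rewrite /s0 /s1; ring: (z6 hz).
  + by rewrite /s1 /s2; ring: (z6 hz).
  + apply: (@neq0_cert _ 6 _ (5 - z ^+ 2 + 2 * z ^+ 3 + 2 * z ^+ 4 - z ^+ 5)); ring: (z6 hz).
  + by ring: (z6 hz).
- apply: (fin 1 _ (z ^+ 3 + z ^+ 4) _ _ _ (Se_col _ _) _ _ _ _ _ e); rewrite ?mxE /=.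
  + exact: s1_neq0.
  + by rewrite /s1 /s2; ring: (z6 hz).
  + by rewrite /s0 /s2; ring: (z6 hz).
  + apply: (@neq0_cert _ 6 _ (3 - 2 * z ^+ 2 - 3 * z ^+ 3 - 3 * z ^+ 4 - 2 * z ^+ 5)); ring: (z6 hz).
  + by ring: (z6 hz).
- apply: (fin 2%:R _ (z + z ^+ 6) _ _ _ (Se_col _ _) _ _ _ _ _ e); rewrite ?mxE /=.
  + exact: s2_neq0.
  + by rewrite /s0 /s2; ring: (z6 hz).
  + by rewrite /s1 /s0; ring: (z6 hz).
  + apply: (@neq0_cert _ 6 _ (6 + 3 * z ^+ 2 + z ^+ 3 + z ^+ 4 + 3 * z ^+ 5)); ring: (z6 hz).
  + by ring: (z6 hz).
Qed.

Lemma SS_col v : S *m (S *m v) = (- 7%:R) *: v.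
Proof. by rewrite mulmxA (SM2 hz) mul_scalar_mx. Qed.

Lemma ev_q_Se j : ev q (S *m e_pt K j) != 0.
Proof.
have [y0 y1 y2] := mulX_neq0 (Se_mulX hz j).
have cB0 : cB (S *m e_pt K j) != 0 by rewrite /cB; nz.
have n (c d : K) : c != flex_t z j * d -> ev (ell c d) (S *m e_pt K j) != 0.
  move=> h; rewrite ev_ell (Se_flex hz); set y := cB _.
  have -> : d * (flex_t z j * y) - c * y = (flex_t z j * d - c) * y by ring.
  by rewrite mulf_neq0 // subr_eq0 eq_sym.
by rewrite /q evM mulf_neq0 // n.
Qed.

(** The quotient q / (xyz)^2 is multiplied by fG / ((xyz) o S). The numerator has divisor 2 sum e_i
    + 2 sum S e_i and the denominator 4 sum S e_i, so D - 2 sum e_i becomes D - 2 sum S e_i. *)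
Lemma theta_S : lin_equiv F D (-3) (fun x => eta_sym_div (S *m x)) (-1).
Proof.
pose G1 := q * fG; pose G2 := fX ^+ 2 * lsub S fX.
have o1e i : ord_eq F (e_pt K i) G1 8.
  apply: ordeq_e => // j; rewrite iter_lsubM iter_tau_fG.
  exact: (@arc_ordM _ _ _ _ _ _ 6 2) (arc_ord_q_e j) arc_ord_fG.
have S_neq0 x : x != 0 -> S *m x != 0 by rewrite unit_mulmx_eq0 // SM_unit.
have oM (x : vec K) (g : 'I_3 -> {poly K}) n (G H : {mpoly K[3]}) k :
    is_arc F n x g -> ev H x != 0 -> arc_ord F x g G k -> arc_ord F x g (G * H) k.
  by move=> hg hH h; rewrite -[k]addn0; apply: arc_ordM h (arc_ord0 hg hH).
have tauS_iter j (H : {mpoly K[3]}) v : ev (iter j (lsub (tauM K)) H) v = ev H (tauM K ^+ j *m v).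
  elim: j v => [|j IH] v; first by rewrite mul1mx.
  by rewrite iterS ev_lsub IH mulmxA exprSr.
have tau_iter_e j i : exists i', tauM K ^+ j *m e_pt K i = e_pt K i'.
  elim: j i => [|j IH] i; first by exists i; rewrite mul1mx.
  have [i' hi'] : exists i', tauM K *m e_pt K i = e_pt K i'.
    by exists (i - 1); rewrite -[X in e_pt K X](subrK 1) tau_e.
  by rewrite exprSr -mulmxA hi'; apply: IH.
have o2e i : ord_eq F (e_pt K i) G2 8.
  apply: ordeq_e => // j; rewrite iter_lsubM expr2 iter_lsubM iter_tau_fX.
  apply: (oM _ _ _ _ _ _ arc0P); last exact: (@arc_ordM _ _ _ _ _ _ 4 4) arc_ord_fX arc_ord_fX.
  rewrite tauS_iter ev_lsub ev_fX; have [i' ->] := tau_iter_e j 0.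
  exact: Se_mulX.
have o1S j : ord_eq F (S *m e_pt K j) G1 2.
  apply: ordeq_Se; apply: ordeq_e => // n; rewrite lsubM lsub_S_fG -mul_mpolyC mulrCA mul_mpolyC.
  rewrite iter_lsubZ (iter_lsubM _ (lsub S q) fG) iter_tau_fG mulrC.
  apply: arc_ordZ kapS_neq0 _; apply: (oM _ _ _ _ _ _ arc0P); last exact: arc_ord_fG.
  by rewrite tauS_iter ev_lsub; have [i' ->] := tau_iter_e n 0; apply: ev_q_Se.
have o2S j : ord_eq F (S *m e_pt K j) G2 4.
  apply: ordeq_Se; apply: ordeq_e => // n; rewrite lsubM lsub_SS_fX -mul_mpolyC mulrCA mul_mpolyC.
  rewrite iter_lsubZ (iter_lsubM _ (lsub S (fX ^+ 2)) fX) iter_tau_fX mulrC.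
  have n343 : - 343%:R != 0 :> K by rewrite oppr_eq0 pnatr_eq0.
  apply: arc_ordZ n343 _; apply: (oM _ _ _ _ _ _ arc0P); last exact: arc_ord_fX.
  rewrite tauS_iter ev_lsub; have [i' ->] := tau_iter_e n 0.
  by rewrite evXn ev_fX expf_neq0 // Se_mulX.
split=> [x x0 hx|].
  rewrite Doff // eta_off // klein_S //; apply: mulf_neq0 => //; by rewrite pnatr_eq0.
(* The degrees match as 11 - 3 = 9 - 1. The orders are 8 and 8 at e_i, 2 and 4 at S e_i. *)
exists G1, G2, 11%N, 9%N.
rewrite /G1 /G2 (dhomogM (d:=8) (e:=3)) ?q_homog ?fG_homog //.
rewrite (dhomogM (d:=6) (e:=3)) ?lsub_homog ?fX_homog ?(dhomogMn (d:=3) 2 fX_homog) //.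
do 3!split=> //; split; first exact: ordeq_not_mul (o1e 0).
split; first exact: ordeq_not_mul (o2e 0).
move=> x x0 hx; have [m|m] := eqVneq (mulX x) 0.
  have [i hi] := klein_mulX0 hx x0 m; exists 8%N, 8%N.
  rewrite De // eta_mulX; last first.
    case/proj_eqP: hi => _ [c c0 ->]; rewrite -scalemxAr mulXZ.
    by rewrite mulf_neq0 ?expf_neq0 ?Se_mulX.
  split; first exact: ordeq_proj hi (o1e i).
  by split=> //; exact: ordeq_proj hi (o2e i).
have [mS|mS] := eqVneq (mulX (S *m x)) 0.
  have hSx : ev F (S *m x) = 0 by rewrite klein_S // hx mulr0.
  have [j hj] := klein_mulX0 hSx (S_neq0 _ x0) mS.
  have hj' : proj_eq x (S *m e_pt K j).
    have n7 := neg7_neq0 K.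
    by rewrite -(proj_eqZl _ _ n7) -SS_col proj_eqM // SM_unit.
  exists 2%N, 4%N; rewrite (eta_e hj) Don //.
  have : ev q x != 0.
    case/proj_eqP: hj' => _ [c c0 ->]; rewrite (ev_homogZ _ _ q_homog).
    by rewrite mulf_neq0 ?expf_neq0 ?ev_q_Se.
  rewrite /q evM mulf_eq0 negb_or => /andP[/negbTE -> /negbTE ->].
  split; first exact: ordeq_proj hj' (o1S j).
  by split=> //; exact: ordeq_proj hj' (o2S j).
have [k hk [k2 Dk]] := arc_ord_q_tan x0 hx m; exists k, 0%N.
rewrite Dk eta_mulX //; split.
  apply: (arc_ord_eq (arc1P hx) k2); apply: (oM _ _ _ _ _ _ (arc1P hx)) => //.
  apply/eqP => /(fG_zero hx m)[j /proj_eqP[_ [c c0 e]]]; move/eqP: mS; apply.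
  by rewrite e -scalemxAr SS_col !mulXZ mulX_e !mulr0.
split=> //; apply: (arc_ord_eq (arc1P hx)) => //; apply: arc_ord0 (arc1P hx) _.
by rewrite evM evXn ev_lsub !ev_fX mulf_neq0 ?expf_neq0.
Qed.

End SResidual.
End Residual.
End Theta.

(** * Residual points *)

Section ResidualPoints.
Variable K : numClosedFieldType.
Implicit Types (L : tuple7 K) (Q : {mpoly K[3]}).

Lemma ord7P (P : 'I_7 -> Prop) : P 0 -> P 1 -> P 2%:R -> P 3%:R -> P 4%:R -> P 5%:R -> P 6%:R ->
  forall i, P i.
Proof.
move=> P0 P1 P2 P3 P4 P5 P6 [[|[|[|[|[|[|[|i]]]]]]] hi] //.
- by rewrite (_ : Ordinal hi = 0) //; apply/val_inj.
- by rewrite (_ : Ordinal hi = 1) //; apply/val_inj.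
- by rewrite (_ : Ordinal hi = 2%:R) //; apply/val_inj.
- by rewrite (_ : Ordinal hi = 3%:R) //; apply/val_inj.
- by rewrite (_ : Ordinal hi = 4%:R) //; apply/val_inj.
- by rewrite (_ : Ordinal hi = 5%:R) //; apply/val_inj.
- by rewrite (_ : Ordinal hi = 6%:R) //; apply/val_inj.
Qed.

Lemma nonconsecP i j : nonconsec i j =
  [|| j == i + 2%:R, i == j + 2%:R, j == i + 3%:R | i == j + 3%:R].
Proof. by elim/ord7P: i; elim/ord7P: j. Qed.

Lemma nonconsecC i j : nonconsec i j = nonconsec j i.
Proof. by elim/ord7P: i; elim/ord7P: j. Qed.

Lemma nonconsec_neq i j : nonconsec i j -> (val i != val j).
Proof. by case/and3P. Qed.

Lemma mem_residual L p : reflect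
  (exists i j : 'I_7, [/\ (val i < val j)%N, nonconsec i j & p = cross (L i) (L j)])
  (p \in residual_pts L).
Proof.
apply: (iffP mapP) => [[[i j]]|[i [j [ij nc ->]]]].
  by rewrite mem_filter => /andP[/andP[ij nc] _] ->; exists i, j.
exists (i, j) => //; rewrite mem_filter ij nc /=.
by apply/allpairsP; exists (i, j); rewrite !mem_enum.
Qed.

Lemma residual_ev L Q : Q \is 4.-homog ->
  (forall p, p \in residual_pts L -> ev Q p = 0) <->
  (forall i, ev Q (cross (L i) (L (i + 2%:R))) = 0 /\ ev Q (cross (L i) (L (i + 3%:R))) = 0).
Proof.
move=> hQ.
have sw u v : ev Q (cross u v) = 0 -> ev Q (cross v u) = 0.
  by rewrite [cross v u]crossC -scaleN1r (ev_homogZ _ _ hQ) => ->; rewrite mulr0.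
split=> h.
  have h2 i j : nonconsec i j -> ev Q (cross (L i) (L j)) = 0.
    move=> nc; case: (ltngtP (val i) (val j)) => [ij|ij|/eqP].
    - by apply/h/mem_residual; exists i, j.
    - by apply/sw/h/mem_residual; exists j, i; rewrite nonconsecC.
    by rewrite (negbTE (nonconsec_neq nc)).
  by move=> i; split; apply: h2; rewrite nonconsecP eqxx ?orbT.
move=> p /mem_residual[i [j [_ nc ->]]]; move: nc; rewrite nonconsecP.
by case/or4P => /eqP ->; [apply h | apply/sw; apply h | apply h | apply/sw; apply h].
Qed.

Lemma count_residual L (a : pred (vec K)) : (forall u v, a (cross u v) = a (cross v u)) ->
  count a (residual_pts L) =
  (\sum_(i < 7) a (cross (L i) (L (i + 2%:R)%R)) + \sum_(i < 7) a (cross (L i) (L (i + 3%:R)%R)))%N.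
Proof.
move=> sym; rewrite /residual_pts /residual_pairs count_map count_filter.
rewrite -sum1_count big_mkcond /= big_allpairs_dep /= big_enum /=.
under eq_bigr do rewrite big_enum /=.
(* With plain numbers as labels, all the conditions on pairs compute, and both sides unfold into the
   same 14 terms. *)
pose f (i j : nat) : nat := a (cross (L (inord i)) (L (inord j))).
have fE (i j : 'I_7) : f i j = a (cross (L i) (L j)) by rewrite /f !inord_val.
have fC i j : f i j = f j i by rewrite /f sym.
pose c (m n : nat) : bool := [&& (m < n)%N, m != n, n != (m + 1) %% 7 & m != (n + 1) %% 7]%N.
transitivity (\sum_(i < 7) \sum_(j < 7) (if c i j then f i j else 0))%N.
  apply: eq_bigr => i _; apply: eq_bigr => j _; rewrite fE /c.
  rewrite -[[&& _ != _, _ & _]]/(nonconsec i j) /=.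
  by case: (a _); case: (_ < _)%N; case: (nonconsec i j).
transitivity (\sum_(i < 7) f i ((i + 2) %% 7) + \sum_(i < 7) f i ((i + 3) %% 7))%N; last first.
  by congr addn; apply: eq_bigr => i _; rewrite -fE.
have sum7 (g : nat -> nat) : (\sum_(i < 7) g i = g 0 + (g 1 + (g 2 + (g 3 + (g 4 + (g 5 + g 6))))))%N.
  by rewrite !big_ord_recl big_ord0 addn0.
rewrite (sum7 (fun i => \sum_(j < 7) (if c i j then f i j else 0))%N) !(sum7 (fun j => if c _ j then f _ j else 0)%N).
rewrite (sum7 (fun i => f i ((i + 2) %% 7)%N)) (sum7 (fun i => f i ((i + 3) %% 7)%N)) /c.
clearbody f; move: {fE} f fC => f fC; rewrite /=.
rewrite 
  -[((0 + 2) %% 7)%N]/(2%N)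
  -[((1 + 2) %% 7)%N]/(3%N)
  -[((2 + 2) %% 7)%N]/(4%N)
  -[((3 + 2) %% 7)%N]/(5%N)
  -[((4 + 2) %% 7)%N]/(6%N)
  -[((5 + 2) %% 7)%N]/(0%N)
  -[((6 + 2) %% 7)%N]/(1%N).
by rewrite [f 5%N 0%N]fC [f 6%N 1%N]fC [f 4%N 0%N]fC [f 5%N 1%N]fC [f 6%N 2%N]fC; lia.
Qed.
End ResidualPoints.

(** * Quartics decomposed by their weights under phi *)

Section Heptagon.
Variable K : numClosedFieldType.
Variable z : K.
Hypothesis hz : 7.-primitive_root z.
Implicit Types (Q : {mpoly K[3]}) (v : vec K).
Local Notation F := (kleinF K).

(** A polynomial of degree at most 6 with the seven roots z^k is zero. This separates the weights of
    a form vanishing along a phi-orbit. *)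
Lemma fourier7 (q : 'I_7 -> K) : (forall k : nat, \sum_w q w * (z ^+ k) ^+ w = 0) ->
  forall w, q w = 0.
Proof.
move=> h; pose p : {poly K} := \poly_(i < 7) q (inord i).
have hp x : p.[x] = \sum_w q w * x ^+ w.
  by rewrite horner_poly; apply: eq_bigr => i _; rewrite inord_val.
have p0 : p = 0.
  apply/eqP; apply/negPn/negP => pn0.
  have hs : all (root p) [seq z ^+ k | k <- iota 0 7].
    by apply/allP => x /mapP[k _ ->]; rewrite rootE hp h.
  have hu : uniq [seq z ^+ k | k <- iota 0 7].
    rewrite map_inj_in_uniq ?iota_uniq // => i j; rewrite !mem_iota /= !add0n => hi hj /eqP.
    by rewrite (eq_prim_root_expr hz) !modn_small // => /eqP.
  have := leq_trans (max_poly_roots pn0 hs hu) (size_poly 7 _).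
  by rewrite size_map size_iota ltnn.
by move=> w; have := coef0 K w; rewrite -p0 coef_poly ltn_ord inord_val.
Qed.

Lemma quartic_weights Q v : Q \is 4.-homog ->
  (forall k : nat, ev Q (phiM z ^+ k *m v) = 0) ->
  let f i j k := Q@_(mn i j k) in
  let x := v 0 0 in let y := v 1 0 in let w := v 2%:R 0 in
  [/\ f 3%N 1%N 0%N * (x ^+ 3 * y) + f 0%N 3%N 1%N * (y ^+ 3 * w) + f 1%N 0%N 3%N * (w ^+ 3 * x) = 0,
      [/\ f 4%N 0%N 0%N * x ^+ 4 + f 1%N 2%N 1%N * (x * y ^+ 2 * w) = 0,
      f 0%N 4%N 0%N * y ^+ 4 + f 1%N 1%N 2%N * (x * y * w ^+ 2) = 0 &
      f 0%N 0%N 4%N * w ^+ 4 + f 2%N 1%N 1%N * (x ^+ 2 * y * w) = 0] &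
      [/\ f 2%N 2%N 0%N * (x ^+ 2 * y ^+ 2) + f 0%N 1%N 3%N * (y * w ^+ 3) = 0,
      f 0%N 2%N 2%N * (y ^+ 2 * w ^+ 2) + f 3%N 0%N 1%N * (x ^+ 3 * w) = 0 &
      f 2%N 0%N 2%N * (x ^+ 2 * w ^+ 2) + f 1%N 3%N 0%N * (x * y ^+ 3) = 0]].
Proof.
move=> hQ h f x y w.
(* The entries are listed by weight: the monomial x^i y^j z^k is multiplied under phi by the power 4
   i + 2 j + k modulo 7 of zeta. *)
pose c : seq K := [:: f 3%N 1%N 0%N * (x ^+ 3 * y) + f 0%N 3%N 1%N * (y ^+ 3 * w) + f 1%N 0%N 3%N * (w ^+ 3 * x);
   f 0%N 4%N 0%N * y ^+ 4 + f 1%N 1%N 2%N * (x * y * w ^+ 2);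
   f 4%N 0%N 0%N * x ^+ 4 + f 1%N 2%N 1%N * (x * y ^+ 2 * w);
   f 2%N 0%N 2%N * (x ^+ 2 * w ^+ 2) + f 1%N 3%N 0%N * (x * y ^+ 3);
   f 0%N 0%N 4%N * w ^+ 4 + f 2%N 1%N 1%N * (x ^+ 2 * y * w);
   f 2%N 2%N 0%N * (x ^+ 2 * y ^+ 2) + f 0%N 1%N 3%N * (y * w ^+ 3);
   f 0%N 2%N 2%N * (y ^+ 2 * w ^+ 2) + f 3%N 0%N 1%N * (x ^+ 3 * w)].
have c0 : forall i : 'I_7, c`_i = 0.
  apply: fourier7 => k; rewrite -[RHS](h k) (quarticE hQ) ev_sum.
  rewrite /quartic_exps !big_cons big_nil !evZ !ev_mono phik_col !col3E /=.
  rewrite !big_ord_recl big_ord0 /c /= /bump /=.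
  have u7 : (z ^+ k) ^+ 7 = 1 by rewrite -exprM mulnC exprM (z7 hz) expr1n.
  have fE (i j l : nat) : Q@_(mn i j l) = f i j l by [].
  rewrite !fE -/x -/y -/w; clear c; clearbody f x y w; move: {fE h} (z ^+ k) u7 => u u7.
  rewrite !mulrA; ring: u7.
have := (c0 0, c0 1, c0 2%:R, c0 3%:R, (c0 4%:R, c0 5%:R, c0 6%:R)).
by rewrite /c /= => -[[[[-> ->] ->] ->] [[-> ->] ->]].
Qed.
End Heptagon.

(** * The heptagon *)

Section KleinHeptagon.
Variable K : numClosedFieldType.
Variable z : K.
Hypothesis hz : 7.-primitive_root z.
Variable R : vec K.
Hypothesis R_neq0 : R != 0.
Hypothesis F_R : ev (kleinF K) R = 0.
Hypothesis R_ne : forall i, ~~ proj_eq R (e_pt K i).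
Hypothesis F_psiR : ev (kleinF K) (psiM z *m R) = 0.
Implicit Types (Q : {mpoly K[3]}) (v : vec K) (i j : 'I_7).
Local Notation F := (kleinF K).
Local Notation P := (kleinP z R).
Local Notation R' := (psiM z *m R).

Lemma mulX_R : mulX R != 0.
Proof. by apply/eqP => /(klein_mulX0 F_R R_neq0)[i]; rewrite (negbTE (R_ne i)). Qed.

Lemma mulX_R' : mulX R' != 0.
Proof.
have [x y w] := mulX_neq0 mulX_R.
have [[p0 p1] p2] := (psi0_neq0 hz, psi1_neq0 hz, psi2_neq0 hz).
rewrite psiM_col /mulX !col3E; nz.
Qed.

(* Values of cA / cB at R and psi(R). *)
Definition tR : K := - 1 - z ^+ 3 - z ^+ 4.
Definition tR' : K := 7 + 6 * z ^+ 2 + 3 * z ^+ 3 + 3 * z ^+ 4 + 6 * z ^+ 5.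

Lemma cA_R : cA R = tR * cB R.
Proof.
have h0 : cA R + cB R + cC R = 0 by rewrite -kleinE.
have h1 : psi0 z ^+ 3 * psi1 z * cA R + psi1 z ^+ 3 * psi2 z * cB R + psi2 z ^+ 3 * psi0 z * cC R = 0.
  by rewrite -F_psiR psiM_col ev_kleinF !col3E /cA /cB /cC; ring.
have n0 : psi2 z ^+ 3 * psi0 z - psi0 z ^+ 3 * psi1 z != 0.
  apply: (@neq0_cert _ 685 _ (1 - 3 * z ^+ 2 - z ^+ 3 - z ^+ 4 - 3 * z ^+ 5)).
  by rewrite /psi0 /psi1 /psi2; ring: (z6 hz).
apply: (mulfI n0); rewrite [RHS]mulrA.
have -> : (psi2 z ^+ 3 * psi0 z - psi0 z ^+ 3 * psi1 z) * tR = psi1 z ^+ 3 * psi2 z - psi2 z ^+ 3 * psi0 z.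
  by rewrite /psi0 /psi1 /psi2 /tR; ring: (z6 hz).
apply/eqP; rewrite -subr_eq0; apply/eqP.
transitivity (psi2 z ^+ 3 * psi0 z * (cA R + cB R + cC R) -
 (psi0 z ^+ 3 * psi1 z * cA R + psi1 z ^+ 3 * psi2 z * cB R + psi2 z ^+ 3 * psi0 z * cC R)); first by ring.
by rewrite h0 h1 mulr0 subrr.
Qed.

Lemma cB_R_neq0 : cB R != 0.
Proof. by have [x y w] := mulX_neq0 mulX_R; rewrite /cB; nz. Qed.

Lemma cB_R'_neq0 : cB R' != 0.
Proof. by have [x y w] := mulX_neq0 mulX_R'; rewrite /cB; nz. Qed.

Lemma cA_R' : cA R' = tR' * cB R'.
Proof.
have -> : cA R' = psi0 z ^+ 3 * psi1 z * cA R by rewrite /cA psiM_col !col3E; ring.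
have -> : cB R' = psi1 z ^+ 3 * psi2 z * cB R by rewrite /cB psiM_col !col3E; ring.
rewrite cA_R !mulrA; congr (_ * _).
by rewrite /psi0 /psi1 /psi2 /tR /tR'; ring: (z6 hz).
Qed.

Lemma tR_neq0 : tR != 0.
Proof.
apply: (@neq0_cert _ 0 _ (- 1 - z ^+ 2 - z ^+ 3 - z ^+ 4 - z ^+ 5)).
by rewrite /tR; ring: (z6 hz).
Qed.
Lemma tR'_neq0 : tR' != 0.
Proof.
apply: (@neq0_cert _ 0 _ (- 5 + 3 * z ^+ 2 - 3 * z ^+ 3 - 3 * z ^+ 4 + 3 * z ^+ 5)).
by rewrite /tR'; ring: (z6 hz).
Qed.
Lemma tR1_neq0 : tR + 1 != 0.
Proof.
apply: (@neq0_cert _ 0 _ (1 + z ^+ 2 + z ^+ 5)).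
by rewrite /tR; ring: (z6 hz).
Qed.
Lemma tR'1_neq0 : tR' + 1 != 0.
Proof.
apply: (@neq0_cert _ 0 _ (- 1 + 3 * z ^+ 2 + 6 * z ^+ 3 + 6 * z ^+ 4 + 3 * z ^+ 5)).
by rewrite /tR'; ring: (z6 hz).
Qed.
Lemma tR_tR' : tR != tR'.
Proof.
rewrite -subr_eq0; apply: (@neq0_cert _ 13 _ (- 2 - z ^+ 2 - 5 * z ^+ 3 - 5 * z ^+ 4 - z ^+ 5)).
by rewrite /tR /tR'; ring: (z6 hz).
Qed.

(** With [tR'_flex], this keeps both fibres away from the flexes S e_j, where orders are computed
    separately. *)
Lemma tR_flex (l : 'I_3) : tR != flex_t z l.
Proof.
rewrite eq_sym -subr_eq0; elim/ord3P: l; rewrite /flex_t /tR /=.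
- apply: (@neq0_cert _ 6 _ (9 + 8 * z ^+ 2 + 5 * z ^+ 3 + 5 * z ^+ 4 + 8 * z ^+ 5)); ring: (z6 hz).
- apply: (@neq0_cert _ 6 _ (- 5 - 6 * z ^+ 2 - 2 * z ^+ 3 - 2 * z ^+ 4 - 6 * z ^+ 5)); ring: (z6 hz).
- apply: (@neq0_cert _ 6 _ (2 + z ^+ 2 + 5 * z ^+ 3 + 5 * z ^+ 4 + z ^+ 5)); ring: (z6 hz).
Qed.
Lemma tR'_flex (l : 'I_3) : tR' != flex_t z l.
Proof.
rewrite eq_sym -subr_eq0; elim/ord3P: l; rewrite /flex_t /tR' /=.
- apply: (@neq0_cert _ 6 _ (- 9 + 20 * z ^+ 2 + 37 * z ^+ 3 + 37 * z ^+ 4 + 20 * z ^+ 5)); ring: (z6 hz).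
- apply: (@neq0_cert _ 6 _ (- 37 + 20 * z ^+ 2 - 26 * z ^+ 3 - 26 * z ^+ 4 + 20 * z ^+ 5)); ring: (z6 hz).
- apply: (@neq0_cert _ 6 _ (- 2 - z ^+ 2 - 5 * z ^+ 3 - 5 * z ^+ 4 - z ^+ 5)); ring: (z6 hz).
Qed.

(** Line coordinates of a side in terms of u = z^i. The exponents 3, 5, 6 are -4, -2, -1 modulo 7,
    because phi acts on lines by the inverse weights. *)
Definition side (u : K) : vec K :=
  col3 (u ^+ 3 * (R 1 0 * R 2%:R 0 * (z ^+ 3 - z ^+ 5)))
       (u ^+ 5 * (R 2%:R 0 * R 0 0 * (z ^+ 5 - z ^+ 6)))
       (u ^+ 6 * (R 0 0 * R 1 0 * (z ^+ 6 - z ^+ 3))).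

Lemma zi7 i : (z ^+ i) ^+ 7 = 1.
Proof. by rewrite -exprM mulnC exprM (z7 hz) expr1n. Qed.

Lemma zD i j : z ^+ (i + j)%R = z ^+ i * z ^+ j.
Proof. by rewrite /= (prim_expr_mod hz) exprD. Qed.

Lemma kleinPE i : P i = side (z ^+ i).
Proof.
rewrite /kleinP crossE !phik_col !col3E (prim_expr_mod hz) exprD /side.
have u7 := zi7 i; move: (z ^+ i) u7 => u u7.
by congr col3; ring: u7 (z6 hz).
Qed.

Definition kap2 : K := (z ^+ 5 - z ^+ 6) * (z ^+ 6 - z ^+ 3) * (z ^+ 5 - z ^+ 3).

Lemma kap2_neq0 : kap2 != 0.
Proof.
apply: (@neq0_cert _ 6 _ (- 1 - 2 * z - 2 * z ^+ 2 - 2 * z ^+ 4)).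
by rewrite /kap2; ring: (z6 hz).
Qed.

(** Both sides pass through phi^i R: it is the second point of [P i] and, as i + 2 + 5 = i modulo 7,
    the first point of [P (i + 2)]. The constant [kap2] is a square root of -7. *)
Lemma cross2 i : cross (P i) (P (i + 2%:R)) = (mulX R * kap2) *: (phiM z ^+ i *m R).
Proof.
rewrite !kleinPE zD phik_col crossE /side !col3E col3Z /mulX /kap2 /=.
have u7 := zi7 i; move: (z ^+ i) u7 => u u7.
by congr col3; ring: u7 (z6 hz).
Qed.

(** With p = phi^(i+1) R, the two sides are the lines joining phi^4 p to phi^6 p and p to phi^2 p,
    whose intersection is psi(p). This explains the exponent i + 1. *)
Lemma cross3 i : cross (P i) (P (i + 3%:R)) = mulX R *: (phiM z ^+ (i.+1) *m R').
Proof.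
have z3 : z ^+ (3%:R : 'I_7) = z ^+ 3 by [].
rewrite !kleinPE zD z3 phik_col psiM_col crossE /side !col3E col3Z /mulX /psi0 /psi1 /psi2 (exprSr z i).
have u7 := zi7 i; move: (z ^+ i) u7 => u u7.
by congr col3; ring: u7 (z6 hz).
Qed.

Lemma P_neq0 i : P i != 0.
Proof.
apply/negP => /eqP h; have := cross2 i; rewrite h.
have -> : cross 0 (P (i + 2%:R)) = 0 by apply: vecP; rewrite crossE !mxE /= ?(mul0r, subrr).
move=> /esym/eqP; rewrite scaler_eq0 unit_mulmx_eq0 ?(phik_unit hz) // (negbTE R_neq0).
by rewrite orbF (negbTE (mulf_neq0 mulX_R kap2_neq0)).
Qed.

Lemma act_phi_P i : act_line (phiM z) (P i) = P (i + 1).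
Proof.
have -> : P i = (phiM z)^T *m P (i + 1).
  rewrite tr_diag_mx -/(phiM z) phiM_col !kleinPE zD expr1 /side !col3E.
  by move: (z ^+ i) => u; congr col3; ring: (z7 hz).
by rewrite /act_line mulmxA -trmx_mul mulmxV ?(phi_unit hz) // trmx1 mul1mx.
Qed.

Lemma quartic_RR' Q (k : nat) : Q \is 4.-homog -> (forall p, p \in residual_pts P -> ev Q p = 0) ->
  ev Q (phiM z ^+ k *m R) = 0 /\ ev Q (phiM z ^+ k *m R') = 0.
Proof.
move=> hQ /(residual_ev _ hQ) h.
have m := mulX_R; have k2 := kap2_neq0.
have zk v (a b : nat) : a = b %[mod 7] -> phiM z ^+ a *m v = phiM z ^+ b *m v.
  by move=> e; rewrite !phik_col -(prim_expr_mod hz a) e (prim_expr_mod hz).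
have s0 (c : K) v : c != 0 -> ev Q (c *: v) = 0 -> ev Q v = 0.
  move=> c0 /eqP; rewrite (ev_homogZ _ _ hQ) mulf_eq0 expf_eq0 /= (negbTE c0) => /eqP //.
split.
  have -> : phiM z ^+ k *m R = phiM z ^+ (inord (k %% 7) : 'I_7) *m R.
    by apply: zk; rewrite inordK ?ltn_mod ?modn_mod.
  by have [+ _] := h (inord (k %% 7)); rewrite cross2 => /s0; apply; nz.
(* Adding 6 subtracts 1 modulo 7 and so undoes the shift of exponent in [cross3]. *)
have -> : phiM z ^+ k *m R' = phiM z ^+ (inord ((k + 6) %% 7) : 'I_7).+1 *m R'.
  by apply: zk; rewrite inordK ?ltn_mod // -(addn1 ((k + 6) %% 7)) (modnDml (k + 6) 1 7) -addnA modnDr.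
by have [_ +] := h (inord ((k + 6) %% 7)); rewrite cross3 => /s0; apply.
Qed.

(** Here a and b are the coefficients of a form in a two-dimensional eigenspace, m and n the values
    of its monomials at R, and r, s the factors by which psi multiplies these values. *)
Lemma det2_0 (a b m n r s : K) : m != 0 -> n != 0 -> r != s ->
  a * m + b * n = 0 -> a * (r * m) + b * (s * n) = 0 -> a = 0 /\ b = 0.
Proof.
move=> m0 n0 rs e1 e2; have rs0 : r - s != 0 by rewrite subr_eq0.
have a0 : a = 0.
  apply: (mulIf m0); apply: (mulIf rs0); rewrite !mul0r.
  transitivity ((a * (r * m) + b * (s * n)) - s * (a * m + b * n)); first by ring.
  by rewrite e1 e2 mulr0 subrr.
split=> //; apply: (mulIf n0); move: e1; rewrite a0 !mul0r add0r //.
Qed.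

Lemma adjoint_P : adjoint_is P F.
Proof.
move=> Q hQ; split; last first.
  move=> [c ->]; apply/residual_ev; first by rewrite rpredZ // kleinF_homog.
  by move=> i; rewrite cross2 cross3 !evZ !(ev_homogZ _ _ (kleinF_homog K)) !klein_phi // F_R F_psiR !mulr0.
move=> h; exists Q@_(mn 3 1 0).
have [w1 [w2 w3 w4] [w5 w6 w7]] := quartic_weights hz hQ (fun k => (quartic_RR' k hQ h).1).
have := quartic_weights hz hQ (fun k => (quartic_RR' k hQ h).2).
rewrite psiM_col !col3E => -[w1' [w2' w3' w4'] [w5' w6' w7']].
have [x0 y0 u0] := mulX_neq0 mulX_R.
have [[p0 p1] p2] := (psi0_neq0 hz, psi1_neq0 hz, psi2_neq0 hz).
have [[r0 r1] r2] := (psi_ratio0 hz, psi_ratio1 hz, psi_ratio2 hz).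
have rf := psi_ratioF hz.
move: F_R; rewrite ev_kleinF => hF; move: F_psiR; rewrite psiM_col ev_kleinF !col3E => hF'.
rewrite {1}(quarticE hQ) /quartic_exps !big_cons big_nil /=.
move: (psi0 z) (psi1 z) (psi2 z) (R 0 0) (R 1 0) (R 2%:R 0) w1 w2 w3 w4 w5 w6 w7
   w1' w2' w3' w4' w5' w6' w7' x0 y0 u0 p0 p1 p2 r0 r1 r2 rf hF hF'.
move=> p q r x y w w1 w2 w3 w4 w5 w6 w7 w1' w2' w3' w4' w5' w6' w7' x0 y0 u0 p0 p1 p2 r0 r1 r2 rf hF hF'.
have k1 : p ^+ 4 != p * q ^+ 2 * r by rewrite exprS -mulrA (inj_eq (mulfI p0)).
have k2 : q ^+ 4 != p * q * r ^+ 2.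
  by rewrite exprS (_ : p * q * r ^+ 2 = q * (r ^+ 2 * p)); [rewrite (inj_eq (mulfI p1)) | ring].
have k3 : r ^+ 4 != p ^+ 2 * q * r.
  by rewrite exprS mulrC (inj_eq (mulIf p2)).
have k4 : p ^+ 2 * q ^+ 2 != q * r ^+ 3.
  by rewrite (_ : p ^+ 2 * q ^+ 2 = q * (p ^+ 2 * q)); [rewrite (inj_eq (mulfI p1)) eq_sym | ring].
have k5 : q ^+ 2 * r ^+ 2 != p ^+ 3 * r.
  by rewrite (_ : q ^+ 2 * r ^+ 2 = q ^+ 2 * r * r); [rewrite (inj_eq (mulIf p2)) eq_sym | ring].
have k6 : p ^+ 2 * r ^+ 2 != p * q ^+ 3.
  by rewrite (_ : p ^+ 2 * r ^+ 2 = p * (r ^+ 2 * p)); [rewrite (inj_eq (mulfI p0)) eq_sym | ring].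
have [|||a1 a2] := det2_0 _ _ k1 w2; [nz|nz|by rewrite -[RHS]w2'; ring|].
have [|||a3 a4] := det2_0 _ _ k2 w3; [nz|nz|by rewrite -[RHS]w3'; ring|].
have [|||a5 a6] := det2_0 _ _ k3 w4; [nz|nz|by rewrite -[RHS]w4'; ring|].
have [|||a7 a8] := det2_0 _ _ k4 w5; [nz|nz|by rewrite -[RHS]w5'; ring|].
have [|||a9 a10] := det2_0 _ _ k5 w6; [nz|nz|by rewrite -[RHS]w6'; ring|].
have [|||a11 a12] := det2_0 _ _ k6 w7; [nz|nz|by rewrite -[RHS]w7'; ring|].
rewrite a1 a2 a3 a4 a5 a6 a7 a8 a9 a10 a11 a12 !scale0r !add0r !addr0.
set f1 := Q@_(mn 3 1 0) in w1 w1' *; set f2 := Q@_(mn 0 3 1) in w1 w1' *.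
set f3 := Q@_(mn 1 0 3) in w1 w1' *.
(* The eigenspace of F has dimension 3; subtracting f3 F leaves two coefficients, to which the same
   argument applies. *)
have [||||b1 b2] := @det2_0 (f1 - f3) (f2 - f3) (x ^+ 3 * y) (y ^+ 3 * w) (p ^+ 3 * q) (q ^+ 3 * r) _ _ rf.
- nz.
- nz.
- transitivity (f1 * (x ^+ 3 * y) + f2 * (y ^+ 3 * w) + f3 * (w ^+ 3 * x)
     - f3 * (x ^+ 3 * y + y ^+ 3 * w + w ^+ 3 * x)); first by ring.
  by rewrite w1 hF mulr0 subrr.
- transitivity (f1 * ((p * x) ^+ 3 * (q * y)) + f2 * ((q * y) ^+ 3 * (r * w)) + f3 * ((r * w) ^+ 3 * (p * x))
     - f3 * ((p * x) ^+ 3 * (q * y) + (q * y) ^+ 3 * (r * w) + (r * w) ^+ 3 * (p * x))); first by ring.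
  by rewrite w1' hF' mulr0 subrr.
have -> : f2 = f1 by rewrite -[f2](subrK f3) b2 -[f1](subrK f3) b1.
have -> : f3 = f1 by rewrite -[f1](subrK f3) b1 add0r.
by rewrite -!scalerDr kleinF_mono addrA.
Qed.
End KleinHeptagon.

(** * No three sides are concurrent; the residual divisor *)

Section KleinHeptagonTheta.
Variable K : numClosedFieldType.
Variable z : K.
Hypothesis hz : 7.-primitive_root z.
Variable R : vec K.
Hypothesis R_neq0 : R != 0.
Hypothesis F_R : ev (kleinF K) R = 0.
Hypothesis R_ne : forall i, ~~ proj_eq R (e_pt K i).
Hypothesis F_psiR : ev (kleinF K) (psiM z *m R) = 0.
Implicit Types (v x : vec K) (i j : 'I_7).
Local Notation F := (kleinF K).
Local Notation P := (kleinP z R).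
Local Notation R' := (psiM z *m R).

(** Dividing by a gives 1 + v + w = 0. Conjugation inverts roots of unity, so also 1 + 1/v + 1/w =
    0, and hence v^2 + v + 1 = 0. Then v^3 = 1 = v^7 forces v = 1, so 3 = 0. *)
Lemma unity7_sum3 (a b c : K) : a ^+ 7 = 1 -> b ^+ 7 = 1 -> c ^+ 7 = 1 -> a + b + c != 0.
Proof.
move=> ha hb hc; have a0 : a != 0.
  by apply: contraNneq (oner_neq0 K) => a0; rewrite -ha a0 expr0n.
pose v := b / a; pose w := c / a.
have v7 : v ^+ 7 = 1 by rewrite expr_div_n ha hb divr1.
have w7 : w ^+ 7 = 1 by rewrite expr_div_n ha hc divr1.
have cj (t : K) : t ^+ 7 = 1 -> t * t^* = 1.
  move=> t7; rewrite -normCK; have : `|t| ^+ 7 = 1 by rewrite -normrX t7 normr1.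
  by move=> /eqP; rewrite pexpr_eq1 // => /eqP ->; rewrite expr1n.
apply/negP => /eqP h.
have h1 : 1 + v + w = 0.
  by apply: (mulIf a0); rewrite mul0r -h /v /w; field.
have h2 : 1 + v^* + w^* = 0 by rewrite -[LHS]/(1 + v^* + w^*) -(rmorph1 (@Num.conj K)) -!rmorphD h1 rmorph0.
have h3 : v * w + w + v = 0.
  transitivity (v * w * (1 + v^* + w^*) + (1 - v * v^*) * w + (1 - w * w^*) * v); first by ring.
  by rewrite h2 !cj // !subrr !mul0r mulr0 !addr0.
have h4 : v ^+ 2 + v + 1 = 0.
  transitivity ((1 + v) * (1 + v + w) - (v * w + w + v)); first by ring.
  by rewrite h1 h3 mulr0 subrr.
have v3 : v ^+ 3 = 1.
  apply/eqP; rewrite -subr_eq0; apply/eqP; transitivity ((v - 1) * (v ^+ 2 + v + 1)); first by ring.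
  by rewrite h4 mulr0.
have v1 : v = 1 by rewrite -[LHS]mul1r -[1 in LHS](expr1n K 2) -v3 -exprM -exprSr v7.
have : 3%:R != 0 :> K by rewrite pnatr_eq0.
by rewrite (_ : 3%:R = 0) ?eqxx // -h4 v1; ring.
Qed.

Lemma zi_inj i j : z ^+ i = z ^+ j -> i = j.
Proof.
by move/eqP; rewrite (eq_prim_root_expr hz) !modn_small // => /eqP/val_inj.
Qed.

Lemma zi_neq0 i : z ^+ i != 0. Proof. by rewrite expf_neq0 // (z_neq0 hz). Qed.

Lemma side_consts : [/\ z ^+ 3 - z ^+ 5 != 0, z ^+ 5 - z ^+ 6 != 0 & z ^+ 6 - z ^+ 3 != 0].
Proof.
by split; rewrite subr_eq0 (eq_prim_root_expr hz).
Qed.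

Lemma cross_P i j : i != j -> cross (P i) (P j) != 0.
Proof.
move=> ij; have [x y w] := mulX_neq0 (mulX_R R_neq0 F_R R_ne); have [c0 c1 c2] := side_consts.
apply/negP => /eqP/(congr1 (fun v : vec K => v 0 0)); rewrite !kleinPE // crossE col3E !mxE /=.
move=> h; have n0 : (R 0 0 ^+ 2 * R 1 0 * R 2%:R 0 * (z ^+ 5 - z ^+ 6) * (z ^+ 6 - z ^+ 3)
   * (z ^+ i) ^+ 5 * (z ^+ j) ^+ 5) * (z ^+ j - z ^+ i) = 0 by rewrite -h; ring.
move/eqP: n0; rewrite mulf_eq0 subr_eq0 => /orP[|/eqP/zi_inj e]; last by rewrite e eqxx in ij.
apply/negP; have [zi zj] := (zi_neq0 i, zi_neq0 j); nz.
Qed.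

Lemma heptagon_P : heptagon P.
Proof.
have [x y w] := mulX_neq0 (mulX_R R_neq0 F_R R_ne); have [c0 c1 c2] := side_consts.
split; first by move=> i; apply: P_neq0.
split=> [i j ij|i j k ij jk ik [v [v0 [hi [hj hk]]]]].
  apply/negP => /proj_eqP[_ [c _ e]]; move: (cross_P ij); rewrite e -[X in cross _ X]scale1r crossZ.
  suff -> : cross (P j) (P j) = 0 by rewrite scaler0 eqxx.
  by apply: vecP; rewrite crossE !mxE /=; ring.
pose X := R 1 0 * R 2%:R 0 * (z ^+ 3 - z ^+ 5) * v 0 0.
pose Y := R 2%:R 0 * R 0 0 * (z ^+ 5 - z ^+ 6) * v 1 0.
pose W := R 0 0 * R 1 0 * (z ^+ 6 - z ^+ 3) * v 2%:R 0.
(* With a = u^6 = 1 / u, the equation of the side multiplied by u reads a^3 X + a Y + W = 0. *)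
have eqn l : on_line (P l) v -> ((z ^+ l) ^+ 6) ^+ 3 * X + (z ^+ l) ^+ 6 * Y + W = 0.
  rewrite on_lineE kleinPE // !col3E => h; have u7 := zi7 hz l.
  transitivity (z ^+ l * (z ^+ l ^+ 3 * (R 1 0 * R 2 0 * (z ^+ 3 - z ^+ 5)) * v 0 0 +
    z ^+ l ^+ 5 * (R 2 0 * R 0 0 * (z ^+ 5 - z ^+ 6)) * v 1 0 +
    z ^+ l ^+ 6 * (R 0 0 * R 1 0 * (z ^+ 6 - z ^+ 3)) * v 2 0)); last by rewrite h mulr0.
  rewrite /X /Y /W; move: (z ^+ l) u7 => u u7; ring: u7.
have s7 (l : 'I_7) : ((z ^+ l) ^+ 6) ^+ 7 = 1 by rewrite (exprAC (z ^+ l)) (zi7 hz) expr1n.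
have sn (l m : 'I_7) : l != m -> (z ^+ l) ^+ 6 - (z ^+ m) ^+ 6 != 0.
  rewrite subr_eq0; apply: contra_neq => e; apply: zi_inj.
  have zV (n : 'I_7) : (z ^+ n) ^+ 6 = (z ^+ n)^-1.
    by apply: (mulfI (zi_neq0 n)); rewrite mulfV ?zi_neq0 // -exprS (zi7 hz).
  by apply: invr_inj; rewrite -!zV.
have := unity7_sum3 (s7 i) (s7 j) (s7 k); have := (sn _ _ ij, sn _ _ jk, sn _ _ ik).
have := (eqn _ hi, eqn _ hj, eqn _ hk).
move: (z ^+ i ^+ 6) (z ^+ j ^+ 6) (z ^+ k ^+ 6) => a b c [[ea eb] ec] [[nab nbc] nac] s.
have X0 : X = 0.
  (* The determinant of the system with rows (a^3, a, 1) for the three sides. *)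
  have n0 : (a - b) * (b - c) * (a - c) * (a + b + c) != 0 by nz.
  apply: (mulfI n0); rewrite mulr0; transitivity ((b - c) * (a ^+ 3 * X + a * Y + W)
     + (c - a) * (b ^+ 3 * X + b * Y + W) + (a - b) * (c ^+ 3 * X + c * Y + W)); first by ring.
  by rewrite ea eb ec !mulr0 !addr0.
have Y0 : Y = 0.
  apply: (mulfI nab); rewrite mulr0; transitivity ((a ^+ 3 * X + a * Y + W) - (b ^+ 3 * X + b * Y + W)).
    by rewrite X0; ring.
  by rewrite ea eb subrr.
have W0 : W = 0 by move: ea; rewrite X0 Y0 !mulr0 !add0r.
have fin (r t : K) : r != 0 -> r * t = 0 -> t = 0.
  by move=> n0 /eqP; rewrite mulf_eq0 (negbTE n0) => /eqP.
by move/eqP: v0; apply; apply: vecP; rewrite [RHS]mxE; [apply: fin X0 | apply: fin Y0 | apply: fin W0]; nz.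
Qed.

Lemma phi_orbit_inj v (i j : 'I_7) : mulX v != 0 ->
  proj_eq (phiM z ^+ i *m v) (phiM z ^+ j *m v) -> i = j.
Proof.
move=> mv /proj_eqP[_ [c _]]; rewrite !phik_col col3Z => /col3_inj[_ e1 e2].
have [_ y w] := mulX_neq0 mv.
have {}e2 : z ^+ i = c * z ^+ j by apply: (mulIf w); rewrite e2 mulrA.
have {}e1 : (z ^+ i) ^+ 2 = c * (z ^+ j) ^+ 2 by apply: (mulIf y); rewrite e1 mulrA.
apply/esym/zi_inj; have z0 := zi_neq0 i.
by apply: (mulfI z0); rewrite -expr2 e1 e2; ring.
Qed.

Lemma cABZ c v : (cA (c *: v) = c ^+ 4 * cA v) * (cB (c *: v) = c ^+ 4 * cB v).
Proof. by rewrite /cA /cB !mxE; split; ring. Qed.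

(** Off the e_i, a fibre of cA / cB on the curve is a single orbit of phi, and phi acts freely
    there, so x is met at most once. *)
Lemma sum_proj_phi v x : ev F v = 0 -> ev F x = 0 -> mulX v != 0 -> mulX x != 0 ->
  (\sum_(i < 7) proj_eq x (phiM z ^+ i *m v))%N = (ev (ell (cA v) (cB v)) x == 0).
Proof.
move=> hv hx mv mx; rewrite ev_ell subr_eq0; case: eqP => [e|ne]; last first.
  rewrite big1 // => i _; case: proj_eqP => // -[_ [c _ ex]]; case: ne.
  by rewrite ex !cABZ cA_phi // cB_phi //; ring.
have e' : cA v * cB x = cA x * cB v by rewrite -e mulrC.
have [k hk] := phi_fiber hz hv hx mv mx e'.
pose i0 : 'I_7 := inord (k %% 7).
have {}hk : proj_eq x (phiM z ^+ i0 *m v).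
  rewrite (_ : phiM z ^+ i0 *m v = phiM z ^+ k *m v) // !phik_col.
  by rewrite inordK ?ltn_mod // (prim_expr_mod hz).
rewrite (bigD1 i0) //= hk big1 // => j ji; apply/eqP; rewrite eqb0; apply: contra ji.
by rewrite (proj_eq_congl _ hk) => /(phi_orbit_inj mv) ->.
Qed.

Local Notation D := (div_of_pts (residual_pts P)).

Lemma D_E x : D x = ((\sum_(i < 7) proj_eq x (phiM z ^+ i *m R)) +
   (\sum_(i < 7) proj_eq x (phiM z ^+ i *m R')))%N%:Z.
Proof.
rewrite /div_of_pts count_residual; last by move=> u v; rewrite [cross v u]crossC proj_eqN.
congr (Posz (_ + _)%N).
  apply: eq_bigr => i _; rewrite cross2 // proj_eqZr // mulf_neq0 ?kap2_neq0 //.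
  exact: mulX_R.
(* The exponent i + 1 of [cross3] is absorbed by a cyclic reindexing. *)
rewrite [RHS](reindex_inj (addIr 1)) /=; apply: eq_bigr => i _.
rewrite cross3 // proj_eqZr; last exact: mulX_R.
congr (proj_eq _ _ : nat); rewrite !phik_col -(prim_expr_mod hz i.+1).
by rewrite -addn1.
Qed.

Let mR := mulX_R R_neq0 F_R R_ne.
Let mR' := mulX_R' hz R_neq0 F_R R_ne.

Lemma D_off x : x != 0 -> ev F x != 0 -> D x = 0.
Proof.
move=> _ hx; rewrite D_E !big1 // => i _; apply/eqP; rewrite eqb0; apply: contraNN hx => /proj_eqP[_ [c _ ->]];
  by rewrite (ev_homogZ _ _ (kleinF_homog K)) klein_phi // ?F_R ?F_psiR mulr0.
Qed.

Lemma D_e x : x != 0 -> ev F x = 0 -> mulX x = 0 -> D x = 0.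
Proof.
move=> _ _ mx; rewrite D_E !big1 // => i _; apply/eqP; rewrite eqb0; apply/negP => /proj_eqP[_ [c c0 e]];
  move/eqP: mx; rewrite e mulXZ mulX_phi // mulf_eq0 expf_eq0 /= (negbTE c0) /= ?(negbTE mR) //.
by rewrite (negbTE mR').
Qed.

Lemma D_on x : x != 0 -> ev F x = 0 -> mulX x != 0 ->
  D x = ((ev (ell (cA R) (cB R)) x == 0%R) + (ev (ell (cA R') (cB R')) x == 0%R))%N%:Z.
Proof. by move=> _ hx mx; rewrite D_E !sum_proj_phi. Qed.

Let bR := cB_R_neq0 R_neq0 F_R R_ne.
Let bR' := cB_R'_neq0 hz R_neq0 F_R R_ne.
Let eR := cA_R hz F_R F_psiR.
Let eR' := cA_R' hz F_R F_psiR.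

Let aR : cA R != 0. Proof. by rewrite eR mulf_neq0 ?tR_neq0. Qed.
Let aR' : cA R' != 0. Proof. by rewrite eR' mulf_neq0 ?tR'_neq0. Qed.
Let abR : cA R + cB R != 0.
Proof. by rewrite eR -[X in _ + X]mul1r -mulrDl mulf_neq0 ?tR1_neq0. Qed.
Let abR' : cA R' + cB R' != 0.
Proof. by rewrite eR' -[X in _ + X]mul1r -mulrDl mulf_neq0 ?tR'1_neq0. Qed.
Let nR : cA R * cB R' != cA R' * cB R.
Proof.
rewrite eR eR' -mulrA -[X in _ != X]mulrA [cB R' * _]mulrC.
by apply: contraNneq (tR_tR' hz) => /(mulIf (mulf_neq0 bR bR')) ->.
Qed.

Lemma thetaP_e : lin_equiv F D (-3) (@eta_sym_div K) (-1).
Proof. exact: theta_e aR bR abR aR' bR' abR' nR D_off D_e D_on. Qed.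

Lemma thetaP_S : lin_equiv F D (-3) (fun x => eta_sym_div (SM z *m x)) (-1).
Proof.
apply: theta_S aR bR abR aR' bR' abR' nR D_off D_e D_on _ hz _ _ => l.
  by rewrite eR; apply: contraNneq (tR_flex hz l) => /(mulIf bR) ->.
by rewrite eR'; apply: contraNneq (tR'_flex hz l) => /(mulIf bR') ->.
Qed.

End KleinHeptagonTheta.

(** * Relabelling and projective transformations *)

Section Invariance.
Variable K : numClosedFieldType.
Implicit Types (L : tuple7 K) (M : 'M[K]_3) (x : vec K) (G Q F : {mpoly K[3]}) (D : divisor K).

Lemma lin_equiv_ext F D1 n1 D2 n2 D1' D2' : D1 =1 D1' -> D2 =1 D2' ->
  lin_equiv F D1 n1 D2 n2 -> lin_equiv F D1' n1 D2' n2.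
Proof.
move=> e1 e2 [h0 [G1 [G2 [d1 [d2 [hG1 [hG2 [d [m1 [m2 h]]]]]]]]]].
split=> [x x0 hx|]; first by rewrite -e1 -e2 h0.
exists G1, G2, d1, d2; do 5!split=> //; move=> x x0 hx.
by have [k1 [k2 [o1 [o2 e]]]] := h x x0 hx; exists k1, k2; rewrite -e1 -e2.
Qed.

Lemma lin_equiv_act F M c D1 n1 D2 n2 : c != 0 -> M \in unitmx -> lsub M F = c *: F ->
  lin_equiv F D1 n1 D2 n2 ->
  lin_equiv F (fun x => D1 (invmx M *m x)) n1 (fun x => D2 (invmx M *m x)) n2.
Proof.
move=> c0 hM hF [h0 [G1 [G2 [d1 [d2 [hG1 [hG2 [d [m1 [m2 h]]]]]]]]]].
have hM' : invmx M \in unitmx by rewrite unitmx_inv.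
have hF' := lsub_inv_eigen c0 hM hF.
have c0' : c^-1 != 0 by rewrite invr_eq0.
have ev0 x : ev F x != 0 -> ev F (invmx M *m x) != 0.
  by rewrite -ev_lsub hF' evZ => e; rewrite mulf_neq0.
have evz x : ev F x = 0 -> ev F (invmx M *m x) = 0 by rewrite -ev_lsub hF' evZ => ->; rewrite mulr0.
have nz0 x : x != 0 -> invmx M *m x != 0 by rewrite unit_mulmx_eq0.
have nm G : (~ exists A, G = A * F) -> ~ exists A, lsub (invmx M) G = A * F.
  move=> nG [A e]; apply: nG; exists (c *: lsub M A).
  have <- : lsub M (lsub (invmx M) G) = G by rewrite lsub_comp mulVmx // lsub1.
  by rewrite e lsubM hF -scalerAl -scalerAr.
split=> [x x0 hx|]; first by rewrite h0 // ?nz0 ?ev0.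
exists (lsub (invmx M) G1), (lsub (invmx M) G2), d1, d2; rewrite !lsub_homog //.
do 3!split=> //; split; first exact: nm; split; first exact: nm.
move=> x x0 hx; have [k1 [k2 [o1 [o2 e]]]] := h _ (nz0 _ x0) (evz _ hx).
exists k1, k2; split; last split=> //; exact/(ordeq_lsubP _ _ _ c0' hM' hF').
Qed.

Lemma heptagon_act M L : M \in unitmx -> heptagon L -> heptagon (act7 M L).
Proof.
move=> hM [h0 [h1 h2]]; split; first by move=> i; rewrite act_line_neq0.
split=> [i j ij|i j k ij jk ik [x [x0 [hi [hj hk]]]]].
  by rewrite proj_eq_act // h1.
apply: (h2 i j k ij jk ik); exists (invmx M *m x).
by rewrite unit_mulmx_eq0 ?unitmx_inv // -!on_line_act.
Qed.

Lemma adjoint_act M c L F : F \is 4.-homog -> c != 0 -> M \in unitmx -> lsub M F = c *: F ->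
  adjoint_is L F -> adjoint_is (act7 M L) F.
Proof.
move=> homF c0 hM hF h Q hQ.
have d0 : (\det M)^-1 != 0 by rewrite invr_eq0 -unitfE -unitmxE.
have e p q : ev Q (cross (act_line M p) (act_line M q)) = 0 <-> ev (lsub M Q) (cross p q) = 0.
  rewrite act_line_cross // (ev_homogZ _ _ hQ) ev_lsub; split=> [/eqP|->]; last by rewrite mulr0.
  by rewrite mulf_eq0 expf_eq0 /= (negbTE d0) => /eqP.
have hMQ := lsub_homog M hQ.
rewrite (residual_ev _ hQ).
have -> : (forall i, ev Q (cross (act7 M L i) (act7 M L (i + 2%:R))) = 0 /\
              ev Q (cross (act7 M L i) (act7 M L (i + 3%:R))) = 0) <->
       (forall p, p \in residual_pts L -> ev (lsub M Q) p = 0).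
  rewrite (residual_ev _ hMQ); split=> hh i; have [h1 h2] := hh i;
    by split; apply/e.
rewrite (h _ hMQ); split=> [[d hd]|[d ->]]; last first.
  by exists (d * c); rewrite lsubZ hF scalerA.
exists (d * c^-1); have <- : lsub (invmx M) (lsub M Q) = Q by rewrite lsub_comp mulmxV // lsub1.
by rewrite hd lsubZ (lsub_inv_eigen c0 hM hF) scalerA.
Qed.

Lemma div_act M L x : M \in unitmx ->
  div_of_pts (residual_pts (act7 M L)) x = div_of_pts (residual_pts L) (invmx M *m x).
Proof.
move=> hM; have d0 : (\det M)^-1 != 0 by rewrite invr_eq0 -unitfE -unitmxE.
have e p q : proj_eq x (cross (act_line M p) (act_line M q)) = proj_eq (invmx M *m x) (cross p q).
  by rewrite act_line_cross // proj_eqZr // -[in RHS](proj_eqM _ _ hM) mulKVmx.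
rewrite /div_of_pts !count_residual; try by move=> u v; rewrite [cross v u]crossC proj_eqN.
by congr (Posz (_ + _)%N); apply: eq_bigr => i _; rewrite e.
Qed.

Section Relabel.
Variables (L L' : tuple7 K) (p : 'I_7 -> 'I_7).
Hypothesis p_inj : injective p.
(** Covers the dihedral relabellings together: cyclic shifts satisfy the first alternative, the
    reversal the second. Either way label differences are kept up to sign, hence so are the residual
    points. *)
Hypothesis p_add : (forall i r, p (i + r) = p i + r) \/ (forall i r, p (i + r) = p i - r).
Hypothesis LL' : forall i, proj_eq (L' i) (L (p i)).

Lemma heptagon_relabel : heptagon L -> heptagon L'.
Proof.
move=> [h0 [h1 h2]]; split; first by move=> i; case/proj_eq_neq0: (LL' i).
have on i x : on_line (L' i) x -> on_line (L (p i)) x.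
  case/proj_eqP: (LL' i) => _ [c c0 ->]; rewrite !on_lineE !mxE => h.
  by apply: (mulfI c0); rewrite mulr0 -h; ring.
split=> [i j ij|i j k ij jk ik [x [x0 [hi [hj hk]]]]].
  by rewrite (proj_eq_congl _ (LL' i)) (proj_eq_congr _ (LL' j)) h1 // (inj_eq p_inj).
apply: (h2 (p i) (p j) (p k)); rewrite ?(inj_eq p_inj) //; exists x.
by split=> //; do !split; apply: on.
Qed.

Lemma cross_relabel i j : exists2 c, c != 0 & cross (L' i) (L' j) = c *: cross (L (p i)) (L (p j)).
Proof.
case/proj_eqP: (LL' i) => _ [c c0 ->]; case/proj_eqP: (LL' j) => _ [d d0 ->].
by exists (c * d); rewrite ?mulf_neq0 // crossZ.
Qed.

Lemma p_surj j : exists i, p i = j.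
Proof. by exists (invF p_inj j); rewrite f_invF. Qed.

Lemma residual_ev_relabel Q : Q \is 4.-homog ->
  (forall q, q \in residual_pts L -> ev Q q = 0) <-> (forall q, q \in residual_pts L' -> ev Q q = 0).
Proof.
move=> hQ; rewrite !(residual_ev _ hQ).
have e i j : ev Q (cross (L' i) (L' j)) = 0 <-> ev Q (cross (L (p i)) (L (p j))) = 0.
  have [c c0 ->] := cross_relabel i j; rewrite (ev_homogZ _ _ hQ).
  split=> [/eqP|->]; last by rewrite mulr0.
  by rewrite mulf_eq0 expf_eq0 /= (negbTE c0) => /eqP.
have sw u v : ev Q (cross u v) = 0 -> ev Q (cross v u) = 0.
  by rewrite [cross v u]crossC -scaleN1r (ev_homogZ _ _ hQ) => ->; rewrite mulr0.
case: p_add => pa; split=> h i.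
- by split; apply/e; rewrite pa; case: (h (p i)).
- by have [j <-] := p_surj i; rewrite -!pa; case: (h j) => /e h1 /e h2.
- split; apply/e/sw; rewrite pa.
    by case: (h (p i - 2%:R)) => + _; rewrite subrK.
  by case: (h (p i - 3%:R)) => _; rewrite subrK.
have [j <-] := p_surj i.
split; apply/sw.
  by case: (h (j - 2%:R)) => /e + _; rewrite subrK -[X in L (p X)](subrK (- 2%:R)) opprK pa opprK subrK.
by case: (h (j - 3%:R)) => _ /e; rewrite subrK -[X in L (p X)](subrK (- 3%:R)) opprK pa opprK subrK.
Qed.

Lemma div_relabel x : div_of_pts (residual_pts L') x = div_of_pts (residual_pts L) x.
Proof.
have sw u v : proj_eq x (cross u v) = proj_eq x (cross v u) by rewrite [cross v u]crossC proj_eqN.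
have e i j : proj_eq x (cross (L' i) (L' j)) = proj_eq x (cross (L (p i)) (L (p j))).
  by have [c c0 ->] := cross_relabel i j; rewrite proj_eqZr.
rewrite /div_of_pts !count_residual //; congr (Posz _).
suff s (r : 'I_7) : (\sum_(i < 7) proj_eq x (cross (L' i) (L' (i + r)%R)))%N =
    (\sum_(i < 7) proj_eq x (cross (L i) (L (i + r)%R)))%N by rewrite (s 2%:R) (s 3%:R).
case: p_add => pa.
  by rewrite [RHS](reindex_inj p_inj) /=; apply: eq_bigr => i _; rewrite e pa.
rewrite [RHS](reindex_inj (addIr (- r))) /= [RHS](reindex_inj p_inj) /=.
by apply: eq_bigr => i _; rewrite e pa subrK sw.
Qed.

Lemma good_relabel : good_heptagon L -> good_heptagon L'.
Proof.
move=> [hL [aL tL]]; split; first exact: heptagon_relabel.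
split; first by move=> Q hQ; rewrite -residual_ev_relabel //; apply: aL.
by apply: lin_equiv_ext tL => // x; rewrite div_relabel.
Qed.
End Relabel.

Lemma good_eq7 L L' : eq7 L' L -> good_heptagon L -> good_heptagon L'.
Proof. by move=> h; apply: (@good_relabel _ _ id) => //; left. Qed.

Lemma good_shift L r : good_heptagon L -> good_heptagon (fun i => L (i + r)).
Proof.
move=> hL; apply: (@good_relabel L _ (fun i => i + r)) (hL); first exact: addIr.
  by left=> i s; rewrite addrAC.
by move=> i; apply: proj_eq_refl; exact: (proj1 (proj1 hL)).
Qed.

Lemma rev_ord_add (i r : 'I_7) : rev_ord (i + r) = rev_ord i - r.
Proof.
have e (j : 'I_7) : rev_ord j = - j - 1.
  by apply/val_inj; elim/ord7P: j; vm_compute.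
by rewrite !e opprD addrAC.
Qed.

Lemma good_rev L : good_heptagon L -> good_heptagon (rev7 L).
Proof.
move=> hL; apply: (@good_relabel L _ (@rev_ord 7)) (hL); first exact: rev_ord_inj.
  by right; apply: rev_ord_add.
by move=> i; apply: proj_eq_refl; exact: (proj1 (proj1 hL)).
Qed.

Section Basis.
Variables (L : tuple7 K) (i j k : 'I_7).
Hypotheses (hL : heptagon L) (ij : i != j) (jk : j != k) (ik : i != k).

Let B : 'M[K]_3 := \matrix_(l < 3)
  (if l == 0 then (L i)^T else if l == 1 then (L j)^T else (L k)^T).

Let rB : (row 0 B = (L i)^T) * (row 1 B = (L j)^T) * (row 2%:R B = (L k)^T).
Proof. by rewrite !rowK. Qed.

Let B_unit : B \in unitmx.
Proof.
case: hL => _ [_ h]; rewrite -unitmx_tr unitmxE unitfE; apply/negP => /det0P[w w0 hw].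
apply: (h i j k ij jk ik); exists w^T; rewrite trmx_eq0; split=> //.
have {}hw : B *m w^T = 0 by rewrite -[B]trmxK -trmx_mul hw trmx0.
have rw l : row l B *m w^T = 0 by rewrite -row_mul hw row0.
by move: (rw 0) (rw 1) (rw 2%:R); rewrite !rB.
Qed.

Lemma heptagon_indep (a b c : K) : a *: L i + b *: L j + c *: L k = 0 -> [/\ a = 0, b = 0 & c = 0].
Proof.
move=> e; pose t : 'rV[K]_3 := (col3 a b c)^T.
have tB : t *m B = 0.
  by rewrite mulmx_sum_row sum3 !rB !mxE /= -!linearZ -!linearD /= e trmx0.
have t0 : t = 0 by rewrite -[t](mulmxK B_unit) tB mul0mx.
have := congr1 (fun t : 'rV[K]_3 => (t 0 0, t 0 1, t 0 2%:R)) t0.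
by rewrite !mxE /= => -[-> -> ->].
Qed.

Lemma heptagon_span u : exists a b c, u = a *: L i + b *: L j + c *: L k.
Proof.
pose t := u^T *m invmx B; exists (t 0 0), (t 0 1), (t 0 2%:R); apply: trmx_inj.
by rewrite -[u^T](mulmxKV B_unit) mulmx_sum_row sum3 !rB -!linearZ -!linearD.
Qed.
End Basis.

(** Four sides form a projective frame: no coordinate of the fourth in the basis of the first three
    vanishes, since otherwise three sides would be dependent. The four eigenvalues therefore
    agree. *)
Lemma heptagon_fixed L (N : 'M[K]_3) : heptagon L -> (forall i, proj_eq (N *m L i) (L i)) ->
  exists2 c, c != 0 & N = c%:M.
Proof.
move=> hL h; have ei i : exists2 c, c != 0 & N *m L i = c *: L i.
  by case/proj_eqP: (h i) => _.
have [c0 n0 e0] := ei 0; have [c1 n1 e1] := ei 1; have [c2 n2 e2] := ei 2%:R; have [c3 n3 e3] := ei 3%:R.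
have [a [b [c e]]] := @heptagon_span L 0 1 2%:R hL isT isT isT (L 3%:R).
have a0 : a != 0.
  apply/eqP => a0; have [||||_ _ /eqP] := @heptagon_indep L 1 2%:R 3%:R hL _ _ _ b c (-1) => //.
    by rewrite e a0 scale0r add0r scaleN1r subrr.
  by rewrite oppr_eq0 oner_eq0.
have b0 : b != 0.
  apply/eqP => b0; have [||||_ _ /eqP] := @heptagon_indep L 0 2%:R 3%:R hL _ _ _ a c (-1) => //.
    by rewrite e b0 scale0r addr0 scaleN1r subrr.
  by rewrite oppr_eq0 oner_eq0.
have d0 : c != 0.
  apply/eqP => d0; have [||||_ _ /eqP] := @heptagon_indep L 0 1 3%:R hL _ _ _ a b (-1) => //.
    by rewrite e d0 scale0r addr0 scaleN1r subrr.
  by rewrite oppr_eq0 oner_eq0.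
have [|f0 f1 f2] := @heptagon_indep L 0 1 2%:R hL isT isT isT
    (a * (c0 - c3)) (b * (c1 - c3)) (c * (c2 - c3)).
  transitivity (N *m L 3%:R - c3 *: L 3%:R); last by rewrite e3 subrr.
  rewrite e !mulmxDr -!scalemxAr e0 e1 e2; apply/colP => l; rewrite !mxE; ring.
have eq c' (x y : K) : x != 0 -> x * (y - c') = 0 -> y = c'.
  by move=> x0 /eqP; rewrite mulf_eq0 (negbTE x0) subr_eq0 => /eqP.
exists c3 => //; apply: mx_ext => u; rewrite mul_scalar_mx.
have [a' [b' [c' ->]]] := @heptagon_span L 0 1 2%:R hL isT isT isT u.
rewrite !mulmxDr -!scalemxAr e0 e1 e2 (eq _ _ _ a0 f0) (eq _ _ _ b0 f1) (eq _ _ _ d0 f2).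
by rewrite !scalerDr !scalerA ![c3 * _]mulrC.
Qed.

Lemma heptagon_act_fixed L M : heptagon L -> M \in unitmx -> eq7 (act7 M L) L ->
  exists2 c, c != 0 & M = c%:M.
Proof.
move=> hL hM /(heptagon_fixed hL)[c c0 e]; exists c^-1; first by rewrite invr_eq0.
have {}e : invmx M = c%:M by rewrite -[LHS]trmxK e tr_scalar_mx.
by rewrite -[M]invmxK e invmx_scalar.
Qed.
End Invariance.

(** * Automorphisms *)

Section Automorphisms.
Variable K : numClosedFieldType.
Variable z : K.
Hypothesis hz : 7.-primitive_root z.
Implicit Types (M N : 'M[K]_3) (v x : vec K).
Local Notation F := (kleinF K).
Local Notation phi := (phiM z).
Local Notation tau := (tauM K).

Lemma aut_mul M N : isAut F M -> isAut F N -> isAut F (M *m N).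
Proof.
move=> [hM fM] [hN fN]; split; first by rewrite unitmx_mul hM.
by move=> x; rewrite -mulmxA -fM fN.
Qed.

Lemma aut_inv M : isAut F M -> isAut F (invmx M).
Proof.
move=> [hM fM]; split; first by rewrite unitmx_inv.
by move=> x; rewrite (fM (invmx M *m x)) mulKVmx.
Qed.

Lemma aut_scale M c : M \in unitmx -> c != 0 -> (forall v, ev F (M *m v) = c * ev F v) -> isAut F M.
Proof.
move=> hM c0 h; split=> // x; rewrite h; split=> [->|/eqP]; first by rewrite mulr0.
by rewrite mulf_eq0 (negbTE c0) => /eqP.
Qed.

Lemma aut_phik k : isAut F (phi ^+ k).
Proof. by apply: (aut_scale (phik_unit hz k) (oner_neq0 K)) => v; rewrite klein_phi // mul1r. Qed.

Lemma tauk_unit k : tau ^+ k \in unitmx.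
Proof. by rewrite -[_ \in _]/(_ \is a GRing.unit) unitrX //; apply: tau_unit. Qed.

Lemma klein_tauk k v : ev F (tau ^+ k *m v) = ev F v.
Proof. by elim: k v => [|k IH] v; rewrite ?mul1mx // exprSr -mulmxA IH klein_tau. Qed.

Lemma aut_tauk k : isAut F (tau ^+ k).
Proof. by apply: (aut_scale (tauk_unit k) (oner_neq0 K)) => v; rewrite klein_tauk // mul1r. Qed.

Lemma aut_S : isAut F (SM z).
Proof. by apply: (aut_scale (SM_unit hz) _ (klein_S hz)); rewrite pnatr_eq0. Qed.

(* Representatives of the cosets of <phi>: their values at e_1 are the 24 flexes. *)
Definition gM (g : option 'I_7 * 'I_3) : 'M[K]_3 :=
  match g.1 with None => tau ^+ g.2 | Some k => phi ^+ k *m (SM z *m tau ^+ g.2) end.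

Lemma aut_gM g : isAut F (gM g).
Proof.
case: g => -[k|] j /=; last exact: aut_tauk.
by apply: aut_mul; [apply: aut_phik | apply: aut_mul; [apply: aut_S | apply: aut_tauk]].
Qed.

Lemma tau_orbit i : exists j : 'I_3, tau ^+ j *m e_pt K 0 = e_pt K i.
Proof.
have t2 : tau *m e_pt K 0 = e_pt K 2%:R by rewrite -[RHS]tau_e; congr (_ *m e_pt K _); apply/val_inj.
have t1 : tau *m e_pt K 2%:R = e_pt K 1 by rewrite -[RHS]tau_e; congr (_ *m e_pt K _); apply/val_inj.
elim/ord3P: i; [exists 0 | exists 2%:R | exists 1]; first by rewrite mul1mx.
  by rewrite /= expr2 -[_ * _]/(tau *m tau) -mulmxA t2.
by rewrite expr1.
Qed.

Lemma tauk_e (j i : 'I_3) : exists i', tau ^+ j *m e_pt K i = e_pt K i'.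
Proof.
elim: (j : nat) i => [|k IH] i; first by exists i; rewrite mul1mx.
rewrite exprSr -mulmxA -[X in e_pt K X](subrK 1) tau_e; exact: IH.
Qed.

Lemma flex_t_inj : injective (flex_t z).
Proof.
have n01 : flex_t z 0 - flex_t z 1 != 0.
  apply: (@neq0_cert _ 6 _ (4 + 3 * z ^+ 2 + 2 * z ^+ 3 + 2 * z ^+ 4 + 3 * z ^+ 5)).
  by rewrite /flex_t /=; ring: (z6 hz).
have n02 : flex_t z 0 - flex_t z 2%:R != 0.
  apply: (@neq0_cert _ 6 _ (- 1 + z ^+ 2 + 3 * z ^+ 3 + 3 * z ^+ 4 + z ^+ 5)).
  by rewrite /flex_t /=; ring: (z6 hz).
have n12 : flex_t z 1 - flex_t z 2%:R != 0.
  apply: (@neq0_cert _ 6 _ (2 - 2 * z ^+ 2 + z ^+ 3 + z ^+ 4 - 2 * z ^+ 5)).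
  by rewrite /flex_t /=; ring: (z6 hz).
move=> i j; elim/ord3P: i; elim/ord3P: j => // e; exfalso;
  by first [move: n01; rewrite e subrr eqxx | move: n02; rewrite e subrr eqxx
           | move: n12; rewrite e subrr eqxx].
Qed.

(** The 24 flexes are told apart by invariants: xyz vanishes at the e_i only, the phi-invariant
    ratio cA / cB separates the three S e_j, and phi acts freely on each of their orbits. *)
Lemma gM_inj g g' : proj_eq (gM g *m e_pt K 0) (gM g' *m e_pt K 0) -> g = g'.
Proof.
have te (j j' : 'I_3) : proj_eq (tau ^+ j *m e_pt K 0) (tau ^+ j' *m e_pt K 0) -> j = j'.
  have t2 : tau *m e_pt K 0 = e_pt K 2%:R by rewrite -[RHS]tau_e; congr (_ *m e_pt K _); apply/val_inj.
  have t1 : tau *m e_pt K 2%:R = e_pt K 1 by rewrite -[RHS]tau_e; congr (_ *m e_pt K _); apply/val_inj.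
  have e (l : 'I_3) : tau ^+ l *m e_pt K 0 = e_pt K (- l).
    elim/ord3P: l; first by rewrite mul1mx oppr0.
      by rewrite expr1 t2; congr (e_pt K _); apply/val_inj.
    by rewrite /= expr2 -[_ * _]/(tau *m tau) -mulmxA t2 t1; congr (e_pt K _); apply/val_inj.
  by rewrite !e e_pt_proj => /eqP/oppr_inj.
have mg k (j : 'I_3) : mulX (phi ^+ k *m (SM z *m tau ^+ j) *m e_pt K 0) != 0.
  by rewrite -!mulmxA mulX_phi //; have [i' ->] := tauk_e j 0; apply: Se_mulX.
have mt (j : 'I_3) : mulX (tau ^+ j *m e_pt K 0) = 0.
  by have [i' ->] := tauk_e j 0; apply: mulX_e.
have cr v w : proj_eq v w -> mulX v = 0 -> mulX w = 0.
  by rewrite proj_eq_sym => /proj_eqP[_ [c _ ->]] h; rewrite mulXZ h mulr0.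
case: g g' => [[k|] j] [[k'|] j']; rewrite /gM /=.
- move=> h; suff jj : j = j'.
    congr (Some _, _) => //; move: h; rewrite jj -!mulmxA; apply: (phi_orbit_inj hz).
    by have [i' ->] := tauk_e j' 0; apply: Se_mulX.
  apply: te; have [i hi] := tauk_e j 0; have [i' hi'] := tauk_e j' 0.
  rewrite hi hi'; move: h; rewrite -!mulmxA hi hi' => h; suff -> : i = i' by rewrite e_pt_proj.
  apply: flex_t_inj; case/proj_eqP: h => _ [c c0].
  move=> e; have := congr1 (fun v => cA v) e; have := congr1 (fun v => cB v) e.
  rewrite !cABZ !cA_phi // !cB_phi // !(Se_flex hz) => -> h.
  have [y0 y1 y2] := mulX_neq0 (Se_mulX hz i').
  have n0 : c ^+ 4 * cB (SM z *m e_pt K i') != 0 by rewrite /cB; nz.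
  by apply: (mulIf n0); rewrite h; ring.
- by rewrite proj_eq_sym => /cr/(_ (mt _)) h; move: (mg k j); rewrite h eqxx.
- by move/cr/(_ (mt _)) => h; move: (mg k' j'); rewrite h eqxx.
- by move/te => ->.
Qed.

Lemma kleinF_e02 (s t : K) : ev F (s *: e_pt K 0 + t *: e_pt K 2%:R) = s * t ^+ 3.
Proof. by rewrite !e_ptE ev_kleinF !mxE /=; ring. Qed.

Lemma kleinF_e21 (s t : K) : ev F (s *: e_pt K 2%:R + t *: e_pt K 1) = s * t ^+ 3.
Proof. by rewrite !e_ptE ev_kleinF !mxE /=; ring. Qed.

Lemma kleinF_e10 (s t : K) : ev F (s *: e_pt K 1 + t *: e_pt K 0) = s * t ^+ 3.
Proof. by rewrite !e_ptE ev_kleinF !mxE /=; ring. Qed.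

Lemma linear_cubic (d l m n c : K) : c != 0 -> d != 0 ->
  (forall s, (s * d + l) ^+ 3 * m + m ^+ 3 * n + n ^+ 3 * (s * d + l) = c * s) ->
  m = 0 /\ l = 0.
Proof.
move=> c0 d0 h; have n6 : 6%:R != 0 :> K by rewrite pnatr_eq0.
have m0 : m = 0.
  have nd : 6%:R * d ^+ 3 != 0 by nz.
  apply: (mulfI nd); rewrite mulr0.
  (* The third finite difference over s = -1, 0, 1, 2 isolates the leading term 6 d^3 m. *)
  transitivity (c * 2%:R - 3%:R * (c * 1) + 3%:R * (c * 0) - c * (-1)); last by ring.
  by rewrite -!h; ring.
move: h; rewrite m0 => h; split=> //.
have n0 : n != 0.
  apply: contraNneq c0 => n0; have := h 1; by rewrite n0 mulr1 => <-; apply/eqP; ring.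
have n3 : n ^+ 3 != 0 by nz.
by apply: (mulfI n3); transitivity (c * 0); [rewrite -h; ring | rewrite !mulr0].
Qed.

(** The flex tangent at e_1 meets the curve again at e_3, and the one at e_3 meets it again at e_2.
    Hence N fixes all three e_i and is diagonal. Comparing the three coefficients of F gives d n^3 =
    n m^3 = m d^3, which makes m / n a seventh root of unity and d / n its cube. *)
Lemma stab_e0 N c : c != 0 -> N \in unitmx -> (forall v, ev F (N *m v) = c * ev F v) ->
  proj_eq (N *m e_pt K 0) (e_pt K 0) -> exists (d : K) (k : 'I_7), d != 0 /\ N = d *: phi ^+ k.
Proof.
move=> c0 hN hF /proj_eqP[_ [d d0 e0]].
have nN i : N *m e_pt K i != 0 by rewrite unit_mulmx_eq0 // e_pt_neq0.
have [n e2] : exists n, N *m e_pt K 2%:R = n *: e_pt K 2%:R.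
  move E : (N *m e_pt K 2%:R) => u; have [|m0 l0] := @linear_cubic d (u 0 0) (u 1 0) (u 2%:R 0) c c0 d0.
    move=> s; have := hF (s *: e_pt K 0 + 1 *: e_pt K 2%:R).
    rewrite kleinF_e02 mulmxDr -!scalemxAr e0 E e_ptE ev_kleinF !mxE /= => h.
    by transitivity (c * (s * 1 ^+ 3)); [rewrite -h; ring | ring].
  by exists (u 2%:R 0); rewrite e_ptE col3Z [LHS]col3P m0 l0 !mulr0 mulr1.
have n0 : n != 0 by apply: contraNneq (nN 2%:R) => n0; rewrite e2 n0 scale0r.
have [m e1] : exists m, N *m e_pt K 1 = m *: e_pt K 1.
  move E : (N *m e_pt K 1) => u; have [|m0 l0] := @linear_cubic n (u 2%:R 0) (u 0 0) (u 1 0) c c0 n0.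
    move=> s; have := hF (s *: e_pt K 2%:R + 1 *: e_pt K 1).
    rewrite kleinF_e21 mulmxDr -!scalemxAr e2 E e_ptE ev_kleinF !mxE /= => h.
    by transitivity (c * (s * 1 ^+ 3)); [rewrite -h; ring | ring].
  by exists (u 1 0); rewrite e_ptE col3Z [LHS]col3P m0 l0 !mulr0 mulr1.
have m0 : m != 0 by apply: contraNneq (nN 1) => m0; rewrite e1 m0 scale0r.
have f1 : d * n ^+ 3 = c.
  have := hF (1 *: e_pt K 0 + 1 *: e_pt K 2%:R); rewrite mulmxDr -!scalemxAr e0 e2 !scale1r.
  by rewrite kleinF_e02 => ->; rewrite -[X in ev F (X + _)]scale1r -[X in ev F (_ + X)]scale1r kleinF_e02; ring.
have f2 : n * m ^+ 3 = c.
  have := hF (1 *: e_pt K 2%:R + 1 *: e_pt K 1); rewrite mulmxDr -!scalemxAr e2 e1 !scale1r.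
  by rewrite kleinF_e21 => ->; rewrite -[X in ev F (X + _)]scale1r -[X in ev F (_ + X)]scale1r kleinF_e21; ring.
have f3 : m * d ^+ 3 = c.
  have := hF (1 *: e_pt K 1 + 1 *: e_pt K 0); rewrite mulmxDr -!scalemxAr e1 e0 !scale1r.
  by rewrite kleinF_e10 => ->; rewrite -[X in ev F (X + _)]scale1r -[X in ev F (_ + X)]scale1r kleinF_e10; ring.
pose t := m / n; pose s := d / n.
have em : m = t * n by rewrite /t divfK.
have ed : d = s * n by rewrite /s divfK.
have st : s = t ^+ 3.
  have n4 : n ^+ 4 != 0 by nz.
  by apply: (mulfI n4); transitivity (n * m ^+ 3); [rewrite f2 -f1 ed | rewrite em]; ring.
have t0 : t != 0 by rewrite /t; nz.
have t7 : t ^+ 7 = 1.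
  have n4 : n ^+ 4 * t ^+ 3 != 0 by nz.
  apply: (mulfI n4); rewrite mulr1; transitivity (m * d ^+ 3); first by rewrite em ed st; ring.
  by rewrite f3 -f2 em; ring.
have [k tk] := root7 hz t7; pose k0 : 'I_7 := inord (k %% 7).
have {}tk : t = z ^+ k0 by rewrite inordK ?ltn_mod // (prim_expr_mod hz).
exists (n / z ^+ k0), k0; have z0 := zi_neq0 hz k0.
split; first by nz.
apply: mx_ext => v; rewrite -scalemxAl phik_col -tk.
have ev0 : v = v 0 0 *: e_pt K 0 + v 1 0 *: e_pt K 1 + v 2%:R 0 *: e_pt K 2%:R.
  by rewrite !e_ptE !col3Z !col3D [LHS]col3P; congr col3; ring.
rewrite [in LHS]ev0 !mulmxDr -!scalemxAr e0 e1 e2 !e_ptE !col3Z !col3D em ed st.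
by congr col3; field.
Qed.

Section Classification.
Variable R : vec K.
Hypothesis R_neq0 : R != 0.
Hypothesis F_R : ev (kleinF K) R = 0.
Hypothesis R_ne : forall i, ~~ proj_eq R (e_pt K i).
Hypothesis F_psiR : ev (kleinF K) (psiM z *m R) = 0.
Local Notation P := (kleinP z R).

(* [F o M] is a quartic vanishing on the residual points of [P], which determine the curve. *)
Lemma aut_eigen M : isAut F M -> exists2 c, c != 0 & lsub M F = c *: F.
Proof.
move=> [hM fM]; have hQ := lsub_homog M (kleinF_homog K).
have [c e] : exists c, lsub M F = c *: F.
  apply/(adjoint_P hz R_neq0 F_R R_ne F_psiR hQ) => p hp; rewrite ev_lsub; apply/(iffLR (fM p)).
  have [_ h] := adjoint_P hz R_neq0 F_R R_ne F_psiR (kleinF_homog K).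
  by apply: (h _ p hp); exists 1; rewrite scale1r.
exists c => //; apply/eqP => c0; have : ev F (M *m (invmx M *m col3 1 1 1)) = 0.
  by rewrite -ev_lsub e c0 scale0r /ev meval0.
rewrite mulKVmx // ev_kleinF !col3E => /eqP; rewrite (_ : _ + _ = 3%:R) ?pnatr_eq0 //.
by ring.
Qed.

Lemma aut_classify M : isAut F M ->
  exists (d : K) g (k : 'I_7), d != 0 /\ M = d *: (gM g *m phi ^+ k).
Proof.
move=> hM; have [c c0 e] := aut_eigen hM.
have eM v : ev F (M *m v) = c * ev F v by rewrite -ev_lsub e evZ.
have [g hg] : exists g, proj_eq (M *m e_pt K 0) (gM g *m e_pt K 0).
  have [|[i hi]|[k [j hk]]] := @flex_point _ z hz (M *m e_pt K 0) (M *m e_pt K 2%:R) c c0.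
  - by move=> s t; rewrite !scalemxAr -mulmxDr eM kleinF_e02; ring.
  - by have [j hj] := tau_orbit i; exists (None, j); rewrite /gM /= hj.
  have [i hi] := tau_orbit j; pose k0 : 'I_7 := inord (k %% 7); exists (Some k0, i).
  rewrite /gM /= -!mulmxA hi; rewrite (_ : phi ^+ k0 *m _ = phi ^+ k *m (SM z *m e_pt K j)) //.
  by rewrite !phik_col inordK ?ltn_mod // (prim_expr_mod hz).
have [hgu _] := aut_gM g; have [b b0 eb] := aut_eigen (aut_inv (aut_gM g)).
have [hMu _] := hM.
have [||||d [k [d0 ek]]] := @stab_e0 (invmx (gM g) *m M) (b * c).
- by rewrite mulf_neq0.
- by rewrite unitmx_mul unitmx_inv hgu.
- by move=> v; rewrite -mulmxA -ev_lsub eb evZ eM mulrA.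
- by rewrite -(proj_eqM _ _ hgu) !mulmxA mulmxV // mul1mx.
by exists d, g, k; split=> //; rewrite scalemxAr -ek mulKVmx.
Qed.

Lemma eta_inv M : M \in unitmx -> (forall i, exists i', M *m e_pt K i = e_pt K i') ->
  (forall i, exists i', proj_eq (invmx M *m e_pt K i) (e_pt K i')) ->
  forall v, eta_sym_div (M *m v) = eta_sym_div v.
Proof.
move=> hM h h' v; have [i hi|n] := pickP (fun i => proj_eq v (e_pt K i)).
  have [i' e] := h i; rewrite (eta_e hi) (eta_e (i := i')) // -e.
  by rewrite proj_eqM.
have -> : eta_sym_div v = 0 by apply: eta_0 => -[i hi]; rewrite n in hi.
apply: eta_0 => -[i hi].
have [i' e] := h' i; have := n i'.
by rewrite -(proj_eq_congr _ e) -(proj_eqM _ _ hM) mulKVmx // hi.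
Qed.

Lemma eta_phik k v : eta_sym_div (phi ^+ k *m v) = eta_sym_div v.
Proof.
have pe i : proj_eq (phi ^+ k *m e_pt K i) (e_pt K i).
  have z0 := z_neq0 hz; apply/proj_eqP; split; first exact: e_pt_neq0.
  elim/ord3P: i; rewrite phik_col !e_ptE !col3E.
  - by exists (z ^+ k ^+ 4); [nz | rewrite col3Z !(mulr0, mulr1)].
  - by exists (z ^+ k ^+ 2); [nz | rewrite col3Z !(mulr0, mulr1)].
  by exists (z ^+ k); [nz | rewrite col3Z !(mulr0, mulr1)].
have [i hi|n] := pickP (fun i => proj_eq v (e_pt K i)).
  rewrite (eta_e hi) (eta_e (i := i)) //.
  by rewrite -(proj_eq_congr _ (pe i)) proj_eqM // phik_unit.
have -> : eta_sym_div v = 0 by apply: eta_0 => -[i hi]; rewrite n in hi.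
apply: eta_0 => -[i hi].
by have := n i; rewrite -(proj_eqM _ _ (phik_unit hz k)) (proj_eq_congr _ (pe i)) hi.
Qed.

Lemma eta_tau v : eta_sym_div (tau *m v) = eta_sym_div v.
Proof.
apply: eta_inv; first exact: tau_unit.
  by move=> i; exists (i - 1); rewrite -[X in e_pt K X](subrK 1) tau_e.
move=> i; exists (i + 1); rewrite -(tau_e K i) mulKmx ?tau_unit //.
exact/proj_eq_refl/e_pt_neq0.
Qed.

Lemma eta_tauk k v : eta_sym_div (tau ^+ k *m v) = eta_sym_div v.
Proof. by elim: k v => [|k IH] v; rewrite ?mul1mx // exprSr -mulmxA IH eta_tau. Qed.

(** S conjugates tau to its inverse tau^2, and tau permutes the e_i. *)
Lemma eta_S_tauk k v : eta_sym_div (SM z *m (tau ^+ k *m v)) = eta_sym_div (SM z *m v).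
Proof.
elim: k => [|k IH]; first by rewrite mul1mx.
rewrite -IH exprS -[tau * _]/(tau *m _) -mulmxA; set w := tau ^+ k *m v.
have -> : SM z *m (tau *m w) = tau *m (tau *m (SM z *m w)).
  by rewrite !tauM_col !SM_col !col3E; congr col3; ring.
by rewrite !eta_tau.
Qed.

Lemma good_P : good_heptagon P.
Proof.
split; first exact: heptagon_P; split; first exact: adjoint_P.
exact: thetaP_e.
Qed.

(** The pullback of 2 sum e_i by tau^j is itself, and by phi^k S tau^j it is the S-translate.
    Transporting [thetaP_e] in the first case and [thetaP_S] in the second therefore ends at 2 sum
    e_i. *)
Lemma good_gM g : good_heptagon (act7 (gM g) P).
Proof.
have [hM _] := aut_gM g; have [c c0 e] := aut_eigen (aut_gM g).
have [hL [aL _]] := good_P.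
split; first exact: heptagon_act.
split; first exact: (adjoint_act (kleinF_homog K) c0 hM e).
case: g hM e => -[k|] j hM e.
  have := lin_equiv_act c0 hM e (thetaP_S hz R_neq0 F_R R_ne F_psiR).
  apply: lin_equiv_ext => x; first by rewrite div_act.
  rewrite -[in RHS](mulKVmx hM x); set y := invmx _ *m x.
  by rewrite /gM /= -!mulmxA eta_phik eta_S_tauk.
have := lin_equiv_act c0 hM e (thetaP_e hz R_neq0 F_R R_ne F_psiR).
apply: lin_equiv_ext => x; first by rewrite div_act.
by rewrite -[in RHS](mulKVmx hM x) eta_tauk.
Qed.

Lemma act_phik_P (k : nat) (i : 'I_7) : act_line (phi ^+ k) (P i) = P (i + k%:R).
Proof.
elim: k => [|k IH]; first by rewrite (_ : phi ^+ 0 = 1%:M) // /act_line invmx1 trmx1 mul1mx addr0.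
rewrite exprS -[_ * _]/(phi *m _) -act_lineM ?phik_unit ?(phi_unit hz) // IH act_phi_P //.
by rewrite -addrA -natr1.
Qed.

Lemma act_aut_P d g (k : 'I_7) i : d != 0 ->
  act7 (d *: (gM g *m phi ^+ k)) P i = d^-1 *: act7 (gM g) P (i + k).
Proof.
move=> d0; have [hM _] := aut_gM g.
rewrite /act7 act_lineZ // ?unitmx_mul ?hM ?phik_unit // -act_lineM ?phik_unit //.
by rewrite act_phik_P natr_Zp.
Qed.

Lemma good_aut M : isAut F M -> good_heptagon (act7 M P).
Proof.
move=> /aut_classify[d [g [k [d0 ->]]]].
apply: good_eq7 (good_shift k (good_gM g)) => i.
rewrite act_aut_P // proj_eqZ ?invr_eq0 //.
by case: (good_gM g) => -[+ _] _; apply.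
Qed.

End Classification.
End Automorphisms.

(** * Counting orbits *)

Lemma n_classes_fin (T : Type) (A : T -> Prop) (eqv : T -> T -> Prop) (I : finType) (s : I -> T) n :
  #|I| = n -> (forall i, A (s i)) -> (forall i j, eqv (s i) (s j) -> i = j) ->
  (forall x, A x -> exists i, eqv x (s i)) -> n_classes A eqv n.
Proof.
move=> <- hA hinj hsurj; exists (s \o enum_val); split; first by move=> i; apply: hA.
split=> [i j /hinj/enum_val_inj //|x /hsurj[i hi]].
by exists (enum_rank i); rewrite /= enum_rankK.
Qed.

Section Counting.
Variable K : numClosedFieldType.
Implicit Types (L : tuple7 K) (M N : 'M[K]_3).

Lemma eq7_sym L L' : eq7 L L' -> eq7 L' L.
Proof. by move=> h i; rewrite proj_eq_sym. Qed.

Lemma eq7_trans L2 L1 L3 : eq7 L1 L2 -> eq7 L2 L3 -> eq7 L1 L3.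
Proof. by move=> h h' i; apply: proj_eq_trans (h i) (h' i). Qed.

Lemma eq7_act M L L' : M \in unitmx -> eq7 L L' -> eq7 (act7 M L) (act7 M L').
Proof. by move=> hM h i; rewrite proj_eq_act. Qed.

Lemma act7_faithful L M N : heptagon L -> M \in unitmx -> N \in unitmx ->
  eq7 (act7 M L) (act7 N L) -> exists2 c, c != 0 & M = c *: N.
Proof.
move=> hL hM hN h; have hN' : invmx N \in unitmx by rewrite unitmx_inv.
have [||c c0 e] := @heptagon_act_fixed K L (invmx N *m M) hL.
- by rewrite unitmx_mul hN'.
- move=> i; rewrite /act7 -act_lineM //; have := eq7_act hN' h i.
  rewrite /act7 [act_line _ (act_line N _)]act_lineM // mulVmx //.
  by rewrite /act_line invmx1 trmx1 mul1mx.
exists c => //; by rewrite -[LHS](mulKVmx hN) e mul_mx_scalar.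
Qed.

Variable z : K.
Hypothesis hz : 7.-primitive_root z.
Variable R : vec K.
Hypothesis R_neq0 : R != 0.
Hypothesis F_R : ev (kleinF K) R = 0.
Hypothesis R_ne : forall i, ~~ proj_eq R (e_pt K i).
Hypothesis F_psiR : ev (kleinF K) (psiM z *m R) = 0.
Local Notation F := (kleinF K).
Local Notation phi := (phiM z).
Local Notation P := (kleinP z R).

Let hepP : heptagon P := heptagon_P hz R_neq0 F_R R_ne.
Let P0 i : P i != 0. Proof. by case: hepP. Qed.

Definition repM (a : (option 'I_7 * 'I_3) * 'I_7) : 'M[K]_3 := gM z a.1 *m phi ^+ a.2.

Lemma aut_repM a : isAut F (repM a).
Proof. by apply: aut_mul; [apply: aut_gM | apply: aut_phik]. Qed.

Lemma repM_inj a b c : c != 0 -> repM a = c *: repM b -> a = b.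
Proof.
move=> c0 e; case: a b e => [g k] [g' k'] e.
have pe (j : 'I_7) : exists2 d, d != 0 & phi ^+ j *m e_pt K 0 = d *: e_pt K 0.
  exists (z ^+ j ^+ 4); first by rewrite expf_neq0 // zi_neq0.
  by rewrite phik_col !e_ptE !col3E col3Z !(mulr0, mulr1).
have gg : g = g'.
  apply: (gM_inj hz); have [d d0 e1] := pe k; have [d' d0' e1'] := pe k'.
  have := congr1 (fun M => M *m e_pt K 0) e; rewrite /repM /= -!scalemxAl -!mulmxA e1 e1' -!scalemxAr scalerA => e2.
  rewrite -(proj_eqZl _ _ d0) e2 proj_eqZ ?mulf_neq0 //.
  by rewrite unit_mulmx_eq0 ?e_pt_neq0 //; case: (aut_gM hz g').
rewrite -gg in e *; congr (_, _); have [hg _] := aut_gM hz g.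
have m : mulX (col3 1 1 1 : vec K) != 0 by rewrite /mulX !col3E !mulr1 oner_eq0.
apply: (phi_orbit_inj hz m); apply/proj_eqP; split.
  rewrite unit_mulmx_eq0 ?phik_unit //; apply: contraNneq m => ->.
  by rewrite /mulX !mxE !mul0r.
exists c => //; have := congr1 (mulmx (invmx (gM z g))) e.
by rewrite /repM /= -scalemxAr !mulKmx // => ->; rewrite -scalemxAl.
Qed.

Lemma repM_surj M : isAut F M -> exists a c, c != 0 /\ M = c *: repM a.
Proof.
move=> /(aut_classify hz R_neq0 F_R R_ne F_psiR)[d [g [k [d0 e]]]].
by exists (g, k), d.
Qed.

Lemma card_rep : #|{: (option 'I_7 * 'I_3) * 'I_7}| = 168.
Proof. by rewrite !card_prod card_option !card_ord. Qed.

Lemma eq7_scale c M L : c != 0 -> M \in unitmx -> (forall i, L i != 0) ->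
  eq7 (act7 (c *: M) L) (act7 M L).
Proof.
by move=> c0 hM h i; rewrite /act7 act_lineZ // proj_eqZ ?invr_eq0 // act_line_neq0.
Qed.

Lemma orbit_rep L Q : (forall i, L i != 0) -> orbit7 L Q -> exists a, eq7 Q (act7 (repM a) L).
Proof.
move=> h [M [hM e]]; have [a [c [c0 eM]]] := repM_surj hM; exists a.
apply: eq7_trans e _; rewrite eM; apply: eq7_scale => //.
by case: (aut_repM a).
Qed.

Lemma eq7_refl L : (forall i, L i != 0) -> eq7 L L.
Proof. by move=> h i; apply: proj_eq_refl. Qed.

Lemma orbit_act L a : (forall i, L i != 0) -> orbit7 L (act7 (repM a) L).
Proof.
move=> h; exists (repM a); split; first exact: aut_repM.
apply: eq7_refl => i; rewrite act_line_neq0 //; by case: (aut_repM a).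
Qed.

Lemma act_rep_inj L a b : heptagon L -> eq7 (act7 (repM a) L) (act7 (repM b) L) -> a = b.
Proof.
move=> hL h; have [ha _] := aut_repM a; have [hb _] := aut_repM b.
by have [c c0] := act7_faithful hL ha hb h; apply: repM_inj.
Qed.

Lemma orbit_168 : n_classes (orbit7 P) (@eq7 K) 168.
Proof.
apply: (n_classes_fin (s := fun a => act7 (repM a) P) card_rep).
- by move=> a; apply: orbit_act.
- by move=> a b; apply: act_rep_inj.
by move=> Q; apply: orbit_rep.
Qed.

(** A factor phi^k on the right only shifts the labels by k, so among the 168 representatives cyclic
    relabelling forgets exactly this factor. *)
Lemma orbit_cyc_24 : n_classes (orbit7 P) (@eq7_cyc K) 24.
Proof.
have e g (k : 'I_7) i : act7 (repM (g, k)) P i = act7 (gM z g) P (i + k).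
  have [hg _] := aut_gM hz g.
  by rewrite /act7 /repM -act_lineM ?phik_unit //= act_phik_P // natr_Zp.
apply: (@n_classes_fin _ _ _ (option 'I_7 * 'I_3)%type (fun g => act7 (gM z g) P)).
- by rewrite card_prod card_option !card_ord.
- move=> g; have := orbit_act (g, 0) P0; rewrite /repM /=.
  by rewrite (_ : phi ^+ 0 = 1%:M) // mulmx1.
- move=> g g' [r h]; suff : (g, 0 : 'I_7) = (g', r) by case.
  by apply: (act_rep_inj hepP) => i; rewrite !e addr0.
by move=> Q /(orbit_rep P0)[[g k] h]; exists g, k => i; rewrite -e.
Qed.

Definition phiI : 'M[K]_3 := diag_mx (\row_(i < 3) [:: z ^+ 3; z ^+ 5; z ^+ 6]`_i).

Lemma phiIK : phiI *m phi = 1%:M.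
Proof.
apply: mx_ext => v; rewrite -mulmxA phiM_col mul1mx mulmx3 !col3E [RHS]col3P !mxE /=.
by rewrite !mulr1n !mulr0n !mul0r !addr0 !add0r; congr col3; ring: (z7 hz).
Qed.

(* Reversing the labels would conjugate [phi] to its inverse up to a cube root of unity. *)
Lemma no_reversal M N : M \in unitmx -> N \in unitmx -> ~ eq7 (act7 M P) (act7 N (rev7 P)).
Proof.
move=> hM hN h; have hN' : invmx N \in unitmx by rewrite unitmx_inv.
pose T := invmx N *m M; have hT : T \in unitmx by rewrite unitmx_mul hN'.
have hphi := phi_unit hz.
have hTP i : proj_eq (act_line T (P i)) (P (rev_ord i)).
  have := eq7_act hN' h i; rewrite /act7 /rev7 !act_lineM // mulVmx //.
  by rewrite {2}/act_line invmx1 trmx1 mul1mx.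
clearbody T.
(* If T reverses the labels, then phi T phi moves label i to i + 1, then to rev i - 1, then to rev
   i, as T itself does. By faithfulness phi T phi = c T. *)
have [|||c c0 e] := @act7_faithful P (phi *m T *m phi) T hepP.
- by rewrite !unitmx_mul hphi hT.
- by [].
- move=> i; rewrite /act7 -!act_lineM ?unitmx_mul ?hphi // act_phi_P //.
  have er : P (rev_ord i) = act_line phi (P (rev_ord i - 1)) by rewrite act_phi_P // subrK.
  rewrite (proj_eq_congr _ (hTP i)) er.
  by rewrite proj_eq_act // (proj_eq_congl _ (hTP _)) rev_ord_add proj_eq_refl.
have d1 : \det phi = 1.
  by rewrite det_diag prod3 !mxE /= -[RHS](z7 hz); ring.
have c3 : c ^+ 3 = 1.
  have dT : \det T != 0 by rewrite -unitfE -unitmxE.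
  apply: (mulIf dT); rewrite -detZ -e !det_mulmx d1; ring.
(* Thus T phi T^-1 = c phi^-1. Traces are compared and then cubed, which removes c. *)
have tr : \tr phi = c * \tr phiI.
  have e1 : T *m phi *m invmx T = c *: phiI.
    have <- : phiI *m (phi *m T *m phi) = T *m phi by rewrite !mulmxA phiIK mul1mx.
    by rewrite e -scalemxAr -scalemxAl mulmxK.
  by rewrite -[in RHS]mxtraceZ -e1 mxtrace_mulC mulmxA mulVmx // mul1mx.
(* The two sums have sum -1 and product 2, so the difference of their cubes is minus their
   difference, a square root of -7. *)
have : (z + z ^+ 2 + z ^+ 4) ^+ 3 - (z ^+ 3 + z ^+ 5 + z ^+ 6) ^+ 3 != 0.
  apply: (@neq0_cert _ 6 _ (1 + 2 * z + 2 * z ^+ 2 + 2 * z ^+ 4)).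
  by ring: (z6 hz).
move: tr; rewrite !mxtrace_diag !sum3 !mxE /= => tr.
have -> : z + z ^+ 2 + z ^+ 4 = c * (z ^+ 3 + z ^+ 5 + z ^+ 6) by rewrite -tr; ring.
by rewrite exprMn c3 mul1r subrr eqxx.
Qed.

Lemma orbits_336 : n_classes (fun Q => orbit7 P Q \/ orbit7 (rev7 P) Q) (@eq7 K) 336.
Proof.
have hrev : heptagon (rev7 P) by case: (good_rev (good_P hz R_neq0 F_R R_ne F_psiR)).
have rev0 i : rev7 P i != 0 by exact: P0.
pose L (b : bool) := if b then rev7 P else P.
have hL b : heptagon (L b) by case: b.
apply: (@n_classes_fin _ _ _ (bool * ((option 'I_7 * 'I_3) * 'I_7))%type
  (fun x => act7 (repM x.2) (L x.1))).
- by rewrite card_prod card_bool card_rep.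
- by case=> -[] a; [right | left]; apply: orbit_act.
- move=> [b a] [b' a'] /= h; have [ha _] := aut_repM a; have [ha' _] := aut_repM a'.
  case: b b' h => [] [] /= h.
  + by rewrite (act_rep_inj hrev h).
  + by case: (no_reversal ha' ha (eq7_sym h)).
  + by case: (no_reversal ha ha' h).
  by rewrite (act_rep_inj hepP h).
move=> Q [] /orbit_rep[] // a h; first by exists (false, a).
by exists (true, a).
Qed.

Lemma orbits_good Q : orbit7 P Q \/ orbit7 (rev7 P) Q -> good_heptagon Q.
Proof.
have hg M := @good_aut K z hz R R_neq0 F_R R_ne F_psiR M.
case=> -[M [hM h]]; apply: good_eq7 h _; first exact: hg.
exact: (good_rev (hg M hM)).
Qed.

End Counting.

Theorem theorem5p4 (K : numClosedFieldType) (z : K) (R1 : vec K) :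
  7.-primitive_root z ->
  R1 != 0 -> ev (kleinF K) R1 = 0 ->
  (forall i, ~~ proj_eq R1 (e_pt K i)) ->
  ev (kleinF K) (psiM z *m R1) = 0 ->
  let P := kleinP z R1 in
  (* (1) *)
  ((forall M, isAut (kleinF K) M -> good_heptagon (act7 M P)) /\
   (forall M N, isAut (kleinF K) M -> isAut (kleinF K) N ->
      eq7 (act7 N (act7 M P)) (act7 M P) -> is_scalar_proj N) /\
   (forall i, proj_eq (act_line (phiM z) (P i)) (P (i + 1))) /\
   n_classes (orbit7 P) (@eq7 K) 168 /\
   n_classes (orbit7 P) (@eq7_cyc K) 24) /\
  (* (2) *)
  ((forall Q, orbit7 P Q \/ orbit7 (rev7 P) Q -> good_heptagon Q) /\
   n_classes (fun Q => orbit7 P Q \/ orbit7 (rev7 P) Q) (@eq7 K) 336).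
Proof.
move=> hz R0 FR Rne FpsiR P; split; [split; [|split; [|split; [|split]]] | split].
- by move=> M; apply: good_aut.
- move=> M N hM [hN _] h; have [hL _] := good_aut hz R0 FR Rne FpsiR hM.
  by have [c _ ->] := heptagon_act_fixed hL hN h; exists c.
- by move=> i; rewrite act_phi_P // proj_eq_refl //; apply: P_neq0.
- exact: orbit_168.
- exact: orbit_cyc_24.
- exact: orbits_good.
exact: orbits_336.
Qed.
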